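(* Let $d\in\{1,2\}$ and let $v_0\in\mathscr{A}^0(\mathbb{T}^d)$ be real-valued with $\int_{\mathbb{T}^d}v_0\,dx=0$, $|v_0|_0<1$, and such that the value $$\delta(|v_0|_0)=6-\frac{3}{(1-|v_0|_0)^4}\left(1+28\frac{|v_0|_0}{1-|v_0|_0}+120\frac{|v_0|_0^2}{(1-|v_0|_0)^2}+120\frac{|v_0|_0^3}{(1-|v_0|_0)^3}\right)$$ satisfies $\delta(|v_0|_0)>0$. Then there exists at least one global weak solution $v$ (in the sense defined in the context, on $[0,T]$ for every $T>0$) of $$\partial_tv=\Delta^2\left(\frac{1}{(1+v)^3}\right),\qquad v(0,x)=v_0(x),$$ having, for every $T>0$, the regularity $$v\in L^\infty([0,T]\times\mathbb{T}^d)\cap L^{4/3}(0,T;W^{3,\infty}(\mathbb{T}^d))\cap\mathcal{M}(0,T;W^{4,\infty}(\mathbb{T}^d))\cap L^2(0,T;\mathscr{H}^2(\mathbb{T}^d)).$$ Furthermore, for every $T>0$, $v\in C([0,T];L^2(\mathbb{T}^d))$ and $$\|v(t)\|_{L^\infty}\le|v_0|_0\,e^{-\delta(|v_0|_0)t}\qquad\text{for all }t\in[0,T].$$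
   Context: $\mathbb{T}^d=[-\pi,\pi]^d$ is the $d$-dimensional torus (periodic boundary conditions). Fourier coefficients: $\widehat u(k)=(2\pi)^{-d}\int_{\mathbb{T}^d}u(x)e^{-ix\cdot k}\,dx$, $k\in\mathbb{Z}^d$. For $\alpha\ge0$: $\mathscr{A}^\alpha(\mathbb{T}^d)=\{u\in L^1(\mathbb{T}^d):|u|_\alpha:=\sum_{k\in\mathbb{Z}^d}|k|^\alpha|\widehat u(k)|<\infty\}$ and $\mathscr{H}^\alpha(\mathbb{T}^d)=\{u\in L^2(\mathbb{T}^d):\|u\|_{\mathscr{H}^\alpha}^2:=\sum_{k\in\mathbb{Z}^d}|k|^{2\alpha}|\widehat u(k)|^2<\infty\}$ (with $|0|^0=1$). $W^{n,p}(\mathbb{T}^d)$ is the usual Sobolev space, and $\mathcal{M}(0,T;X)$ is the space of Radon measures on $[0,T]$ with values in the Banach space $X$. Weak solution: $v\in L^\infty(0,T;L^\infty(\mathbb{T}^d))$ is a weak solution on $[0,T]$ of $\partial_tv=\Delta^2\big((1+v)^{-3}\big)$ with initial data $v_0$ if $$\int_{\mathbb{T}^d}\varphi(0,x)v_0(x)\,dx+\int_0^T\int_{\mathbb{T}^d}\Big(\partial_t\varphi(t,x)\,v(t,x)+\frac{\Delta^2\varphi(t,x)}{(1+v(t,x))^3}\Big)\,dx\,dt=0$$ for all $\varphi\in C^\infty([0,T)\times\mathbb{T}^d)$ with compact support in $[0,T)\times\mathbb{T}^d$. *)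

(* Defs.v *)
From HB Require Import structures.
From mathcomp Require Import all_boot all_order all_algebra.
From mathcomp Require Import complex.
From mathcomp Require Import all_classical all_reals all_analysis.

Set Implicit Arguments.
Unset Strict Implicit.
Unset Printing Implicit Defensive.

Import Order.TTheory GRing.Theory Num.Def Num.Theory.
Import numFieldNormedType.Exports.

Local Open Scope classical_set_scope.
Local Open Scope ring_scope.

Definition rV_display (disp : measure_display) : measure_display.
Proof. exact. Qed.

Section measurable_rV.
Context (disp : measure_display) (S : measurableType disp) (n : nat).

Definition rV_coord (i : 'I_n) (x : 'rV[S]_n) : S := x ord0 i.

Let rV_set0 : g_sigma_preimage rV_coord set0.
Proof. exact: sigma_algebra0. Qed.

Let rV_setC A : g_sigma_preimage rV_coord A -> g_sigma_preimage rV_coord (~` A).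
Proof. exact: sigma_algebraC. Qed.

Let rV_bigcup (F : _^nat) : (forall i, g_sigma_preimage rV_coord (F i)) ->
  g_sigma_preimage rV_coord (\bigcup_i (F i)).
Proof. exact: sigma_algebra_bigcup. Qed.

HB.instance Definition _ := @isMeasurable.Build (rV_display disp)
  'rV[S]_n (g_sigma_preimage rV_coord) rV_set0 rV_setC rV_bigcup.

End measurable_rV.

Section torus_measure.
Context (R : realType).

Definition interval_measure (a b : R) : set R -> \bar R :=
  fun A => lebesgue_measure (A `&` `[a, b]).

Let interval_measure0 a b : interval_measure a b set0 = 0%E.
Proof. by rewrite /interval_measure set0I measure0. Qed.

Let interval_measure_ge0 a b A : (0 <= interval_measure a b A)%E.
Proof. exact: measure_ge0. Qed.

Let interval_measure_sigma_additive a b :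
  semi_sigma_additive (interval_measure a b).
Proof.
exact: (@measure_semi_sigma_additive _ _ _
  (mrestr (@lebesgue_measure R) (measurable_itv `[a, b]))).
Qed.

HB.instance Definition _ a b := isMeasure.Build _ _ _ (interval_measure a b)
  (interval_measure0 a b) (@interval_measure_ge0 a b)
  (@interval_measure_sigma_additive a b).

Let interval_measure_fin a b : fin_num_fun (interval_measure a b).
Proof.
move=> A mA; rewrite ge0_fin_numE ?measure_ge0//.
apply: (@le_lt_trans _ _ (lebesgue_measure (`[a, b]%classic : set R))).
  by apply: le_measure; rewrite ?inE//; exact: measurableI.
by rewrite lebesgue_measure_itv/=; case: ifPn => _; rewrite ?ltry// -EFinB ltry.
Qed.

HB.instance Definition _ a b :=
  Measure_isFinite.Build _ _ _ (interval_measure a b) (interval_measure_fin a b).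

Definition cons_row n (p : R * 'rV[R]_n) : 'rV[R]_n.+1 :=
  row_mx (p.1%:M : 'rV[R]_1) p.2.

(* Lebesgue measure restricted to [-pi, pi]^n, as an iterated product *)
Fixpoint torus_measure (n : nat) : set 'rV[R]_n -> \bar R :=
  match n return set 'rV[R]_n -> \bar R with
  | 0 => dirac (0 : 'rV[R]_0)
  | m.+1 => pushforward (interval_measure (- pi) pi \x @torus_measure m)%E
              (@cons_row m)
  end.
Arguments torus_measure : clear implicits.

Lemma measurable_rV_coord n (i : 'I_n) :
  measurable_fun [set: 'rV[R]_n] (@rV_coord _ R n i).
Proof.
move=> _ Y mY; rewrite setTI; apply: sub_sigma_algebra => /=.
rewrite -bigcup_seq/=; exists i => /=; first by rewrite mem_index_enum.
by exists Y => //; rewrite setTI.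
Qed.

Lemma measurable_fun_rVP disp (T : measurableType disp) n (f : T -> 'rV[R]_n) :
  (forall i, measurable_fun [set: T] (fun x => f x ord0 i)) ->
  measurable_fun [set: T] f.
Proof.
move=> mf.
pose S := [set A : set 'rV[R]_n | measurable (f @^-1` A)].
suff : @measurable _ 'rV[R]_n `<=` S.
  by move=> sub _ Y mY; rewrite setTI; exact: sub.
apply: smallest_sub; first split.
- by rewrite /S/= preimage_set0.
- by move=> A SA; rewrite /S/= setTD preimage_setC; exact: measurableC.
- by move=> F SF; rewrite /S/= preimage_bigcup; apply: bigcup_measurable => k _; exact: SF.
rewrite -bigcup_seq => A [i _ [B mB <-]]; rewrite /S/= setTI.
by have := mf i measurableT B mB; rewrite setTI.
Qed.

Lemma measurable_cons_row n : measurable_fun [set: R * 'rV[R]_n] (@cons_row n).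
Proof.
apply: measurable_fun_rVP => i.
case: (splitP (i : 'I_(1 + n))) => j ij.
  have -> : (fun x : R * 'rV[R]_n => cons_row x ord0 i) = fst.
    apply/funext => x; rewrite /cons_row.
    have -> : i = lshift n j by exact: val_inj.
    by apply: (etrans (row_mxEl _ _ ord0 j)); rewrite !ord1 mxE.
  exact: measurable_fst.
have -> : (fun x : R * 'rV[R]_n => cons_row x ord0 i)
    = @rV_coord _ R n j \o snd.
  apply/funext => x; rewrite /cons_row.
  have -> : i = rshift 1 j by exact: val_inj.
  exact: row_mxEr.
exact: measurableT_comp (measurable_rV_coord j) measurable_snd.
Qed.

Lemma torus_measureP n :
  exists mu : {finite_measure set 'rV[R]_n -> \bar R}, torus_measure n = mu.
Proof.
elim: n => [|n [mu muE]].
  by exists (dirac (0 : 'rV[R]_0)).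
pose nu := (interval_measure (- pi) pi \x mu)%E.
pose push : {measure set 'rV[R]_n.+1 -> \bar R} :=
  measure_function_pushforward__canonical__measure_function_Measure nu
    (@measurable_cons_row n).
have pushE : torus_measure n.+1 = push by rewrite /= muE.
have pushfin : fin_num_fun push.
  move=> A mA; rewrite ge0_fin_numE ?measure_ge0//.
  apply: (@le_lt_trans _ _ (push setT)).
    by apply: le_measure; rewrite ?inE.
  rewrite /push/= /pushforward preimage_setT -setXTT product_measure1E//.
  by rewrite lte_mul_pinfty// -?ge0_fin_numE ?fin_num_measure.
pose pf := Measure_isFinite.Build _ _ _ push pushfin.
pose P : {finite_measure set 'rV[R]_n.+1 -> \bar R} :=
  HB.pack (Measure.sort push) (Measure.class push) pf.
by exists P.
Qed.

Let torus_measure0 n : torus_measure n set0 = 0%E.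
Proof. by have [mu ->] := torus_measureP n; exact: measure0. Qed.

Let torus_measure_ge0 n A : (0 <= torus_measure n A)%E.
Proof. by have [mu ->] := torus_measureP n; exact: measure_ge0. Qed.

Let torus_measure_sigma_additive n : semi_sigma_additive (torus_measure n).
Proof.
by have [mu ->] := torus_measureP n; exact: measure_semi_sigma_additive.
Qed.

HB.instance Definition _ n := isMeasure.Build _ _ _ (torus_measure n)
  (torus_measure0 n) (@torus_measure_ge0 n) (@torus_measure_sigma_additive n).

Let torus_measure_fin n : fin_num_fun (torus_measure n).
Proof. by have [mu ->] := torus_measureP n; exact: fin_num_measure. Qed.

HB.instance Definition _ n :=
  Measure_isFinite.Build _ _ _ (torus_measure n) (@torus_measure_fin n).

End torus_measure.
Arguments torus_measure : clear implicits.

(* A function on the torus is represented by a Borel function on R^d, of which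
   only the values almost everywhere on [-pi, pi]^d matter; periodicity is
   required of smooth test functions only.  A function space X is given by an
   extended norm N, with u in X iff N u < +oo. *)
Section torus_spaces.
Context (R : realType) (d : nat).
Local Notation point := 'rV[R]_d.
Local Notation dx := (torus_measure R d).

Definition Lp_norm (p : \bar R) (u : point -> R) : \bar R :=
  if `[< measurable_fun setT u >] then 'N[dx]_p[EFin \o u]%E else +oo%E.

Definition dotk (k : 'rV[int]_d) (x : point) : R :=
  \sum_(i < d) (k ord0 i)%:~R * x ord0 i.

Definition normk (k : 'rV[int]_d) : R :=
  Num.sqrt (\sum_(i < d) ((k ord0 i)%:~R) ^+ 2).

(* e^{-i x.k} = cos (k.x) - i sin (k.x) *)
Definition fourier (u : point -> R) (k : 'rV[int]_d) : R[i] :=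
  (((2 * pi) ^- d)%:C *
   ((\int[dx]_x (u x * cos (dotk k x))) -i* (\int[dx]_x (u x * sin (dotk k x)))))%C.

(* powR satisfies 0 `^ 0 = 1 *)
Definition wiener_norm (a : R) (u : point -> R) : \bar R :=
  (\esum_(k in [set: 'rV[int]_d])
    (normk k `^ a * ComplexField.Normc.normc (fourier u k))%R%:E)%E.

Definition wiener_space (a : R) : set (point -> R) :=
  [set u | u \in Lfun dx 1%E /\ (wiener_norm a u < +oo)%E].

(* As |0| `^ (2 * a) = 0 for a > 0, this is then only a seminorm: it vanishes
   on constants. *)
Definition sobolev2_norm (a : R) (u : point -> R) : \bar R :=
  if `[< u \in Lfun dx 2%:E >] then
    ((\esum_(k in [set: 'rV[int]_d])
      (normk k `^ (2 * a) * ComplexField.Normc.normc (fourier u k) ^+ 2)%R%:E)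
        `^ 2^-1)%E
  else +oo%E.

(* C^oo: all iterated directional derivatives exist and are continuous *)
Definition smooth (V : normedModType R) (f : V -> R) : Prop :=
  forall ws : seq V, let g := foldr (fun w h => 'D_w h) f ws in
    continuous g /\ forall x w, derivable g x w.

Definition basis_vec (i : 'I_d) : point := delta_mx ord0 i.

Definition torus_periodic (f : point -> R) : Prop :=
  forall x i, f (x + (2 * pi) *: basis_vec i) = f x.

Definition partial (i : 'I_d) (f : point -> R) : point -> R :=
  'D_(basis_vec i) f.

Definition laplacian (f : point -> R) : point -> R :=
  fun x => \sum_(i < d) partial i (partial i f) x.

Definition bilaplacian (f : point -> R) : point -> R :=
  laplacian (laplacian f).

Definition multi_partial (m : 'I_d -> nat) (f : point -> R) : point -> R :=
  foldr (fun i g => iter (m i) (partial i) g) f (enum 'I_d).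

Definition weak_derivative (m : 'I_d -> nat) (u g : point -> R) : Prop :=
  [/\ u \in Lfun dx 1%E, g \in Lfun dx 1%E &
    forall psi : point -> R, smooth psi -> torus_periodic psi ->
      \int[dx]_x (u x * multi_partial m psi x) =
      (-1) ^+ (\sum_i m i)%N * \int[dx]_x (g x * psi x)].

(* Weak derivatives are unique up to null sets, so the set below has at most
   one element; it is empty, and the norm +oo, if one of them is missing. *)
Definition sobolev_norm (n : nat) (p : \bar R) (u : point -> R) : \bar R :=
  ereal_inf [set y | exists2 g : {ffun 'I_d -> 'I_n.+1} -> point -> R,
    forall m : {ffun 'I_d -> 'I_n.+1}, (\sum_i m i <= n)%N ->
      weak_derivative (fun i => m i) u (g m) &
    y = (\sum_(m : {ffun 'I_d -> 'I_n.+1} | (\sum_i m i <= n)%N)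
           Lp_norm p (g m))%E].

Definition jointly_measurable (v : R -> point -> R) : Prop :=
  measurable_fun [set: R * point] (fun z => v z.1 z.2).

Definition simple_in (N : (point -> R) -> \bar R) (s : R -> point -> R) : Prop :=
  exists (n : nat) (A : 'I_n -> set R) (w : 'I_n -> point -> R),
    [/\ forall j, measurable (A j), forall j, (N (w j) < +oo)%E &
        forall t x, s t x = \sum_(j < n) \1_(A j) t * w j x].

Definition strongly_measurable (T : R) (N : (point -> R) -> \bar R)
    (v : R -> point -> R) : Prop :=
  exists2 s : nat -> R -> point -> R, forall n, simple_in N (s n) &
    {ae interval_measure 0 T, forall t,
      (fun n => N (fun x => s n t x - v t x)) @ \oo --> 0%E}.

Definition bochner (T : R) (p : \bar R) (N : (point -> R) -> \bar R)
    : set (R -> point -> R) :=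
  [set v | [/\ jointly_measurable v, strongly_measurable T N v &
    ('N[interval_measure 0%R T]_p[N \o v] < +oo)%E]].

Definition vector_variation (N : (point -> R) -> \bar R) (mu : set R -> point -> R)
    (A : set R) : \bar R :=
  ereal_sup [set y | exists (n : nat) (F : 'I_n -> set R),
    [/\ forall j, measurable (F j), forall j, F j `<=` A, trivIset setT F &
        y = (\sum_(j < n) N (mu (F j)))%E]].

(* a countably additive, regular Borel vector measure of bounded variation *)
Definition radon_measure (T : R) (N : (point -> R) -> \bar R)
    (mu : set R -> point -> R) : Prop :=
  [/\ forall A, measurable A -> A `<=` `[0, T] -> (N (mu A) < +oo)%E,
      forall F : nat -> set R, (forall n, measurable (F n)) ->
        (forall n, F n `<=` `[0, T]) -> trivIset setT F ->
        (fun n => N (fun x => mu (\bigcup_i F i) x - \sum_(i < n) mu (F i) x))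
          @ \oo --> 0%E,
      (vector_variation N mu `[0%R, T] < +oo)%E &
      forall A (e : R), measurable A -> A `<=` `[0, T] -> 0 < e ->
        exists K U : set R, [/\ compact K, open U, K `<=` A, A `<=` U &
          (vector_variation N mu ((U `&` `[0%R, T]) `\` K) < e%:E)%E]].

(* M(0, T; X), a function v being identified with the measure v(t) dt *)
Definition radon_space (T : R) (N : (point -> R) -> \bar R)
    : set (R -> point -> R) :=
  [set v | (fun z : R * point => v z.1 z.2)
             \in Lfun (interval_measure 0%R T \x dx)%E 1%E /\
           radon_measure T N
             (fun A x => \int[interval_measure 0 T]_(t in A) v t x)].

Definition continuous_in (T : R) (N : (point -> R) -> \bar R)
    : set (R -> point -> R) :=
  [set v | forall t, `[0, T]%classic t -> (N (v t) < +oo)%E /\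
    N (fun x => v s x - v t x) @[s --> within `[0, T] (nbhs t)] --> 0%E].

(* A smooth function on [0, T) x T^d is the restriction of a smooth function
   on R x R^d that is periodic in space; the torus being compact, the support
   is compact iff it is bounded away from T. *)
Definition test_function (T : R) (phi : R -> point -> R) : Prop :=
  [/\ smooth (fun z : R * point => phi z.1 z.2),
      forall t, torus_periodic (phi t) &
      exists2 S, S < T & forall t x, S < t -> phi t x = 0].

Definition weak_integrand (phi v : R -> point -> R) (t : R) (x : point) : R :=
  derive1 (phi ^~ x) t * v t x + bilaplacian (phi t) x / (1 + v t x) ^+ 3.

(* The integrability of the integrand, implicit in the weak formulation, is
   stated explicitly because Rintegral is total. *)
Definition weak_solution (T : R) (v0 : point -> R) (v : R -> point -> R) : Prop :=
  bochner T +oo%E (Lp_norm +oo%E) v /\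
  forall phi, test_function T phi ->
    (fun z : R * point => weak_integrand phi v z.1 z.2)
      \in Lfun (interval_measure 0%R T \x dx)%E 1%E /\
    \int[dx]_x (phi 0 x * v0 x) +
    \int[interval_measure 0 T]_t \int[dx]_x weak_integrand phi v t x = 0.

End torus_spaces.

Definition delta_rate (R : realType) (r : R) : R :=
  6 - 3 / (1 - r) ^+ 4 *
    (1 + 28 * (r / (1 - r)) + 120 * (r ^+ 2 / (1 - r) ^+ 2)
     + 120 * (r ^+ 3 / (1 - r) ^+ 3)).

(* Main.v *)
(* The Taylor coefficients of (1 + v)^-3 are those of its majorant (1 - r)^-3 up
   to sign, and |v^n|_4 <= n^4 |v|_0^(n-1) |v|_4 in the Wiener norms; summing the
   series shows that the terms of degree n >= 2 contribute at most
   (3 - delta(|v|_0)) |v|_4, which the linear part - 3 Delta^2 v absorbs, so that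
   d/dt |v|_0 + delta(|v|_0) |v|_4 <= 0. This is proved for an explicit Euler
   scheme truncated to finitely many frequencies, whose time step is so small
   that 1 - 3 tau |k|^4 >= 0 for all of them. All iterates are finite sums of
   terms r cos (k.x + a), for which the estimates hold term by term.

   Each Fourier coefficient of the scheme is Lipschitz in time, so a subsequence
   converges at all times, coefficient by coefficient. The bound on the time
   integral of |v|_4 makes the high frequencies uniformly small, hence the limit
   v(t) has coefficients solving c_k(t) = c_k(0) + |k|^4 int_0^t P_k, where P_k is
   the k-th coefficient of (1 + v)^-3. Testing against a smooth periodic function
   and summing over k gives the weak formulation, since an integrable function
   all of whose coefficients vanish annihilates the continuous periodic functions.
   All the norms in the statement are controlled by sums of |k|^j |c_k(t)|, j <= 4,
   and |c(t)|_3 <= C (1 + |c(t)|_4)^(3/4) gives the exponent 4/3. *)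

Require Import Defs.
From mathcomp Require Import all_boot all_order all_algebra.
From mathcomp Require Import complex ring lra zify.
From mathcomp Require Import all_classical all_reals all_analysis.
From mathcomp Require Import measurable_realfun ess_sup_inf.

Set Implicit Arguments.
Unset Strict Implicit.
Unset Printing Implicit Defensive.

Import Order.TTheory GRing.Theory Num.Def Num.Theory.
Import numFieldNormedType.Exports.

Local Open Scope classical_set_scope.
Local Open Scope ring_scope.

(** * The power series of (1 + v)^-3 *)

(** The constants 1, 28, 120, 120 of [delta_rate] come from writing C(n+3,2) (n+1)^4 in the basis
    C(n+3,i), whose generating functions are explicit. The factor n^4 is exact: convexity of the
    fourth power is applied with the weights n/(n+1) and 1/(n+1), so that the induction on the
    degree loses nothing. The main obstacle is that the fourth moment is bounded only after
    integration in time and may be infinite on a null set of times. Hence the nonlinear term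
    converges in L^1 in time only, the limit equation is kept in integrated form, and the fourth
    moment lives in the extended reals. Limits along an ultrafilter are turned into sequential ones
    because dominated convergence is applied to them. The series built from the coefficients of (1 +
    v)^-3 converges absolutely, but is compared with that function only against test functions, by
    means of a de la Vallee Poussin kernel. Complex coefficients become pairs (cosine, sine) with
    modulus [amp]; this modulus is a maximum of linear forms over the phase, which yields triangle
    inequalities and passage to the limit. *)

Section series_bounds.
Context {R : realType}.
Implicit Types (r x : R) (n : nat).

(** Induction on [j]: multiplying the partial sum by [1 - r] lowers [j] by one, by Pascal's rule, up
    to a boundary term of the right sign. Only partial sums occur, so no question of convergence
    arises. *)
Lemma sum_binomial_le j N r : 0 <= r < 1 ->
  \sum_(n < N) 'C(n + j, j)%:R * r ^+ n <= (1 - r) ^- j.+1.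
Proof.
move=> /andP[r0 r1]; have r1' : 0 < 1 - r by rewrite subr_gt0.
elim: j N => [|j IH] N.
  rewrite expr1 -[leRHS]mul1r ler_pdivlMr// mulr_suml.
  have -> : \sum_(i < N) 'C(i + 0, 0)%:R * r ^+ i * (1 - r) = 1 - r ^+ N.
    elim: N => [|N IH]; first by rewrite big_ord0 expr0 subrr.
    rewrite big_ord_recr/= IH bin0 exprS; ring.
  by rewrite gerBl exprn_ge0.
rewrite (exprS _ j.+1) invfM lter_pdivlMl// (le_trans _ (IH N))//.
have : forall M, (1 - r) * \sum_(n < M) 'C(n + j.+1, j.+1)%:R * r ^+ n =
   \sum_(n < M) 'C(n + j, j)%:R * r ^+ n - (if M is M'.+1 then 'C(M' + j.+1, j.+1)%:R * r ^+ M else 0).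
  elim=> [|[|M] IHM]; first by rewrite !big_ord0 mulr0 subr0.
    rewrite !big_ord_recr !big_ord0/= !add0n !binn; ring.
  rewrite big_ord_recr mulrDr IHM [in RHS]big_ord_recr/=.
  have -> : 'C(M.+1 + j.+1, j.+1) = ('C(M.+1 + j, j) + 'C(M + j.+1, j.+1))%N.
    by rewrite addnS binS addnC !addSn addnS.
  rewrite natrD !exprS; ring.
case: N => [|N] -> ; first by rewrite subr0.
by rewrite gerBl mulr_ge0// exprn_ge0.
Qed.

(** The terms with [n < i] vanish, and shifting the index by [i] pulls out [r ^+ i]. These are the
    generating functions of the basis used in [bin_pow4]. *)
Lemma sum_binomial_shift_le i j N r : 0 <= r < 1 ->
  \sum_(n < N) 'C(n + j, i + j)%:R * r ^+ n <= r ^+ i * (1 - r) ^- (i + j).+1.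
Proof.
move=> /andP[r0 r1].
apply: (@le_trans _ _ (\sum_(n < N + i) 'C(n + j, i + j)%:R * r ^+ n)).
  rewrite big_split_ord/= lerDl sumr_ge0// => k _.
  by rewrite mulr_ge0// exprn_ge0.
rewrite addnC big_split_ord/= big1 ?add0r; last first.
  by move=> k _; rewrite bin_small ?mul0r// ltn_add2r.
have -> : \sum_(k < N) 'C(i + k + j, i + j)%:R * r ^+ (i + k) =
    r ^+ i * \sum_(k < N) 'C(k + (i + j), i + j)%:R * r ^+ k.
  rewrite mulr_sumr; apply: eq_bigr => k _.
  by rewrite exprD mulrCA mulrA [(i + k)%N]addnC -addnA mulrA.
by rewrite ler_wpM2l ?exprn_ge0// sum_binomial_le// r0.
Qed.

(** The coefficient of degree n + 1 in (1 + v)^-3 is ['C(n.+3, 2)] up to sign, and [n.+1 ^ 4] is the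
    factor of [nrm4_tpow]. The numbers 3, 84, 360, 360 are three times the 1, 28, 120, 120 of
    [delta_rate]. *)
Lemma bin_pow4 n : ('C(n.+3, 2) * n.+1 ^ 4 =
  3 * 'C(n.+3, 3) + 84 * 'C(n.+3, 4) + 360 * 'C(n.+3, 5) + 360 * 'C(n.+3, 6))%N.
Proof.
have g m k : (k.+1 * 'C(m, k.+1) = (m - k) * 'C(m, k))%N.
  by rewrite mul_bin_left.
have e3 := g n.+3 2%N; have e4 := g n.+3 3%N.
have e5 := g n.+3 4%N; have e6 := g n.+3 5%N.
rewrite !subSS !subn0 in e3 e4 e5 e6.
(* The recurrences between consecutive binomials involve the truncated differences n - 1 and n - 2;
   where these truncate, the binomials concerned are zero. *)
have s6 : (n < 2)%N -> 'C(n.+3, 5) = 0%N by move=> n2; rewrite bin_small.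
have s5 : (n < 1)%N -> 'C(n.+3, 4) = 0%N by move=> n2; rewrite bin_small.
move: e3 e4 e5 e6 s5 s6.
move: 'C(n.+3, 2) 'C(n.+3, 3) 'C(n.+3, 4) 'C(n.+3, 5) 'C(n.+3, 6).
move=> c2 c3 c4 c5 c6 e3 e4 e5 e6 s5 s6.
apply/eqP; rewrite -(eqr_nat rat) !(natrD, natrM, natrX).
have E3 : c3%:R = (n%:R + 1) * c2%:R / 3 :> rat.
  by rewrite natr1 -natrM -e3 natrM mulrC mulKf.
have E4 : c4%:R = n%:R * c3%:R / 4 :> rat.
  by rewrite -natrM -e4 natrM mulrC mulKf.
have E5 : c5%:R = (n%:R - 1) * c4%:R / 5 :> rat.
  have [n0|n0] := ltnP n 1.
    by move: e5; rewrite s5// muln0 => /eqP; rewrite muln_eq0/= => /eqP ->; rewrite mulr0 mul0r.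
  by rewrite -(natrB rat n0) -natrM -e5 natrM mulrC mulKf.
have E6 : c6%:R = (n%:R - 2) * c5%:R / 6 :> rat.
  have [n0|n0] := ltnP n 2.
    by move: e6; rewrite s6// muln0 => /eqP; rewrite muln_eq0/= => /eqP ->; rewrite mulr0 mul0r.
  by rewrite -natrB// -natrM -e6 natrM mulrC mulKf.
by rewrite E6 E5 E4 E3 -natr1; apply/eqP; field.
Qed.

(** By [bin_pow4] the sum splits into four binomial series, whose closed forms add up to the right
    side. Its term [n = 0] equals 3 and belongs to the linear part of the power series, which leaves
    [3 - delta_rate r] for the nonlinear part. *)
Lemma delta_rate_sum N r : 0 <= r < 1 ->
  \sum_(n < N) ('C(n.+3, 2) * n.+1 ^ 4)%:R * r ^+ n <= 6 - delta_rate r.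
Proof.
move=> r01; have /andP[r0 r1] := r01.
have r1' : 1 - r != 0 by rewrite gt_eqF// subr_gt0.
have -> : 6 - delta_rate r = 3 * (r ^+ 0 * (1 - r) ^- (0 + 3).+1)
   + 84 * (r ^+ 1 * (1 - r) ^- (1 + 3).+1) + 360 * (r ^+ 2 * (1 - r) ^- (2 + 3).+1)
   + 360 * (r ^+ 3 * (1 - r) ^- (3 + 3).+1).
  by rewrite /delta_rate; field.
have -> : \sum_(n < N) ('C(n.+3, 2) * n.+1 ^ 4)%:R * r ^+ n =
    3 * (\sum_(n < N) 'C(n + 3, 0 + 3)%:R * r ^+ n)
    + 84 * (\sum_(n < N) 'C(n + 3, 1 + 3)%:R * r ^+ n)
    + 360 * (\sum_(n < N) 'C(n + 3, 2 + 3)%:R * r ^+ n)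
    + 360 * (\sum_(n < N) 'C(n + 3, 3 + 3)%:R * r ^+ n).
  rewrite !mulr_sumr -!big_split/=; apply: eq_bigr => n _.
  rewrite bin_pow4 addn3 !add0n.
  move: 'C(n.+3, 3) 'C(n.+3, 4) 'C(n.+3, 5) 'C(n.+3, 6) => c3 c4 c5 c6.
  rewrite !(natrD, natrM); ring.
have B c i : 0 <= c -> c * (\sum_(n < N) 'C(n + 3, i + 3)%:R * r ^+ n) <=
    c * (r ^+ i * (1 - r) ^- (i + 3).+1).
  by move=> c0; apply: ler_wpM2l => //; exact: sum_binomial_shift_le.
exact: (lerD (lerD (lerD (B _ 0%N (ler0n _ 3)) (B _ 1%N (ler0n _ 84)))
  (B _ 2%N (ler0n _ 360))) (B _ 3%N (ler0n _ 360))).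
Qed.

Lemma delta_rate0_le r : 0 <= r < 1 -> delta_rate r <= 3.
Proof.
move=> r01; have := delta_rate_sum 1 r01.
by rewrite big_ord1 expr0 mulr1 exp1n muln1 (_ : 'C(3, 2) = 3)%N//; lra.
Qed.

(* the partial sums of (1 + v)^-3 *)
Definition fpoly N (v : R) : R := \sum_(n < N) ((-1) ^+ n * 'C(n.+2, 2)%:R) * v ^+ n.

(** In the product all coefficients cancel except the constant one and those of degrees N, N + 1 and
    N + 2. This exact remainder takes the place of Taylor's theorem. *)
Lemma fpoly_cube N v : (1 + v) ^+ 3 * fpoly N v = 1 - (- v) ^+ N *
  ('C(N.+2, 2)%:R + (N * N.+2)%:R * v + 'C(N.+1, 2)%:R * v ^+ 2).
Proof.
have E m : 'C(m.+1, 2)%:R = m%:R * (m%:R + 1) / 2 :> R.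
  have := mul_bin_diag m.+1 1; rewrite bin1 succnK => /(congr1 (fun k : nat => k%:R : R)).
  by rewrite !natrM -natr1 => E; rewrite [m%:R * _]mulrC E mulrC mulKf.
elim: N => [|N IH].
  by rewrite /fpoly big_ord0 mulr0 expr0 mul1r !E; field.
rewrite /fpoly big_ord_recr mulrDr IH /= !E !natrM -!natr1 (exprS (- v)) (exprNn v).
by field.
Qed.

(** The remainder of [fpoly_cube] is divided by (1 + v)^3. The factor 4 bounds its three
    coefficients: the middle one, [N * N.+2], is at most twice ['C(N.+2, 2)], and the last one at
    most once. *)
Lemma fpoly_dist N v r : 0 <= r < 1 -> `|v| <= r ->
  `|fpoly N v - (1 + v) ^- 3| <= (1 - r) ^- 3 * (4 * ('C(N + 2, 2)%:R * r ^+ N)).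
Proof.
move=> /andP[r0 r1] vr.
have v1 : 1 - r <= 1 + v by rewrite lerD2l lerNl (le_trans _ vr)// -normrN ler_norm.
have r1' : 0 < 1 - r by rewrite subr_gt0.
have v0 : 0 < 1 + v by exact: lt_le_trans v1.
have E : fpoly N v - (1 + v) ^- 3 = (1 + v) ^- 3 * - ((- v) ^+ N *
  ('C(N.+2, 2)%:R + (N * N.+2)%:R * v + 'C(N.+1, 2)%:R * v ^+ 2)).
  have := fpoly_cube N v => /(congr1 (fun x => (1 + v) ^- 3 * x)).
  by rewrite mulKf ?expf_neq0 ?gt_eqF// => ->; rewrite mulrBr mulr1 addrAC subrr add0r mulrN.
rewrite E normrM; apply: ler_pM => //.
  rewrite ger0_norm ?invr_ge0 ?exprn_ge0 ?(ltW v0)// lef_pV2 ?posrE ?exprn_gt0//.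
  by rewrite lerXn2r ?nnegrE// ltW.
rewrite normrN normrM normrX normrN (mulrA 4) mulrC ler_pM ?exprn_ge0//; last first.
  by rewrite lerXn2r ?nnegrE.
have v1' : `|v| <= 1 by rewrite (le_trans vr)// ltW.
apply: (@le_trans _ _ ('C(N.+2, 2)%:R + (N * N.+2)%:R + 'C(N.+1, 2)%:R)).
  rewrite (le_trans (ler_normD _ _))// lerD//.
    rewrite (le_trans (ler_normD _ _))// lerD//; first by rewrite ger0_norm.
    by rewrite normrM ger0_norm// ler_piMr.
  by rewrite normrM ger0_norm// ler_piMr// normrX exprn_ile1.
rewrite -!natrD -natrM ler_nat addn2.
have := mul_bin_diag N.+2 1; rewrite bin1/= => e1.
have := mul_bin_diag N.+1 1; rewrite bin1/= => e2.
nia.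
Qed.

Lemma cvg_binomial_geometric r : 0 <= r < 1 ->
  (fun n => 'C(n + 2, 2)%:R * r ^+ n) @ \oo --> (0 : R).
Proof.
move=> r01; apply: cvg_series_cvg_0.
apply: nondecreasing_is_cvgn.
  apply: nondecreasing_series => n _ _.
  by rewrite mulr_ge0// exprn_ge0//; case/andP: r01.
exists ((1 - r) ^- 3) => _ [n _ <-].
by rewrite /series/= big_mkord sum_binomial_le.
Qed.

(** Convexity of x^4 for the weights m / (m + 1) and 1 / (m + 1), sharp at a = m b. It is applied
    with [m] the number of factors already multiplied. *)
Lemma pow4_convex (a b m : R) : 0 < m -> 0 <= a -> 0 <= b ->
  (a + b) ^+ 4 <= (m + 1) ^+ 3 * (a ^+ 4 / m ^+ 3 + b ^+ 4).
Proof.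
move=> m0 a0 b0; rewrite -subr_ge0.
have m0' : m != 0 by rewrite gt_eqF.
set c := a / m; have -> : a = m * c by rewrite /c mulrC mulfVK.
have c0 : 0 <= c by rewrite /c divr_ge0// ltW.
(* In terms of c = a / m the difference has a double root at b = c, and the cofactor has nonnegative
   coefficients. *)
have -> : (m + 1) ^+ 3 * ((m * c) ^+ 4 / m ^+ 3 + b ^+ 4) - (m * c + b) ^+ 4 =
  m * (b - c) ^+ 2 * ((m ^+ 2 + 3 * m + 3) * b ^+ 2
   + (2 * m ^+ 2 + 6 * m + 2) * b * c + (3 * m ^+ 2 + 3 * m + 1) * c ^+ 2).
  by field.
have m0l := ltW m0.
have m2 := sqr_ge0 m.
apply: mulr_ge0; first by rewrite mulr_ge0 ?sqr_ge0.
apply: addr_ge0; first apply: addr_ge0.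
- by rewrite mulr_ge0 ?sqr_ge0//; lra.
- by rewrite mulr_ge0// mulr_ge0//; lra.
- by rewrite mulr_ge0 ?sqr_ge0//; lra.
Qed.

End series_bounds.

(** * Trigonometric sums and their norms *)

Section frequencies.
Context {R : realType} {d : nat}.
Implicit Types k l : 'rV[int]_d.
Local Notation nk := (@normk R d).

Lemma normk_ge0 k : 0 <= nk k. Proof. exact: sqrtr_ge0. Qed.

Lemma normk_sqr k : nk k ^+ 2 = \sum_(i < d) ((k ord0 i)%:~R) ^+ 2.
Proof. by rewrite /normk sqr_sqrtr// sumr_ge0// => i _; exact: sqr_ge0. Qed.

Lemma normk0 : nk 0 = 0.
Proof. by rewrite /normk big1 ?sqrtr0// => i _; rewrite mxE expr0n. Qed.

Lemma normkN k : nk (- k) = nk k.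
Proof.
by rewrite /normk; congr Num.sqrt; apply: eq_bigr => i _; rewrite mxE intrN sqrrN.
Qed.

Lemma normkD k l : nk (k + l) <= nk k + nk l.
Proof.
pose a i : R := (k ord0 i)%:~R; pose b i : R := (l ord0 i)%:~R.
(* Lagrange's identity; it gives the Cauchy-Schwarz inequality [cs], and with it the triangle
   inequality. *)
have lagr : \sum_i \sum_j (a i * b j - a j * b i) ^+ 2 =
    2 * ((nk k * nk l) ^+ 2 - (\sum_i a i * b i) ^+ 2).
  rewrite exprMn !normk_sqr mulrBr expr2 !mulr_suml.
  rewrite mulr_natl mulr2n -[X in _ + X - _]mulr_suml -[X in _ + X - _](mulrC (\sum_i _)) .
  rewrite mulr_suml -big_split/= mulr_natl mulr2n opprD -!sumrN -!big_split/=.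
  apply: eq_bigr => i _; rewrite !mulr_sumr -!sumrN -!big_split/=.
  apply: eq_bigr => j _; rewrite -/(a i) -/(a j) -/(b i) -/(b j); ring.
have cs : (\sum_i a i * b i) <= nk k * nk l.
  apply: le_trans (ler_norm _) _.
  rewrite -(@ler_pXn2r _ 2)// ?nnegrE ?mulr_ge0 ?normk_ge0// real_normK ?num_real//.
  rewrite -subr_ge0 -(@pmulr_rge0 _ 2)// -lagr.
  by apply: sumr_ge0 => i _; apply: sumr_ge0 => j _; exact: sqr_ge0.
rewrite -(@ler_pXn2r _ 2)// ?nnegrE ?addr_ge0 ?normk_ge0//.
rewrite sqrrD !normk_sqr.
have -> : \sum_(i < d) ((k + l) ord0 i)%:~R ^+ 2 = \sum_(i < d) (k ord0 i)%:~R ^+ 2 +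
   (\sum_i a i * b i) *+ 2 + \sum_(i < d) (l ord0 i)%:~R ^+ 2 :> R.
  rewrite -sumrMnl -!big_split/=; apply: eq_bigr => i _.
  by rewrite mxE intrD sqrrD.
by rewrite lerD2r lerD2l lerMn2r cs.
Qed.

Lemma normkB k l : nk (k - l) <= nk k + nk l.
Proof. by rewrite -(normkN l) normkD. Qed.

Lemma normk_ge1 k : k != 0 -> 1 <= nk k.
Proof.
move=> k0; have [i ki] : exists i, k ord0 i != 0.
  apply/existsP; apply: contra_neqT k0 => /existsPn h; apply/rowP => i.
  by rewrite mxE; apply/eqP; rewrite -[_ == _]negbK h.
rewrite -(@ler_pXn2r _ 2)// ?nnegrE ?normk_ge0// expr1n normk_sqr (bigD1 i)//=.
rewrite -[leLHS]addr0 lerD ?sumr_ge0// => [|j _]; last exact: sqr_ge0.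
rewrite -real_normK ?num_real// -intr_norm expr_ge1// ?ler1z//.
by rewrite -gtz0_ge1 normr_gt0.
Qed.

Lemma normk_int k i : `|(k ord0 i)%:~R| <= nk k.
Proof.
rewrite -(@ler_pXn2r _ 2)// ?nnegrE ?normk_ge0// normk_sqr (bigD1 i)//=.
by rewrite real_normK ?num_real// lerDl sumr_ge0// => j _; exact: sqr_ge0.
Qed.

Lemma dotk0 x : dotk (0 : 'rV[int]_d) x = 0 :> R.
Proof. by rewrite /dotk big1// => i _; rewrite mxE mul0r. Qed.

Lemma dotkD k l (x : 'rV[R]_d) : dotk (k + l) x = dotk k x + dotk l x.
Proof.
by rewrite /dotk -big_split; apply: eq_bigr => i _; rewrite mxE intrD mulrDl.
Qed.

Lemma dotkN k (x : 'rV[R]_d) : dotk (- k) x = - dotk k x.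
Proof.
by rewrite /dotk -sumrN; apply: eq_bigr => i _; rewrite mxE intrN mulNr.
Qed.

Lemma dotkBr k (x y : 'rV[R]_d) : dotk k (x - y) = dotk k x - dotk k y.
Proof.
by rewrite /dotk -sumrB; apply: eq_bigr => i _; rewrite !mxE mulrBr.
Qed.

End frequencies.

Section trigonometric_lists.
Context {R : realType} {d : nat}.
Local Notation nk := (@normk R d).
Local Notation point := 'rV[R]_d.

(* (r, a, k) stands for r cos (k.x + a); equal frequencies are never merged,
   so that all the norm estimates below are termwise. *)
Definition term : Type := R * R * 'rV[int]_d.
Implicit Types (s t : seq term) (q p : term) (k l : 'rV[int]_d).

Definition ev s (x : point) : R :=
  \sum_(q <- s) q.1.1 * cos (dotk q.2 x + q.1.2).

Definition nrm (a : nat) s : R := \sum_(q <- s) `|q.1.1| * nk q.2 ^+ a.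

Definition scl (c : 'rV[int]_d -> R) s : seq term :=
  [seq (c q.2 * q.1.1, q.1.2, q.2) | q <- s].

(** The product-to-sum formula: cos X cos Y is half of cos (X + Y) plus half of cos (X - Y), hence
    two output terms for each pair. *)
Definition tmul s t : seq term := \big[cat/[::]]_(p <- s) \big[cat/[::]]_(q <- t)
  [:: (p.1.1 * q.1.1 / 2, p.1.2 + q.1.2, p.2 + q.2);
      (p.1.1 * q.1.1 / 2, p.1.2 - q.1.2, p.2 - q.2)].

Lemma big_bigcat (V : nmodType) (I : Type) (r : seq I) (G : I -> seq term) (F : term -> V) :
  \sum_(q <- \big[cat/[::]]_(i <- r) G i) F q = \sum_(i <- r) \sum_(q <- G i) F q.
Proof.
by elim: r => [|i r IH]; rewrite ?big_nil// !big_cons big_cat/= IH.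
Qed.

Lemma big_tmul (V : nmodType) s t (F : term -> V) : \sum_(q <- tmul s t) F q =
  \sum_(p <- s) \sum_(q <- t)
    (F (p.1.1 * q.1.1 / 2, p.1.2 + q.1.2, p.2 + q.2)
     + F (p.1.1 * q.1.1 / 2, p.1.2 - q.1.2, p.2 - q.2)).
Proof.
rewrite big_bigcat; apply: eq_bigr => p _; rewrite big_bigcat.
by apply: eq_bigr => q _; rewrite !big_cons big_nil addr0.
Qed.

Lemma nrm_cat a s t : nrm a (s ++ t) = nrm a s + nrm a t.
Proof. by rewrite /nrm big_cat. Qed.

Lemma nrm_ge0 a s : 0 <= nrm a s.
Proof. by apply: sumr_ge0 => q _; rewrite mulr_ge0// exprn_ge0 ?normk_ge0. Qed.

Lemma ev_le_nrm s x : `|ev s x| <= nrm 0 s.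
Proof.
apply: le_trans (ler_norm_sum _ _ _) _; apply: ler_sum => q _.
by rewrite expr0 mulr1 normrM ler_piMr// ler_norml cos_geN1 cos_le1.
Qed.

Lemma ev_tmul s t x : ev (tmul s t) x = ev s x * ev t x.
Proof.
rewrite /ev big_tmul mulr_suml; apply: eq_bigr => p _.
rewrite mulr_sumr; apply: eq_bigr => q _ /=.
have -> : dotk (p.2 + q.2) x + (p.1.2 + q.1.2) =
    (dotk p.2 x + p.1.2) + (dotk q.2 x + q.1.2) by rewrite dotkD addrACA.
have -> : dotk (p.2 - q.2) x + (p.1.2 - q.1.2) =
    (dotk p.2 x + p.1.2) - (dotk q.2 x + q.1.2).
  by rewrite dotkD dotkN addrACA opprD.
by rewrite cosD cosB; field.
Qed.

Lemma ev_scl c s x : ev (scl (fun=> c) s) x = c * ev s x.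
Proof. by rewrite /ev big_map mulr_sumr; apply: eq_bigr => q _; rewrite mulrA. Qed.

Lemma nrm_scl a c s : nrm a (scl (fun=> c) s) = `|c| * nrm a s.
Proof.
by rewrite /nrm big_map mulr_sumr; apply: eq_bigr => q _ /=; rewrite normrM mulrA.
Qed.

(** An equality, because nothing is merged: each pair yields two terms of half the amplitude. *)
Lemma nrm0_tmul s t : nrm 0 (tmul s t) = nrm 0 s * nrm 0 t.
Proof.
rewrite /nrm big_tmul mulr_suml; apply: eq_bigr => p _.
rewrite mulr_sumr; apply: eq_bigr => q _ /=.
by rewrite !expr0 !mulr1 !normrM (@ger0_norm _ 2^-1)// -splitr.
Qed.

(** Both output frequencies have norm at most |k| + |l|, to which [pow4_convex] applies termwise.
    The weight [m] stays free for the induction on powers. *)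
Lemma nrm4_tmul (m : R) s t : 0 < m -> nrm 4 (tmul s t) <=
  (m + 1) ^+ 3 * (nrm 4 s / m ^+ 3 * nrm 0 t + nrm 0 s * nrm 4 t).
Proof.
move=> m0; rewrite /nrm big_tmul.
have -> : (m + 1) ^+ 3 *
  ((\sum_(q <- s) `|q.1.1| * nk q.2 ^+ 4) / m ^+ 3 * (\sum_(q <- t) `|q.1.1| * nk q.2 ^+ 0) +
   (\sum_(q <- s) `|q.1.1| * nk q.2 ^+ 0) * \sum_(q <- t) `|q.1.1| * nk q.2 ^+ 4) =
  \sum_(p <- s) \sum_(q <- t) `|p.1.1| * `|q.1.1| *
     ((m + 1) ^+ 3 * (nk p.2 ^+ 4 / m ^+ 3 + nk q.2 ^+ 4)).
  rewrite !mulr_suml -big_split mulr_sumr; apply: eq_bigr => p _.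
  rewrite !mulr_sumr -big_split mulr_sumr; apply: eq_bigr => q _ /=.
  by rewrite !expr0; field; rewrite gt_eqF.
apply: ler_sum => p _; apply: ler_sum => q _ /=.
have h k : nk k <= nk p.2 + nk q.2 -> `|p.1.1 * q.1.1 / 2| * nk k ^+ 4 <=
   `|p.1.1| * `|q.1.1| / 2 * ((m + 1) ^+ 3 * (nk p.2 ^+ 4 / m ^+ 3 + nk q.2 ^+ 4)).
  move=> kpq; rewrite !normrM (@ger0_norm _ 2^-1)//.
  rewrite ler_wpM2l ?divr_ge0 ?mulr_ge0//.
  rewrite (le_trans _ (pow4_convex m0 (normk_ge0 _) (normk_ge0 _)))//.
  by rewrite lerXn2r ?nnegrE ?addr_ge0 ?normk_ge0.
rewrite (le_trans (lerD (h _ (normkD _ _)) (h _ (normkB _ _))))//.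
by rewrite -mulrDl -splitr.
Qed.

Fixpoint tpow s n : seq term :=
  if n is m.+1 then tmul (tpow s m) s else [:: (1, 0, 0)].

Lemma ev_tpow s n x : ev (tpow s n) x = ev s x ^+ n.
Proof.
elim: n => [|n IH]; last by rewrite /= ev_tmul IH exprSr.
by rewrite /ev big_seq1 dotk0 addr0 cos0 mulr1.
Qed.

Lemma nrm0_tpow s n : nrm 0 (tpow s n) = nrm 0 s ^+ n.
Proof.
elim: n => [|n IH]; last by rewrite /= nrm0_tmul IH exprSr.
by rewrite /nrm big_seq1 normr1 !expr0 mulr1.
Qed.

(** Choosing the weight [m = n.+1] at each multiplication makes the constants close up: (n+2)^3
    ((n+1)^4 / (n+1)^3 + 1) = (n+2)^4. *)
Lemma nrm4_tpow s n : nrm 4 (tpow s n.+1) <= n.+1%:R ^+ 4 * nrm 0 s ^+ n * nrm 4 s.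
Proof.
elim: n => [|n IH].
  rewrite /= /nrm big_tmul big_seq1 expr1n expr0 !mul1r le_eqVlt; apply/orP; left.
  apply/eqP; apply: eq_bigr => q _ /=; rewrite mul1r !add0r normkN -mulrDl.
  by rewrite normrM (@ger0_norm _ 2^-1)// -splitr.
have nn : (0 : R) < n.+1%:R by rewrite ltr0n.
rewrite (le_trans (nrm4_tmul (tpow s n.+1) s nn))// nrm0_tpow.
have n0 : n.+1%:R != 0 :> R by [].
apply: (@le_trans _ _ ((n.+1%:R + 1) ^+ 3 * (n.+1%:R ^+ 4 * nrm 0 s ^+ n * nrm 4 s
    / n.+1%:R ^+ 3 * nrm 0 s + nrm 0 s ^+ n.+1 * nrm 4 s))).
  rewrite ler_wpM2l ?exprn_ge0// lerD2r ler_wpM2r ?nrm_ge0// ler_wpM2r//.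
rewrite -(natr1 n.+1) (exprSr (nrm 0 s)) le_eqVlt; apply/orP; left; apply/eqP.
field.
by rewrite addrC natr1.
Qed.

Definition Fcoef n : R := (-1) ^+ n * 'C(n.+2, 2)%:R.

Definition Flist N s : seq term :=
  \big[cat/[::]]_(n < N) scl (fun=> Fcoef n) (tpow s n).

Lemma ev_Flist N s x : ev (Flist N s) x = fpoly N (ev s x).
Proof.
rewrite /ev big_bigcat /fpoly; apply: eq_bigr => n _.
by rewrite -[LHS]/(ev _ x) ev_scl ev_tpow.
Qed.

Lemma nrm0_Flist N s : nrm 0 s < 1 -> nrm 0 (Flist N s) <= (1 - nrm 0 s) ^- 3.
Proof.
move=> s1; have s01 : 0 <= nrm 0 s < 1 by rewrite nrm_ge0.
rewrite /nrm big_bigcat (le_trans _ (sum_binomial_le 2 N s01))//.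
apply: ler_sum => n _; rewrite -/(nrm 0 _) nrm_scl nrm0_tpow addn2.
by rewrite normrM normrX normrN1 expr1n mul1r ger0_norm.
Qed.

(* the nonlinear part of the truncated (1 + v)^-3, that is 1 - 3 v removed *)
Definition Glist N s : seq term :=
  \big[cat/[::]]_(n < N) scl (fun=> Fcoef n.+2) (tpow s n.+2).

Lemma big_Flist (V : nmodType) (F : term -> V) N s :
  \sum_(q <- Flist N.+2 s) F q = \sum_(q <- scl (fun=> Fcoef 0) (tpow s 0)) F q
   + (\sum_(q <- scl (fun=> Fcoef 1) (tpow s 1)) F q + \sum_(q <- Glist N s) F q).
Proof. by rewrite !big_bigcat 2!big_ord_recl. Qed.

(** The bounds [nrm4_tpow] are summed against the Taylor coefficients. The result is
    [delta_rate_sum] with its first term, equal to 3, moved to the other side. *)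
Lemma nrm4_Glist N s r : nrm 0 s <= r -> r < 1 ->
  nrm 4 (Glist N s) <= (3 - delta_rate r) * nrm 4 s.
Proof.
move=> sr r1; have r01 : 0 <= r < 1 by rewrite r1 (le_trans (nrm_ge0 _ _) sr).
have /(ler_wpM2r (nrm_ge0 4 s)) := delta_rate_sum N.+1 r01.
rewrite big_ord_recl expr0 mulr1 exp1n muln1 (_ : 'C(3, 2) = 3)%N// => h.
have {}h : (\sum_(i < N) ('C(i.+4, 2) * i.+2 ^ 4)%:R * r ^+ i.+1) * nrm 4 s <=
   (3 - delta_rate r) * nrm 4 s.
  by move: h; rewrite !mulrDl mulNr; lra.
apply: le_trans h.
rewrite /nrm big_bigcat mulr_suml; apply: ler_sum => n _.
rewrite -[leLHS]/(nrm 4 _) nrm_scl normrM normrX normrN1 expr1n mul1r ger0_norm//.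
rewrite natrM natrX -2!mulrA ler_wpM2l// mulrA (le_trans (nrm4_tpow _ _))//.
rewrite ler_wpM2r ?nrm_ge0// ler_wpM2l ?exprn_ge0//.
by rewrite lerXn2r ?nnegrE ?nrm_ge0//; case/andP: r01.
Qed.

(* explicit Euler step of v' = - 3 Delta^2 v + P_B Delta^2 G_N(v) *)
Definition step N (tau : R) (B : seq 'rV[int]_d) s : seq term :=
  scl (fun k => 1 - 3 * (tau * nk k ^+ 4)) s ++
  scl (fun k => tau * nk k ^+ 4) [seq q <- Glist N s | q.2 \in B].

Section step.
Context (N : nat) (tau : R) (B : seq 'rV[int]_d) (s : seq term) (r : R).
Hypotheses (tau0 : 0 <= tau) (tauB : forall k, k \in B -> 3 * (tau * nk k ^+ 4) <= 1)
  (sB : forall q, q \in s -> q.2 \in B) (sr : nrm 0 s <= r) (r1 : r < 1).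

Lemma step_freq q : q \in step N tau B s -> q.2 \in B.
Proof.
rewrite mem_cat => /orP[] /mapP[p]; first by move=> /sB ? ->.
by rewrite mem_filter => /andP[? _] ->.
Qed.

(** The damping removes exactly [3 * tau * nrm 4 s], since the factors 1 - 3 tau |k|^4 are
    nonnegative and their absolute values open without loss. The nonlinear part gives back at most
    the fraction [3 - delta_rate r] of these 3. *)
Lemma nrm_step : nrm 0 (step N tau B s) <= nrm 0 s - tau * (delta_rate r * nrm 4 s).
Proof.
rewrite nrm_cat.
have -> : nrm 0 (scl (fun k => 1 - 3 * (tau * nk k ^+ 4)) s) =
    nrm 0 s - 3 * tau * nrm 4 s.
  rewrite /nrm big_map mulr_sumr -sumrB !big_seq; apply: eq_bigr => q /sB qB /=.
  by rewrite normrM expr0 ger0_norm ?subr_ge0 ?tauB//; ring.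
have h : nrm 0 (scl (fun k => tau * nk k ^+ 4) [seq q <- Glist N s | q.2 \in B])
    <= tau * nrm 4 (Glist N s).
  rewrite /nrm big_map big_filter mulr_sumr [leLHS]big_mkcond; apply: ler_sum => q _ /=.
  have h0 : 0 <= tau * nk q.2 ^+ 4 by rewrite mulr_ge0// exprn_ge0// normk_ge0.
  case: ifP => _; last by rewrite mulrCA mulr_ge0.
  by rewrite expr0 normrM (ger0_norm h0) mulr1 -mulrA (mulrC (nk _ ^+ 4)).
have g := ler_wpM2l tau0 (nrm4_Glist N sr r1).
have := lerD (lexx (nrm 0 s - 3 * tau * nrm 4 s)) (le_trans h g).
by move/le_trans; apply; rewrite mulrBl mulrBr; lra.
Qed.

End step.

End trigonometric_lists.

(** * Integration on finite measure spaces and on the torus *)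

Section finite_measure_integrals.
Context {disp : measure_display} {T : measurableType disp} {R : realType}.
Context (mu : {finite_measure set T -> \bar R}).
Implicit Types (f g : T -> R).

Lemma integrable_bounded f (M : R) : measurable_fun setT f ->
  (forall x, `|f x| <= M) -> mu.-integrable setT (EFin \o f).
Proof.
move=> mf fM; apply: measurable_bounded_integrable => //.
  by rewrite -ge0_fin_numE ?measure_ge0// fin_num_measure.
exists M; split; first exact: num_real.
by move=> y My x _ /=; rewrite (le_trans (fM x))// ltW.
Qed.

Lemma Rintegral_cstT (c : R) : \int[mu]_x c = c * fine (mu setT).
Proof. by rewrite Rintegral_cst. Qed.

Lemma le_Rintegral_norm f g : mu.-integrable setT (EFin \o f) ->
  mu.-integrable setT (EFin \o g) -> (forall x, `|f x| <= g x) ->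
  `|\int[mu]_x f x| <= \int[mu]_x g x.
Proof.
move=> fi gi fg; rewrite (le_trans (le_normr_Rintegral _ _))//.
by apply: le_Rintegral => //; exact: integrable_norm.
Qed.

Lemma Rintegral_le_bound f (M : R) : measurable_fun setT f ->
  (forall x, `|f x| <= M) -> `|\int[mu]_x f x| <= M * fine (mu setT).
Proof.
move=> mf fM; rewrite -Rintegral_cstT; apply: le_Rintegral_norm => //.
  exact: integrable_bounded fM.
by apply: (@integrable_bounded _ `|M|).
Qed.

Lemma Rdominated_cvg (f_ : nat -> T -> R) f g :
  (forall n, measurable_fun setT (f_ n)) -> measurable_fun setT f ->
  {ae mu, forall x, (f_ ^~ x) @ \oo --> f x} ->
  mu.-integrable setT (EFin \o g) ->
  {ae mu, forall x, forall n, `|f_ n x| <= g x} ->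
  mu.-integrable setT (EFin \o f) /\
  (fun n => \int[mu]_x f_ n x) @ \oo --> \int[mu]_x f x.
Proof.
move=> mf_ mf cf gi fg.
have [|||||fi _ cvi] := @dominated_convergence _ _ _ mu setT measurableT
   (fun n => EFin \o f_ n) (EFin \o f) (EFin \o g).
- by move=> n; exact/measurable_EFinP.
- exact/measurable_EFinP.
- by apply: filterS cf => x cx _; apply: cvg_EFin => //; exact: nearW.
- exact: gi.
- by apply: filterS fg => x gx n _ /=; rewrite lee_fin.
split=> //; rewrite /Rintegral.
apply/fine_cvg; rewrite fineK//.
exact: integrable_fin_num fi.
Qed.

Lemma Rbounded_cvg (f_ : nat -> T -> R) f (M : R) :
  (forall n, measurable_fun setT (f_ n)) ->
  (forall n x, `|f_ n x| <= M) -> (forall x, (f_ ^~ x) @ \oo --> f x) ->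
  (fun n => \int[mu]_x f_ n x) @ \oo --> \int[mu]_x f x.
Proof.
move=> mf_ fM cf.
have mf : measurable_fun setT f by apply: measurable_fun_cvg => // x _; exact: cf.
apply: (proj2 (@Rdominated_cvg f_ f (cst M) mf_ mf _ _ _)).
- exact: aeW.
- by apply: (@integrable_bounded _ `|M|).
- by apply: aeW => x n; exact: fM.
Qed.

Lemma Rintegral_sum (I : Type) (r : seq I) (F : I -> T -> R) :
  (forall i, mu.-integrable setT (EFin \o F i)) ->
  \int[mu]_x (\sum_(i <- r) F i x) = \sum_(i <- r) \int[mu]_x F i x.
Proof.
move=> Fi; elim: r => [|i r IH].
  by rewrite big_nil; under eq_Rintegral do rewrite big_nil; rewrite Rintegral_cstT mul0r.
rewrite big_cons -IH -RintegralD//.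
  by apply: eq_Rintegral => x _; rewrite big_cons.
rewrite (_ : _ \o _ = (fun x => \sum_(i <- r) (F i x)%:E)%E); last first.
  by apply/funext => x; rewrite /= sumEFin.
by apply: integrable_sum => // i0 _; exact: Fi.
Qed.

End finite_measure_integrals.

(** * Fubini's theorem for real-valued integrals *)

Section fubini_real.
Context {d1 d2 : measure_display} {T1 : measurableType d1} {T2 : measurableType d2}.
Context {R : realType}.
Context (m1 : {finite_measure set T1 -> \bar R}) (m2 : {finite_measure set T2 -> \bar R}).
Context (f : T1 * T2 -> R).
Hypothesis fi : (m1 \x m2)%E.-integrable setT (EFin \o f).

Lemma measurable_Rfubini : measurable_fun setT (fun x => \int[m2]_y f (x, y)).
Proof.
by apply: (measurableT_comp (fine_measurable measurableT) (measurable_fubini_F fi)).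
Qed.

Lemma integrable_Rfubini : m1.-integrable setT (EFin \o fun x => \int[m2]_y f (x, y)).
Proof.
apply: le_integrable (integrable_fubini_F fi) => //.
  exact/measurable_EFinP/measurable_Rfubini.
(* [fine] sends infinite values to 0, so the real inner integral is dominated by the extended one at
   every point. *)
move=> x _ /=; rewrite /Rintegral /fubini_F /=.
by case: (integral _ _ _) => //=; rewrite ?normr0 ?leey.
Qed.

Lemma Rfubini1 : \int[(m1 \x m2)%E]_z f z = \int[m1]_x \int[m2]_y f (x, y).
Proof.
rewrite /Rintegral; congr fine.
rewrite -(integral12_prod_meas1 fi); apply: ae_eq_integral => //.
- exact: (measurable_fubini_F fi).
- exact/measurable_EFinP/measurable_Rfubini.
- apply: filterS (ae_integrable1 fi) => x xi _ /=.
  by rewrite /fubini_F /= fineK// (integrable_fin_num _ xi).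
Qed.

End fubini_real.

Section fubini_real_swap.
Context {d1 d2 : measure_display} {T1 : measurableType d1} {T2 : measurableType d2}.
Context {R : realType}.
Context (m1 : {finite_measure set T1 -> \bar R}) (m2 : {finite_measure set T2 -> \bar R}).
Context (f : T1 * T2 -> R).
Hypothesis fi : (m1 \x m2)%E.-integrable setT (EFin \o f).

Lemma measurable_Rfubini2 : measurable_fun setT (fun y => \int[m1]_x f (x, y)).
Proof.
by apply: (measurableT_comp (fine_measurable measurableT) (measurable_fubini_G fi)).
Qed.

Lemma Rfubini2 : \int[(m1 \x m2)%E]_z f z = \int[m2]_y \int[m1]_x f (x, y).
Proof.
rewrite /Rintegral; congr fine.
rewrite -(integral21_prod_meas1 fi); apply: ae_eq_integral => //.
- exact: (measurable_fubini_G fi).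
- exact/measurable_EFinP/measurable_Rfubini2.
- apply: filterS (ae_integrable2 fi) => x xi _ /=.
  by rewrite /fubini_G /= fineK// (integrable_fin_num _ xi).
Qed.

End fubini_real_swap.

Lemma integrable_bounded_prod {d1 d2 : measure_display} {T1 : measurableType d1}
  {T2 : measurableType d2} {R : realType}
  (m1 : {finite_measure set T1 -> \bar R}) (m2 : {finite_measure set T2 -> \bar R})
  (f : T1 * T2 -> R) (M : R) : measurable_fun setT f -> (forall z, `|f z| <= M) ->
  (m1 \x m2)%E.-integrable setT (EFin \o f).
Proof.
move=> mf fM; apply: measurable_bounded_integrable => //.
  have := product_measure1E m1 m2 measurableT measurableT; rewrite setXTT => E.
  rewrite [ltLHS]E lte_mul_pinfty ?measure_ge0 ?fin_num_measure//.
  by rewrite -ge0_fin_numE ?measure_ge0// fin_num_measure.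
exists M; split; first exact: num_real.
by move=> y My x _ /=; rewrite (le_trans (fM x))// ltW.
Qed.

Section countable_partitions.
Context {disp : measure_display} {T : measurableType disp} {R : realType}.

(** The preimages are countable unions of fibres of [E], so [h] may be arbitrary. It serves for
    functions sampled on a grid and for step functions of time. *)
Lemma measurable_countable_fun (C : countType) (E : T -> C) (h : C -> R) :
  (forall c, measurable [set x | E x = c]) -> measurable_fun setT (h \o E).
Proof.
move=> mE _ Y mY; rewrite setTI.
have -> : (h \o E) @^-1` Y = \bigcup_(n in [set: nat])
    (if unpickle n is Some c then [set x | E x = c /\ Y (h c)] else set0).
  apply/seteqP; split => x /=.
    by move=> Yx; exists (pickle (E x)) => //; rewrite pickleK.
  by move=> [n _]; case: unpickle => [c|//] [-> ].
apply: bigcupT_measurable => n; case: unpickle => [c|]; last exact: measurable0.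
have [Yc|Yc] := pselect (Y (h c)).
  rewrite (_ : [set _ | _] = [set x | E x = c])//.
  by apply/seteqP; split => x /= => [[]|].
rewrite (_ : [set _ | _] = set0); first exact: measurable0.
by apply/seteqP; split => x /= => [[]|].
Qed.

End countable_partitions.

(** * Measurability of continuous functions of several variables *)

Section row_measurability.
Context {R : realType} {n : nat}.
Local Notation point := 'rV[R]_n.

Lemma measurable_coord (i : 'I_n) : measurable_fun setT (fun x : point => x ord0 i).
Proof. exact: measurable_rV_coord. Qed.

Definition grid (m : nat) (t : R) : R := (Num.floor (m.+1%:R * t))%:~R / m.+1%:R.

Lemma grid_dist m t : `|t - grid m t| <= m.+1%:R^-1.
Proof.
have m0 : 0 < m.+1%:R :> R by rewrite ltr0n.
have h := floor_itv (m.+1%:R * t); move/andP: h => [h1 h2].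
rewrite /grid ger0_norm; last first.
  by rewrite subr_ge0 ler_pdivrMr// [leRHS]mulrC.
rewrite lerBlDr -[X in X + _]mul1r -mulrDl ler_pdivlMr// mulrC ltW// (lt_le_trans h2)//.
by rewrite intrD addrC.
Qed.

Lemma grid_cvg t : grid ^~ t @ \oo --> t.
Proof.
apply/cvgrPdist_le => e e0; near=> m.
rewrite (le_trans (grid_dist _ _))//.
apply: ltW; near: m; exact: (near_infty_natSinv_lt (PosNum e0)).
Unshelve. all: by end_near. Qed.

Lemma row_norm_le (x : point) (M : R) : 0 <= M ->
  (forall i, `|x ord0 i| <= M) -> `|x| <= M.
Proof.
move=> M0 xM; rewrite [leLHS]mx_normrE; apply/bigmax_leP; split=> //= -[i j] _ /=.
by rewrite ord1; exact: xM.
Qed.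

Lemma cvg_row {I : Type} {F : set_system I} {FF : Filter F} (f : I -> point) (l : point) :
  (forall i, (fun t => f t ord0 i) @ F --> l ord0 i) -> f @ F --> l.
Proof.
move=> fl; apply/cvgrPdist_le => e e0.
have : \forall t \near F, forall i, `|l ord0 i - f t ord0 i| <= e.
  by apply: filter_forall => i; move/cvgrPdist_le : (fl i) => /(_ _ e0).
apply: filterS => t h; apply: row_norm_le => [|i]; first exact: ltW.
by rewrite !mxE h.
Qed.

Definition grid_row m (x : point) : point := \row_i grid m (x ord0 i).

Lemma grid_row_cvg (x : point) : grid_row ^~ x @ \oo --> x.
Proof.
apply: cvg_row => i; rewrite (_ : (fun _ => _) = grid ^~ (x ord0 i)); last first.
  by apply/funext => m; rewrite /grid_row mxE.
exact: grid_cvg.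
Qed.

Let floor_row m (x : point) : 'rV[int]_n := \row_i Num.floor (m.+1%:R * x ord0 i).

Let measurable_floor m (c : int) : measurable [set t : R | Num.floor (m.+1%:R * t) = c].
Proof.
rewrite (_ : [set _ | _] = (fun t => m.+1%:R * t) @^-1` `[c%:~R, (c + 1)%:~R[%classic); last first.
  apply/seteqP; split => t /=; rewrite in_itv/=.
    by move=> <-; have /andP[-> ->] := floor_itv (m.+1%:R * t).
  by move=> h; apply: floor_def.
rewrite -[X in measurable X]setTI; have mm : measurable_fun setT (fun t : R => m.+1%:R * t) by exact: mulrl_measurable.
exact: mm.
Qed.

Let measurable_floor_row m (c : 'rV[int]_n) : measurable [set x | floor_row m x = c].
Proof.
rewrite (_ : [set _ | _] = \big[setI/setT]_(i < n)
    ((fun x : point => x ord0 i) @^-1` [set t | Num.floor (m.+1%:R * t) = c ord0 i])).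
  apply: bigsetI_measurable => i _; rewrite -[X in measurable X]setTI.
  by apply: measurable_coord => //; exact: measurable_floor.
rewrite -bigcap_seq; apply/seteqP; split => x /=.
  by move=> <- i _ /=; rewrite mxE.
by move=> h; apply/rowP => i; rewrite mxE; apply: h; rewrite /= mem_index_enum.
Qed.

(** The sigma-algebra on rows is generated by the coordinates rather than by the open sets. A
    continuous function is reached as the pointwise limit of its samples on the grids of mesh 1 / (m
    + 1), which factor through the countable type of integer rows. *)
Lemma continuous_row_measurable (f : point -> R) : continuous f -> measurable_fun setT f.
Proof.
move=> cf; apply: (@measurable_fun_cvg _ _ _ _ (fun m => f \o grid_row m)).
  move=> m; rewrite (_ : _ \o _ =
     (fun c : 'rV[int]_n => f (\row_i ((c ord0 i)%:~R / m.+1%:R))) \o floor_row m).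
    exact: measurable_countable_fun.
  apply/funext => x /=; congr f; apply/rowP => i.
  by rewrite !mxE.
move=> x _; apply: continuous_cvg; first exact: cf.
exact: grid_row_cvg.
Qed.

Lemma grid_pair_cvg (t : R) (x : point) :
  (fun m => (grid m t, grid_row m x)) @ \oo --> (t, x).
Proof.
apply/cvg_ballP => e e0; near=> m; split => /=.
  by near: m; move: e e0; apply/cvg_ballP; exact: grid_cvg.
by near: m; move: e e0; apply/cvg_ballP; exact: grid_row_cvg.
Unshelve. all: by end_near. Qed.

Lemma continuous_pair_measurable (f : R * point -> R) :
  continuous f -> measurable_fun setT f.
Proof.
move=> cf; apply: (@measurable_fun_cvg _ _ _ _ (fun m => fun z => f (grid m z.1, grid_row m z.2))).
  move=> m; rewrite (_ : (fun _ => _) =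
     (fun c : int * 'rV[int]_n => f (c.1%:~R / m.+1%:R, \row_i ((c.2 ord0 i)%:~R / m.+1%:R)))
       \o (fun z : R * point => (Num.floor (m.+1%:R * z.1), floor_row m z.2))).
    apply: measurable_countable_fun => -[c1 c2].
    rewrite (_ : [set _ | _] = [set t | Num.floor (m.+1%:R * t) = c1] `*` [set x | floor_row m x = c2]).
      by apply: measurableX; [exact: measurable_floor|exact: measurable_floor_row].
    by apply/seteqP; split => -[t x] /= [-> ->].
  apply/funext => -[t x] /=; congr (f (_, _)); apply/rowP => i.
  by rewrite !mxE.
move=> [t x] _; apply: continuous_cvg; first exact: cf.
exact: grid_pair_cvg.
Qed.

End row_measurability.

(** * Integrals over an interval and the fundamental theorem of calculus *)

Section interval_integrals.
Context {R : realType}.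
Implicit Types (a b : R).

Let idR : measurableTypeR R -> R := id.

Let midR : measurable_fun setT idR.
Proof. by move=> _ Y mY; rewrite setTI. Qed.

(** After splitting into positive and negative parts, the integrand is restricted to the interval,
    which carries all the mass, and Lebesgue measure is transported by the identity [idR] between
    the two measurable types of the reals. *)
Lemma integral_interval a b (f : R -> \bar R) : measurable_fun setT f ->
  (\int[interval_measure a b]_x f x = \int[lebesgue_measure]_(x in `[a, b]) f x)%E.
Proof.
pose D : set R := `[a, b]%classic.
have mD : measurable D by exact: measurable_itv.
suff h (g : R -> \bar R) : measurable_fun setT g -> (forall x, 0 <= g x)%E ->
    (\int[interval_measure a b]_x g x = \int[lebesgue_measure]_(x in D) g x)%E.
  move=> mf; rewrite integralE [in RHS]integralE.
  have mp : measurable_fun setT (f ^\+)%E by exact: measurable_funepos.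
  have mn : measurable_fun setT (f ^\-)%E by exact: measurable_funeneg.
  by rewrite (h _ mp)// (h _ mn).
move=> mg g0; transitivity (\int[interval_measure a b]_(x in D) g x)%E.
  rewrite [RHS]integral_mkcond; apply: ae_eq_integral => //.
    by apply/(measurable_restrictT _ mD); exact: measurable_funTS.
  exists (~` D); split => //; first exact: measurableC.
    by rewrite [LHS]/(lebesgue_measure _) setICl measure0.
  move=> x /= nfx xab; apply: nfx => _; rewrite patchE.
  by rewrite mem_set.
have := @ge0_integral_pushforward _ _ _ _ R idR midR (@lebesgue_measure R) D g.
move=> /(_ mD (measurable_funTS mg) (fun x _ => g0 x)) <-.
apply: (@eq_measure_integral _ _ R D
  (measure_function_pushforward__canonical__measure_function_Measure (@lebesgue_measure R) midR)
  (Defs_interval_measure__canonical__measure_function_Measure a b) g) => A mA AD.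
have AE : (A : set R) `&` `[a, b] = A by apply/setIidPl.
by rewrite /= /interval_measure /pushforward AE.
Qed.

Lemma Rintegral_interval a b (f : R -> R) : measurable_fun setT f ->
  \int[interval_measure a b]_x f x = \int[lebesgue_measure]_(x in `[a, b]) f x.
Proof. by move=> mf; rewrite /Rintegral integral_interval//; exact/measurable_EFinP. Qed.

Lemma interval_measureT a b : a <= b -> interval_measure a b setT = (b - a)%:E.
Proof.
move=> ab; rewrite /interval_measure setTI.
rewrite (@lebesgue_measure_itv R `[a, b])/= lte_fin.
by case: ltP => // ba; rewrite (@le_anti _ _ a b) ?ab// subrr.
Qed.

Lemma Rintegral_FTC a b (F f : R -> R) : a <= b ->
  (forall t : R, is_derive t 1 F (f t)) -> continuous f ->
  \int[interval_measure a b]_t f t = F b - F a.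
Proof.
move=> ab dF cf; rewrite Rintegral_interval; last exact: continuous_measurable_fun.
move: ab; rewrite le_eqVlt => /orP[/eqP <-|ab].
  by rewrite set_itv1 Rintegral_set1 subrr.
have cF : continuous F.
  by move=> t; apply: differentiable_continuous; apply/derivable1_diffP; apply: ex_derive.
rewrite /Rintegral (@continuous_FTC2 _ f F)//.
- exact: continuous_subspaceT.
- split.
  + by move=> t _; exact: ex_derive.
  + exact/cvg_at_right_filter/cF.
  + exact/cvg_at_left_filter/cF.
- by move=> t _; rewrite derive1E derive_val.
Qed.

End interval_integrals.

(** * Integration over the torus by induction on the dimension *)

Section torus_integrals.
Context {R : realType}.

Lemma cons_row0 n (t : R) (y : 'rV[R]_n) : cons_row (t, y) ord0 ord0 = t.
Proof.
rewrite /cons_row /= (_ : ord0 = lshift n (ord0 : 'I_1)); last exact: val_inj.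
by apply: (etrans (row_mxEl _ _ ord0 ord0)); rewrite mxE.
Qed.

Lemma cons_rowS n (t : R) (y : 'rV[R]_n) j :
  cons_row (t, y) ord0 (lift ord0 j) = y ord0 j.
Proof.
rewrite /cons_row /= (_ : lift ord0 j = rshift 1 j); last exact: val_inj.
exact: (row_mxEr _ _ ord0 j).
Qed.

Lemma cons_rowP n (z : 'rV[R]_n.+1) (t : R) (y : 'rV[R]_n) :
  z ord0 ord0 = t -> (forall j, z ord0 (lift ord0 j) = y ord0 j) -> z = cons_row (t, y).
Proof.
move=> zt zy; apply/rowP => i; have [->|i0] := eqVneq i ord0; first by rewrite cons_row0.
by have [j ->] : exists j, i = lift ord0 j; [case: (unliftP ord0 i) i0 => [j ->|->] // _; exists j|rewrite cons_rowS].
Qed.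

Lemma basis_shift n (h : R) (z : 'rV[R]_n) j i :
  (h *: basis_vec R j + z) ord0 i = h * (i == j)%:R + z ord0 i.
Proof. by rewrite !mxE eqxx. Qed.

Lemma cons_row_shift0 n (t h : R) (y : 'rV[R]_n) :
  cons_row (h + t, y) = h *: basis_vec R ord0 + cons_row (t, y).
Proof.
apply/esym/cons_rowP => [|j]; rewrite basis_shift.
  by rewrite cons_row0 eqxx mulr1.
by rewrite cons_rowS mulr0 add0r.
Qed.

Lemma cons_row_shiftS n (t h : R) (y : 'rV[R]_n) j :
  cons_row (t, h *: basis_vec R j + y) = h *: basis_vec R (lift ord0 j) + cons_row (t, y).
Proof.
apply/esym/cons_rowP => [|i]; rewrite !basis_shift.
  by rewrite cons_row0 /= mulr0 add0r.
by rewrite cons_rowS /= (inj_eq (@lift_inj _ ord0)).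
Qed.

Lemma cvg_cons_row {I : Type} {F : set_system I} {FF : Filter F} n
    (f : I -> R) (g : I -> 'rV[R]_n) (t : R) (y : 'rV[R]_n) :
  f @ F --> t -> g @ F --> y -> (fun i => cons_row (f i, g i)) @ F --> cons_row (t, y).
Proof.
move=> ft gy; apply: cvg_row => i.
have [->|i0] := eqVneq i ord0.
  rewrite cons_row0; under eq_fun do rewrite cons_row0; exact: ft.
have [j ->] : exists j, i = lift ord0 j.
  by case: (unliftP ord0 i) i0 => [j ->|->] // _; exists j.
rewrite cons_rowS; under eq_fun do rewrite cons_rowS.
apply: (@cvg_comp _ _ _ g (fun v : 'rV[R]_n => v ord0 j) F _ _ gy); exact: coord_continuous.
Qed.

Lemma cons_row_continuous n (t : R) : continuous (fun y : 'rV[R]_n => cons_row (t, y)).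
Proof.
move=> y; apply: (@cvg_cons_row _ (nbhs y) _ n (fun=> t) id t y); last exact: cvg_id.
by apply/cvgrPdist_le => e e0; apply: nearW => z; rewrite subrr normr0 ltW.
Qed.

Lemma interval_measure_pi : interval_measure (- pi) pi setT = (2 * pi : R)%:E.
Proof. by rewrite interval_measureT ?opprK ?mulr_natl ?mulr2n// -subr_ge0 opprK addr_ge0 ?pi_ge0. Qed.

Lemma integrable_cons_row n (f : 'rV[R]_n.+1 -> R) (M : R) :
  measurable_fun setT f -> (forall x, `|f x| <= M) ->
  (interval_measure (- pi) pi \x torus_measure R n)%E.-integrable setT
    (EFin \o (f \o @cons_row R n)).
Proof.
move=> mf fM.
apply: (@integrable_bounded_prod _ _ _ _ _ (interval_measure (- pi) pi) (torus_measure R n) _ M) => [|z]; last exact: fM.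
by apply: measurableT_comp => //; exact: measurable_cons_row.
Qed.

Lemma torus_Rintegral n (f : 'rV[R]_n.+1 -> R) (M : R) :
  measurable_fun setT f -> (forall x, `|f x| <= M) ->
  \int[torus_measure R n.+1]_x f x =
  \int[(interval_measure (- pi) pi \x torus_measure R n)%E]_z f (cons_row z).
Proof.
move=> mf fM.
have mf' : measurable_fun setT (EFin \o f) by exact/measurable_EFinP.
have := @integral_pushforward _ _ _ _ R _ (@measurable_cons_row R n)
  (interval_measure (- pi) pi \x torus_measure R n)%E setT (EFin \o f) mf'.
rewrite preimage_setT => /(_ (integrable_cons_row mf fM) measurableT) h.
by rewrite /Rintegral; congr fine; exact: h.
Qed.

Lemma torus_Rintegral1 n (f : 'rV[R]_n.+1 -> R) (M : R) :
  measurable_fun setT f -> (forall x, `|f x| <= M) ->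
  \int[torus_measure R n.+1]_x f x =
  \int[interval_measure (- pi) pi]_t \int[torus_measure R n]_y f (cons_row (t, y)).
Proof.
move=> mf fM; rewrite (torus_Rintegral mf fM).
exact: (Rfubini1 (integrable_cons_row mf fM)).
Qed.

Lemma torus_Rintegral2 n (f : 'rV[R]_n.+1 -> R) (M : R) :
  measurable_fun setT f -> (forall x, `|f x| <= M) ->
  \int[torus_measure R n.+1]_x f x =
  \int[torus_measure R n]_y \int[interval_measure (- pi) pi]_t f (cons_row (t, y)).
Proof.
move=> mf fM; rewrite (torus_Rintegral mf fM).
exact: (Rfubini2 (integrable_cons_row mf fM)).
Qed.

Lemma torus_measureT n : torus_measure R n setT = ((2 * pi) ^+ n)%:E.
Proof.
elim: n => [|n IH]; first by rewrite /= diracE in_setT.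
transitivity ((interval_measure (- pi) pi \x torus_measure R n)%E setT).
  by rewrite -[in RHS](preimage_setT (@cons_row R n)).
rewrite -setXTT (product_measure1E (interval_measure (- pi) pi) (torus_measure R n))//.
by rewrite exprS EFinM; congr (_ * _)%E; [exact: interval_measure_pi|exact: IH].
Qed.

Lemma torus_cst n (c : R) : \int[torus_measure R n]_x c = c * (2 * pi) ^+ n.
Proof.
rewrite (Rintegral_cstT (torus_measure R n)); congr (_ * _).
exact: (congr1 fine (torus_measureT n)).
Qed.

Lemma cos_shift (m : int) (x : R) : cos (m%:~R * (pi + pi) + x) = cos x.
Proof.
have h (k : nat) y : cos (k%:R * (pi + pi) + y) = cos y :> R.
  elim: k y => [|k IH] y; first by rewrite mul0r add0r.
  rewrite -natr1 mulrDl mul1r -addrA IH addrC -[pi + pi]mulr2n.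
  by rewrite cosD cos2pi sin2pi mulr1 mulr0 subr0.
case: m => k; first exact: h.
rewrite NegzE intrN mulNr -(h k.+1 (- _ + x)).
by rewrite addrA subrr add0r.
Qed.

Lemma interval_cos (m : int) (a : R) :
  \int[interval_measure (- pi) pi]_t cos (m%:~R * t + a) =
  (2 * pi) * (if m == 0 then cos a else 0).
Proof.
have pp : - pi <= pi :> R by rewrite -subr_ge0 opprK addr_ge0 ?pi_ge0.
case: eqP => [->|/eqP m0].
  under eq_Rintegral do rewrite mul0r add0r.
  by rewrite Rintegral_cst//= interval_measure_pi/= mulrC.
pose F (t : R) := sin (m%:~R * t + a) / m%:~R.
have m0' : m%:~R != 0 :> R by rewrite intr_eq0.
have -> : \int[interval_measure (- pi) pi]_t cos (m%:~R * t + a) = F pi - F (- pi).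
  apply: Rintegral_FTC => // t.
    rewrite /F; apply: is_derive_eq.
    by rewrite /GRing.scale/= !(mulr0, add0r, addr0, mulr1); field.
  apply: continuous_comp; last exact: continuous_cos.
  by apply: cvgD; [apply: cvgMl_tmp; exact: cvg_id|exact: cvg_cst].
rewrite /F mulr0 -mulrBl.
have -> : m%:~R * pi + a = m%:~R * (pi + pi) + (m%:~R * - pi + a) by ring.
have sE y : sin y = - cos (y + pi / 2) :> R.
  by rewrite cosD cos_pihalf sin_pihalf mulr0 mulr1 sub0r opprK.
by rewrite !sE -addrA cos_shift subrr mul0r.
Qed.

Lemma dotk_cons_row n (k : 'rV[int]_n.+1) (t : R) (y : 'rV[R]_n) :
  dotk k (cons_row (t, y)) =
  (k ord0 ord0)%:~R * t + dotk (\row_j k ord0 (lift ord0 j)) y.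
Proof.
rewrite /dotk big_ord_recl cons_row0; congr (_ + _).
by apply: eq_bigr => j _; rewrite cons_rowS mxE.
Qed.

Lemma measurable_dotk n (k : 'rV[int]_n) : measurable_fun setT (dotk k : 'rV[R]_n -> R).
Proof.
apply: measurable_sum => i; apply: measurable_funM => //; exact: measurable_coord.
Qed.

Lemma measurable_cos_comp {disp} {T : measurableType disp} (f : T -> R) :
  measurable_fun setT f -> measurable_fun setT (fun x => cos (f x)).
Proof.
exact: (measurableT_comp (continuous_measurable_fun (@continuous_cos R))).
Qed.

Lemma measurable_cos_dotk n (k : 'rV[int]_n) (a : R) :
  measurable_fun setT (fun x : 'rV[R]_n => cos (dotk k x + a)).
Proof.
apply: measurable_cos_comp.
by apply: measurable_funD => //; exact: measurable_dotk.
Qed.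

Lemma norm_cos_le1 (x : R) : `|cos x| <= 1.
Proof. by rewrite ler_norml cos_geN1 cos_le1. Qed.

Lemma norm_sin_le1 (x : R) : `|sin x| <= 1.
Proof. by rewrite ler_norml sin_geN1 sin_le1. Qed.

(** Orthogonality of the characters. The phase [a] makes the induction on the dimension work: the
    first coordinate, once fixed, joins the phase of the integral over the remaining ones. *)
Lemma torus_cos n (k : 'rV[int]_n) (a : R) :
  \int[torus_measure R n]_x cos (dotk k x + a) =
  (2 * pi) ^+ n * (if k == 0 then cos a else 0).
Proof.
elim: n k a => [|n IH] k a.
  have -> : k = 0 by apply/rowP => -[].
  rewrite eqxx expr0 mul1r.
  under eq_Rintegral do rewrite dotk0 add0r.
  by rewrite torus_cst expr0 mulr1.
rewrite (torus_Rintegral1 (measurable_cos_dotk _ _) (fun x => norm_cos_le1 _)).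
pose k' := \row_j k ord0 (lift ord0 j).
under eq_Rintegral => t _.
  under eq_Rintegral => y _.
    rewrite dotk_cons_row addrAC -/k' addrC.
    over.
  rewrite IH; over.
have kE : (k == 0) = (k' == 0) && (k ord0 ord0 == 0).
  apply/eqP/andP => [k0|[/eqP k'0 /eqP k0]].
    by split; apply/eqP; rewrite /k' k0 ?mxE//; apply/rowP => j; rewrite !mxE.
  apply/rowP => i; have [->|i0] := eqVneq i ord0; first by rewrite k0 mxE.
  case: (unliftP ord0 i) i0 => [j ->|->] // _.
  by move/rowP : k'0 => /(_ j); rewrite !mxE.
rewrite kE; case: (k' == 0) => /=; last first.
  under eq_Rintegral do rewrite mulr0.
  by rewrite Rintegral_cstT mul0r mulr0.
rewrite RintegralZl//; last first.
  apply: (@integrable_bounded _ _ _ _ _ 1) => [|t]; last exact: norm_cos_le1.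
  by apply: measurable_cos_comp; apply: measurable_funD => //; exact: mulrl_measurable.
by rewrite interval_cos exprSr mulrA.
Qed.

(** The difference quotients on both sides are identical. This covers slices with some coordinates
    fixed as well as translations by a period. *)
Lemma derive_slice_val {V W : normedModType R} (F : W -> R) (c : V -> W) (x : V) (v : V) (w : W) :
  (forall h : R, c (h *: v + x) = h *: w + c x) -> 'D_v (F \o c) x = 'D_w F (c x).
Proof.
by move=> cE; rewrite /derive; under eq_fun do rewrite /= cE.
Qed.

Lemma derivable_slice {V W : normedModType R} (F : W -> R) (c : V -> W) (x : V) (v : V) (w : W) :
  (forall h : R, c (h *: v + x) = h *: w + c x) ->
  derivable F (c x) w -> derivable (F \o c) x v.
Proof.
move=> cE dF; rewrite /derivable.
suff -> : (fun h : R => h^-1 *: (((F \o c) \o shift x) (h *: v) - (F \o c) x)) =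
    (fun h => h^-1 *: ((F \o shift (c x)) (h *: w) - F (c x))) by exact: dF.
by apply/funext => h /=; rewrite cE.
Qed.

Lemma torus_periodic_int n (F : 'rV[R]_n -> R) i (m : int) (x : 'rV[R]_n) :
  torus_periodic F -> F ((m%:~R * (2 * pi)) *: basis_vec R i + x) = F x.
Proof.
move=> pF.
have h (k : nat) y : F ((k%:R * (2 * pi)) *: basis_vec R i + y) = F y.
  elim: k y => [|k IH] y; first by rewrite mul0r scale0r add0r.
  by rewrite -natr1 mulrDl mul1r scalerDl -addrA IH addrC pF.
case: m => k; first exact: h.
rewrite NegzE intrN mulNr scaleNr -(h k.+1 (- _ + x)).
by rewrite addrA subrr add0r.
Qed.

Lemma periodic_translate n (F : 'rV[R]_n -> R) (k : 'rV[int]_n) (x : 'rV[R]_n) :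
  torus_periodic F -> F ((\row_i ((k ord0 i)%:~R * (2 * pi))) + x) = F x.
Proof.
move=> pF.
have -> : \row_i ((k ord0 i)%:~R * (2 * pi)) =
    \sum_(i < n) ((k ord0 i)%:~R * (2 * pi)) *: basis_vec R i.
  apply/rowP => j; rewrite mxE summxE (bigD1 j)//= big1 ?addr0 => [|i ij].
    by rewrite !mxE !eqxx mulr1.
  by rewrite !mxE eqxx/= eq_sym (negbTE ij) mulr0.
elim: (index_enum _) => [|i s IH]; first by rewrite big_nil add0r.
by rewrite big_cons -addrA torus_periodic_int.
Qed.

Lemma periodic_bounded n (F : 'rV[R]_n -> R) : continuous F -> torus_periodic F ->
  exists M : R, forall x, `|F x| <= M.
Proof.
move=> cF pF.
have cK : compact [set v : 'rV[R]_n | forall i, `[0, 2 * pi]%classic (v ord0 i)].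
  by apply: (@rV_compact _ _ (fun=> `[0, 2 * pi]%classic)) => i; exact: segment_compact.
have : compact (F @` [set v : 'rV[R]_n | forall i, `[0, 2 * pi]%classic (v ord0 i)]).
  by apply: continuous_compact => //; exact: continuous_subspaceT.
move=> /compact_bounded [M [_ HM]]; exists (M + 1) => x.
have p2 : 0 < 2 * pi :> R by rewrite mulr_gt0 ?pi_gt0.
(* Subtracting the integer parts of the coordinates divided by 2 pi moves the point into the compact
   cube [0, 2 pi]^n. *)
pose k := (\row_i (- Num.floor (x ord0 i / (2 * pi)))) : 'rV[int]_n.
rewrite -(periodic_translate k x pF).
apply: (HM (M + 1)); first by rewrite ltrDl.
eexists; last reflexivity.
move=> i; rewrite !mxE /= in_itv/= intrN.
have := floor_itv (x ord0 i / (2 * pi)) => /andP[h1 h2].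
move: h1 h2; rewrite ler_pdivlMr// ltr_pdivrMr// intrD => h1 h2.
rewrite -[1%:~R]/(1 : R) mulrDl mul1r in h2.
by rewrite mulNr addrC subr_ge0 h1/= lerBlDl ltW.
Qed.

Lemma periodic_derive n (F : 'rV[R]_n -> R) w : torus_periodic F ->
  torus_periodic ('D_w F).
Proof.
move=> pF x i; pose c (y : 'rV[R]_n) := y + (2 * pi) *: basis_vec R i.
have E : F \o c = F by apply/funext => y; exact: pF.
have := @derive_slice_val _ _ F c x w w; rewrite E => -> // h.
by rewrite /c addrA.
Qed.

(** In the first direction the fundamental theorem on each line, with periodicity, gives zero; in
    another direction the induction hypothesis applies to the slice with the first coordinate fixed.
    The order of integration is chosen accordingly. *)
Lemma torus_derive0 n (F : 'rV[R]_n -> R) i : continuous F ->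
  (forall x, derivable F x (basis_vec R i)) ->
  continuous ('D_(basis_vec R i) F) -> torus_periodic F ->
  \int[torus_measure R n]_x 'D_(basis_vec R i) F x = 0.
Proof.
elim: n F i => [F []//|n IH] F i cF dF cdF pF.
have pdF := periodic_derive (basis_vec R i) pF.
have [M HM] := periodic_bounded cdF pdF.
have mdF := continuous_row_measurable cdF.
have [i0|] := eqVneq i ord0.
  rewrite (torus_Rintegral2 mdF HM).
  have E y : \int[interval_measure (- pi) pi]_t 'D_(basis_vec R i) F (cons_row (t, y)) = 0.
    transitivity (F (cons_row (pi, y)) - F (cons_row (- pi, y))); last first.
      rewrite {1}(_ : pi = 2 * pi + - pi); last by ring.
      by rewrite cons_row_shift0 (addrC (_ *: _)) pF subrr.
    apply: (@Rintegral_FTC _ _ _ (fun t => F (cons_row (t, y)))).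
    - by rewrite -subr_ge0 opprK addr_ge0 ?pi_ge0.
    - move=> t; apply: DeriveDef.
        apply: (@derivable_slice _ _ F (fun t => cons_row (t, y)) t 1 (basis_vec R i)); last exact: dF.
        by move=> h; rewrite i0 -cons_row_shift0 /GRing.scale/= mulr1.
      apply: (@derive_slice_val _ _ F (fun t => cons_row (t, y)) t 1 (basis_vec R i)).
      by move=> h; rewrite i0 -cons_row_shift0 /GRing.scale/= mulr1.
    - move=> t; apply: (@cvg_comp _ _ _ (fun t => cons_row (t, y)) _ _ _ _ _ (cdF _)).
      by apply: cvg_cons_row; [exact: cvg_id|exact: cvg_cst].
  under eq_Rintegral do rewrite E.
  by rewrite torus_cst mul0r.
case: (unliftP ord0 i) => [j ij|->]; last by rewrite eqxx.
move=> _; rewrite (torus_Rintegral1 mdF HM).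
under eq_Rintegral => t _.
  have E y : 'D_(basis_vec R i) F (cons_row (t, y)) =
      'D_(basis_vec R j) (fun y => F (cons_row (t, y))) y.
    apply/esym/(@derive_slice_val _ _ F (fun y => cons_row (t, y)) y (basis_vec R j) (basis_vec R i)).
    by move=> h; rewrite cons_row_shiftS ij.
  under eq_Rintegral do rewrite E.
  rewrite IH; last 4 first.
  - move=> y; apply: continuous_comp; [exact: cons_row_continuous|exact: cF].
  - move=> y; apply: (@derivable_slice _ _ F (fun y => cons_row (t, y)) y (basis_vec R j) (basis_vec R i)); last exact: dF.
    by move=> h; rewrite cons_row_shiftS ij.
  - have cE : 'D_(basis_vec R j) (fun y => F (cons_row (t, y))) =
        'D_(basis_vec R i) F \o (fun y => cons_row (t, y)).
      by apply/funext => y /=; rewrite E.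
    by rewrite cE => y; apply: continuous_comp; [exact: cons_row_continuous|exact: cdF].
  - by move=> y k; rewrite addrC cons_row_shiftS addrC pF.
  over.
by rewrite (Rintegral_cstT (interval_measure (- pi) pi)) mul0r.
Qed.

End torus_integrals.

(** * Fourier coefficients and absolutely convergent series *)

Section amplitude.
Context {R : realType}.
Implicit Types p q : R * R.

Definition amp p : R := Num.sqrt (p.1 ^+ 2 + p.2 ^+ 2).

Lemma amp_ge0 p : 0 <= amp p. Proof. exact: sqrtr_ge0. Qed.

Lemma amp_sqr p : amp p ^+ 2 = p.1 ^+ 2 + p.2 ^+ 2.
Proof. by rewrite sqr_sqrtr// addr_ge0 ?sqr_ge0. Qed.

Lemma amp_polar p : exists a, p.1 = amp p * cos a /\ p.2 = - (amp p * sin a).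
Proof.
have [h0|h0] := eqVneq (amp p) 0.
  exists 0; have := amp_sqr p; rewrite h0 expr0n/= => /esym/eqP.
  rewrite paddr_eq0 ?sqr_ge0// !sqrf_eq0 => /andP[/eqP -> /eqP ->].
  by rewrite !mul0r oppr0.
have hp : 0 < amp p by rewrite lt_def h0 amp_ge0.
have p1 : `|p.1| <= amp p.
  rewrite -(@ler_pXn2r _ 2)// ?nnegrE ?amp_ge0// real_normK ?num_real//.
  by rewrite amp_sqr lerDl sqr_ge0.
have c1 : -1 <= p.1 / amp p <= 1.
  by rewrite -ler_norml normrM normfV (ger0_norm (amp_ge0 p)) ler_pdivrMr// mul1r.
pose b := acos (p.1 / amp p).
have cb : cos b = p.1 / amp p by rewrite acosK// in_itv.
have sb : amp p * sin b = `|p.2|.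
  have sb0 : 0 <= sin b by rewrite sin_acos// sqrtr_ge0.
  apply/eqP; rewrite -(@eqrXn2 _ 2)// ?mulr_ge0 ?amp_ge0//.
  have p2E : p.2 ^+ 2 = amp p ^+ 2 - p.1 ^+ 2 by rewrite amp_sqr addrAC subrr add0r.
  rewrite exprMn sin2cos2 cb real_normK ?num_real// p2E; apply/eqP.
  by field.
(* The arccosine determines the angle up to sign, and the sign is read off from [p.2]. *)
have [p20|p20] := leP 0 p.2.
  exists (- b); rewrite cosN sinN cb mulrN opprK sb ger0_norm//.
  by rewrite mulrC mulfVK.
exists b; rewrite cb sb ltr0_norm// opprK.
by rewrite mulrC mulfVK.
Qed.

(** With [amp_polarE] this presents [amp] as a maximum of linear forms over the phase.
    Subadditivity, bounds for integrals and limits are then proved at a fixed phase. *)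
Lemma polar_le_amp p a : p.1 * cos a + p.2 * sin a <= amp p.
Proof.
have [b [-> ->]] := amp_polar p.
rewrite mulNr -!mulrA -mulrBr -cosD ler_piMr ?amp_ge0//; exact: cos_le1.
Qed.

Lemma norm_polar_le_amp p a : `|p.1 * cos a + p.2 * sin a| <= amp p.
Proof.
rewrite ler_norml polar_le_amp andbT lerNl.
have := polar_le_amp p (a + pi); rewrite cosDpi sinDpi !mulrN -opprD; exact.
Qed.

Definition angle p : R := xget 0 [set a | p.1 = amp p * cos a /\ p.2 = - (amp p * sin a)].

Lemma angleP p : p.1 = amp p * cos (angle p) /\ p.2 = - (amp p * sin (angle p)).
Proof. have [a aP] := amp_polar p; rewrite /angle; case: xgetP => [b -> //|/(_ a)]; by case. Qed.

Lemma amp_polarE p : exists a, amp p = p.1 * cos a + p.2 * sin a.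
Proof.
have [a [p1 p2]] := amp_polar p; exists (- a); rewrite cosN sinN {1}p1 {1}p2.
rewrite mulrNN -!mulrA -mulrDr -!expr2 cos2Dsin2 mulr1.
by [].
Qed.

Lemma ampD p q : amp (p + q) <= amp p + amp q.
Proof.
have [a ->] := amp_polarE (p + q).
by rewrite /= !mulrDl addrACA lerD// polar_le_amp.
Qed.

Lemma ampN p : amp (- p) = amp p.
Proof. by rewrite /amp /= !sqrrN. Qed.

Lemma ampB p q : amp (p - q) <= amp p + amp q.
Proof. by rewrite -(ampN q) ampD. Qed.

Lemma ampC p q : amp (p - q) = amp (q - p).
Proof. by rewrite -ampN opprB. Qed.

Lemma amp0 : amp 0 = 0.
Proof. by rewrite /amp /= expr0n/= addr0 sqrtr0. Qed.

Lemma norm_fst_le_amp p : `|p.1| <= amp p.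
Proof. by have := norm_polar_le_amp p 0; rewrite cos0 sin0 mulr1 mulr0 addr0. Qed.

Lemma norm_snd_le_amp p : `|p.2| <= amp p.
Proof.
have := norm_polar_le_amp p (pi / 2).
by rewrite cos_pihalf sin_pihalf mulr1 mulr0 add0r.
Qed.

Lemma amp_le_norm p : amp p <= `|p.1| + `|p.2|.
Proof.
have [a ->] := amp_polarE p; rewrite lerD// (le_trans (ler_norm _))// normrM.
  by rewrite ler_piMr// norm_cos_le1.
by rewrite ler_piMr// norm_sin_le1.
Qed.

End amplitude.

Lemma cvg_sumr {R : realType} {T I : Type} (F : set_system T) (FF : Filter F) (r : seq I)
    (f : I -> T -> R) (l : I -> R) : (forall i, f i @ F --> l i) ->
  (fun t => \sum_(i <- r) f i t) @ F --> \sum_(i <- r) l i.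
Proof.
move=> fl; elim: r => [|i r IH].
  by rewrite big_nil; under eq_fun do rewrite big_nil; exact: cvg_cst.
rewrite big_cons; under eq_fun do rewrite big_cons; exact: cvgD.
Qed.

Lemma cvg_ext {R : realType} (f g : nat -> R) (a : R) :
  f =1 g -> f @ \oo --> a -> g @ \oo --> a.
Proof. by move=> /funext ->. Qed.

Lemma continuous_add {T : topologicalType} {R : realType} (f g : T -> R) :
  continuous f -> continuous g -> continuous (fun x => f x + g x).
Proof. by move=> cf cg x; exact: (cvgD (cf x) (cg x)). Qed.

Lemma continuous_mul {T : topologicalType} {R : realType} (f g : T -> R) :
  continuous f -> continuous g -> continuous (fun x => f x * g x).
Proof. by move=> cf cg x; exact: (cvgM (cf x) (cg x)). Qed.

Lemma continuous_const {T : topologicalType} {R : realType} (c : R) :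
  continuous (fun _ : T => c).
Proof. by move=> x; apply/cvgrPdist_le => e e0; apply: nearW => z; rewrite subrr normr0 ltW. Qed.

Lemma continuous_sum_fun {T : topologicalType} {R : realType} {I : Type} (r : seq I)
    (f : I -> T -> R) : (forall i, continuous (f i)) ->
  continuous (fun x => \sum_(i <- r) f i x).
Proof. by move=> cf x; apply: cvg_sumr => i; exact: cf. Qed.

Lemma cvg_le_all {R : realType} (f : nat -> R) (a b : R) :
  f @ \oo --> a -> (forall n, f n <= b) -> a <= b.
Proof. by move=> fa fb; apply: (cvgr_to_le fa); exact: nearW. Qed.

Section fourier_coefficients.
Context {R : realType} {d : nat}.
Local Notation nk := (@normk R d).
Local Notation point := 'rV[R]_d.
Local Notation dx := (torus_measure R d).
Implicit Types (k : 'rV[int]_d) (u : point -> R) (s : seq (@term R d)).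

Definition fcos u k : R := (2 * pi) ^- d * \int[dx]_x (u x * cos (dotk k x)).
Definition fsin u k : R := (2 * pi) ^- d * \int[dx]_x (u x * sin (dotk k x)).
Definition fcoef u k : R * R := (fcos u k, fsin u k).

Lemma normc_fourier u k : ComplexField.Normc.normc (fourier u k) = amp (fcoef u k).
Proof.
rewrite /fourier /amp /fcoef /fcos /fsin /=; congr Num.sqrt.
by rewrite !mul0r subr0 addr0 mulrN sqrrN.
Qed.

Lemma measurable_cos_dot k : measurable_fun setT (fun x : point => cos (dotk k x)).
Proof. by under eq_fun do rewrite -[dotk k _]addr0; exact: measurable_cos_dotk. Qed.

Lemma sin_as_cos (x : R) : sin x = cos (x - pi / 2).
Proof. by rewrite cosB cos_pihalf sin_pihalf mulr0 mulr1 add0r. Qed.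

Lemma measurable_sin_dot k : measurable_fun setT (fun x : point => sin (dotk k x)).
Proof. by under eq_fun do rewrite sin_as_cos; exact: measurable_cos_dotk. Qed.

Lemma cvg_Rintegral_mul (f_ : nat -> point -> R) (f g : point -> R) (M N : R) :
  (forall n, measurable_fun setT (f_ n)) -> measurable_fun setT g ->
  (forall n x, `|f_ n x| <= M) -> (forall x, `|g x| <= N) ->
  (forall x, (f_ ^~ x) @ \oo --> f x) ->
  (fun n => \int[dx]_x (f_ n x * g x)) @ \oo --> \int[dx]_x (f x * g x).
Proof.
move=> mf mg fM gN ff; apply: (@Rbounded_cvg _ _ _ _ _ _ (M * N)).
- by move=> n; exact: measurable_funM.
- by move=> n x; rewrite normrM ler_pM.
- by move=> x; apply: cvgMr_tmp; exact: ff.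
Qed.

Lemma cvg_fcoef (f_ : nat -> point -> R) (f : point -> R) (M : R) k :
  (forall n, measurable_fun setT (f_ n)) -> (forall n x, `|f_ n x| <= M) ->
  (forall x, (f_ ^~ x) @ \oo --> f x) ->
  (fun n => fcos (f_ n) k) @ \oo --> fcos f k /\
  (fun n => fsin (f_ n) k) @ \oo --> fsin f k.
Proof.
move=> mf fM ff; split; apply: cvgMl_tmp; apply: (@cvg_Rintegral_mul _ _ _ M 1) => //.
- exact: measurable_cos_dot.
- by move=> x; exact: norm_cos_le1.
- exact: measurable_sin_dot.
- by move=> x; exact: norm_sin_le1.
Qed.

(* the Fourier coefficients of [ev s]; a term of frequency l contributes at l and at - l *)
Definition lcoef s k : R * R := \sum_(q <- s)
  ((q.1.1 / 2 * ((q.2 == k)%:R + (q.2 == - k)%:R) * cos q.1.2,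
    q.1.1 / 2 * ((q.2 == - k)%:R - (q.2 == k)%:R) * sin q.1.2) : R * R).

Lemma lcoef1 s k : (lcoef s k).1 = \sum_(q <- s)
  q.1.1 / 2 * ((q.2 == k)%:R + (q.2 == - k)%:R) * cos q.1.2.
Proof. by rewrite /lcoef; elim/big_rec2 : _ => // q x y _ <-. Qed.

Lemma lcoef2 s k : (lcoef s k).2 = \sum_(q <- s)
  q.1.1 / 2 * ((q.2 == - k)%:R - (q.2 == k)%:R) * sin q.1.2.
Proof. by rewrite /lcoef; elim/big_rec2 : _ => // q x y _ <-. Qed.

Lemma lcoef_cat s t k : lcoef (s ++ t) k = lcoef s k + lcoef t k.
Proof. by rewrite /lcoef big_cat. Qed.

Lemma torus_cos_term (q : @term R d) k a :
  \int[dx]_x (q.1.1 * cos (dotk q.2 x + q.1.2) * cos (dotk k x + a)) =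
  (2 * pi) ^+ d * (q.1.1 / 2 * ((q.2 == - k)%:R * cos (q.1.2 + a) + (q.2 == k)%:R * cos (q.1.2 - a))).
Proof.
have ic (l : 'rV[int]_d) c : dx.-integrable setT (EFin \o (fun x => cos (dotk l x + c))).
  apply: (@integrable_bounded _ _ _ _ _ 1); first exact: measurable_cos_dotk.
  by move=> x; exact: norm_cos_le1.
have E (x : point) : q.1.1 * cos (dotk q.2 x + q.1.2) * cos (dotk k x + a) =
    q.1.1 / 2 * (cos (dotk (q.2 + k) x + (q.1.2 + a)) + cos (dotk (q.2 - k) x + (q.1.2 - a))).
  have -> : dotk (q.2 + k) x + (q.1.2 + a) = (dotk q.2 x + q.1.2) + (dotk k x + a).
    by rewrite dotkD addrACA.
  have -> : dotk (q.2 - k) x + (q.1.2 - a) = (dotk q.2 x + q.1.2) - (dotk k x + a).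
    by rewrite dotkD dotkN opprD addrACA.
  move: (dotk q.2 x + q.1.2) (dotk k x + a) => X Y; rewrite cosD cosB; by field.
under eq_Rintegral do rewrite E.
rewrite RintegralZl//; last first.
  exact: (integrableD measurableT (ic (q.2 + k) (q.1.2 + a)) (ic (q.2 - k) (q.1.2 - a))).
rewrite RintegralD// !torus_cos addr_eq0 subr_eq0.
by case: eqP => _; case: eqP => _; rewrite ?mul1r ?mul0r ?mulr0 ?add0r ?addr0; ring.
Qed.

Lemma measurable_ev s : measurable_fun setT (ev s : point -> R).
Proof.
apply: measurable_sum => q; apply: measurable_funM => //; exact: measurable_cos_dotk.
Qed.

(** The phase treats both coefficients at once: [a = 0] gives the cosine coefficient and
    [a = - (pi / 2)] the sine coefficient. *)
Lemma ev_coef s k a : \int[dx]_x (ev s x * cos (dotk k x + a)) =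
  (2 * pi) ^+ d * ((lcoef s k).1 * cos a - (lcoef s k).2 * sin a).
Proof.
rewrite /ev; under eq_Rintegral do rewrite mulr_suml.
rewrite Rintegral_sum; last first.
  move=> q; apply: (@integrable_bounded _ _ _ _ _ `|q.1.1|).
    by apply: measurable_funM; [apply: measurable_funM => //|]; exact: measurable_cos_dotk.
  move=> x; rewrite !normrM -mulrA ler_piMr// mulr_ile1// ?norm_cos_le1//.
rewrite lcoef1 lcoef2 !mulr_suml -sumrB mulr_sumr; apply: eq_bigr => q _.
rewrite torus_cos_term; congr (_ * _); rewrite cosD cosB; ring.
Qed.

Lemma fcoef_ev s k : fcoef (ev s) k = lcoef s k.
Proof.
have p0 : (2 * pi) ^+ d != 0 :> R by rewrite expf_neq0// mulf_neq0// gt_eqF// pi_gt0.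
rewrite /fcoef /fcos /fsin [RHS]surjective_pairing; congr (_, _).
  have := ev_coef s k 0; under eq_Rintegral do rewrite addr0.
  by rewrite cos0 sin0 mulr1 mulr0 subr0 => ->; rewrite mulKf.
have := ev_coef s k (- (pi / 2)); under eq_Rintegral do rewrite -sin_as_cos.
by rewrite cosN sinN cos_pihalf sin_pihalf mulr0 sub0r mulrN1 opprK => ->; rewrite mulKf.
Qed.

Lemma sum_uniq_eq (K : seq 'rV[int]_d) (F : 'rV[int]_d -> R) l : uniq K ->
  \sum_(k <- K) F k * (l == k)%:R = F l * (l \in K)%:R.
Proof.
move=> uK; have [lK|lK] := boolP (l \in K).
  rewrite (bigD1_seq l)//= eqxx mulr1 big1 ?addr0// => k kl.
  by rewrite eq_sym (negbTE kl) mulr0.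
rewrite mulr0 big_seq big1// => k kK; case: eqP lK => [->|_ _]; last by rewrite mulr0.
by rewrite kK.
Qed.

Lemma sum_uniq_opp (K : seq 'rV[int]_d) (F : 'rV[int]_d -> R) l : uniq K ->
  \sum_(k <- K) F k * (l == - k)%:R = F (- l) * (- l \in K)%:R.
Proof.
by move=> uK; rewrite -sum_uniq_eq//; apply: eq_bigr => k _; rewrite eqr_oppLR.
Qed.

(** A term of frequency l gives half of its amplitude to l and half to -l, which have the same norm.
    For fixed phases [al] the left side is linear in the coefficients and so survives limits; the
    best phases give [lcoef_le_nrm]. *)
Lemma lcoef_phase_le a s (K : seq 'rV[int]_d) (al : 'rV[int]_d -> R) : uniq K ->
  \sum_(k <- K) nk k ^+ a * ((lcoef s k).1 * cos (al k) + (lcoef s k).2 * sin (al k)) <= nrm a s.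
Proof.
move=> uK.
have E k : (lcoef s k).1 * cos (al k) + (lcoef s k).2 * sin (al k) =
  \sum_(q <- s) q.1.1 / 2 * ((q.2 == k)%:R * cos (q.1.2 + al k) + (q.2 == - k)%:R * cos (q.1.2 - al k)).
  rewrite lcoef1 lcoef2 !mulr_suml -big_split; apply: eq_bigr => q _ /=.
  rewrite cosD cosB; ring.
apply: (@le_trans _ _ (\sum_(k <- K) \sum_(q <- s) `|q.1.1| / 2 *
    (nk k ^+ a * (q.2 == k)%:R + nk k ^+ a * (q.2 == - k)%:R))).
  apply: ler_sum => k _; rewrite E mulr_sumr; apply: ler_sum => q _.
  have nk0 : 0 <= nk k ^+ a by rewrite exprn_ge0 ?normk_ge0.
  rewrite mulrCA -mulrDr (le_trans (ler_norm _))// !normrM (@ger0_norm _ 2^-1)//.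
  rewrite ler_wpM2l ?divr_ge0// (ger0_norm nk0) ler_wpM2l//.
  by rewrite (le_trans (ler_normD _ _))// lerD// normrM ger0_norm// ler_piMr// norm_cos_le1.
rewrite exchange_big; apply: ler_sum => q _.
rewrite -mulr_sumr big_split/= (sum_uniq_eq _ _ uK) (sum_uniq_opp _ _ uK) normkN -mulrDr.
rewrite -mulrA ler_wpM2l// mulrCA ler_piMr ?exprn_ge0 ?normk_ge0//.
by case: (_ \in _); case: (_ \in _) => /=; rewrite ?addr0 ?add0r ?mulr0 ?mulr1; lra.
Qed.

Lemma lcoef_le_nrm a s (K : seq 'rV[int]_d) : uniq K ->
  \sum_(k <- K) nk k ^+ a * amp (lcoef s k) <= nrm a s.
Proof.
move=> uK; have /choice[al alE] := fun k => amp_polarE (lcoef s k).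
by under eq_bigr do rewrite alE; exact: lcoef_phase_le.
Qed.

Definition trig (p : R * R) k (x : point) : R :=
  p.1 * cos (dotk k x) + p.2 * sin (dotk k x).

Lemma trigD p q k x : trig (p + q) k x = trig p k x + trig q k x.
Proof. by rewrite /trig /= !mulrDl addrACA. Qed.

Lemma trigN p k x : trig (- p) k x = - trig p k x.
Proof. by rewrite /trig /= !mulNr opprD. Qed.

Lemma norm_trig_le p k x : `|trig p k x| <= amp p.
Proof. exact: norm_polar_le_amp. Qed.

Lemma ev_trig s (K : seq 'rV[int]_d) x : uniq K ->
  (forall q, q \in s -> q.2 \in K /\ - q.2 \in K) ->
  ev s x = \sum_(k <- K) trig (lcoef s k) k x.
Proof.
move=> uK sK; rewrite /trig.
transitivity (\sum_(k <- K) \sum_(q <- s) q.1.1 / 2 *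
  (cos (dotk k x + q.1.2) * (q.2 == k)%:R + cos (dotk k x - q.1.2) * (q.2 == - k)%:R)).
  rewrite exchange_big [LHS]big_seq [RHS]big_seq; apply: eq_bigr => q /sK[qK qK'].
  rewrite -mulr_sumr big_split/= (sum_uniq_eq _ _ uK) (sum_uniq_opp _ _ uK).
  rewrite qK qK' !mulr1 dotkN -opprD cosN; by field.
apply: eq_bigr => k _; rewrite lcoef1 lcoef2 !mulr_suml -big_split; apply: eq_bigr => q _ /=.
rewrite cosD cosB; ring.
Qed.

End fourier_coefficients.

(** * Absolutely convergent series over all frequencies *)

Section code_series.
Context {R : realType} {d : nat}.
Local Notation nk := (@normk R d).
Local Notation point := 'rV[R]_d.
Local Notation freq := 'rV[int]_d.
Local Notation dx := (torus_measure R d).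
Implicit Types (k : freq) (c : freq -> R * R).

(** Finite sets exhausting the lattice in the order of the codes of a countable type, not by size.
    The series below converge absolutely, so the order is immaterial; [large_freq] relates codes to
    norms. *)
Definition freqs n : seq freq := pmap (@pickle_inv _) (iota 0 n).

Lemma mem_freqs n k : (k \in freqs n) = (pickle k < n)%N.
Proof.
rewrite /freqs mem_pmap; apply/mapP/idP => [[m]|kn].
  rewrite mem_iota add0n => /andP[_ mn] /esym mk.
  by have := @pickle_invK freq m; rewrite mk /= => ->.
by exists (pickle k); rewrite ?pickleK_inv// mem_iota.
Qed.

Lemma uniq_freqs n : uniq (freqs n).
Proof.
apply: (@pmap_uniq _ _ _ pickle); last exact: iota_uniq.
exact: pickle_invK.
Qed.

Lemma freqsS n : freqs n.+1 = freqs n ++ (if pickle_inv n is Some k then [:: k] else [::]).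
Proof. by rewrite /freqs -[n.+1]addn1 iotaD pmap_cat/= add0n; case: pickle_inv. Qed.

(** Integers that code no frequency contribute 0, so that a sum over [freqs n] becomes a partial sum
    of an ordinary series. *)
Definition codes (V : nmodType) (F : freq -> V) (j : nat) : V :=
  oapp F 0 (pickle_inv j).

Lemma sum_freqs (V : nmodType) (F : freq -> V) n :
  \sum_(k <- freqs n) F k = \sum_(0 <= j < n) codes F j.
Proof.
elim: n => [|n IH]; first by rewrite big_nil big_geq.
rewrite freqsS big_cat/= IH big_nat_recr//= /codes; congr (_ + _).
by case: pickle_inv => [k|] /=; rewrite ?big_seq1 ?big_nil.
Qed.

Lemma sum_freqs_mono (F : freq -> R) : (forall k, 0 <= F k) ->
  {homo (fun n => \sum_(k <- freqs n) F k) : m n / (m <= n)%N >-> m <= n}.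
Proof.
move=> F0; apply: (@homo_leq _ _ (fun x y : R => x <= y)) => [//|y x z|n]; first exact: le_trans.
by rewrite freqsS big_cat/= lerDl; case: pickle_inv => [k|]; rewrite ?big_seq1 ?big_nil.
Qed.

Lemma sub_freqs (K : seq freq) : exists n, {subset K <= freqs n}.
Proof.
exists (\max_(k <- K) pickle k).+1 => k kK; rewrite mem_freqs ltnS.
by rewrite (big_rem k)//= leq_maxl.
Qed.

Lemma sum_uniq_le_freqs (K : seq freq) (F : freq -> R) M : uniq K -> (forall k, 0 <= F k) ->
  (forall n, \sum_(k <- freqs n) F k <= M) -> \sum_(k <- K) F k <= M.
Proof.
move=> uK F0 FM; have [n Kn] := sub_freqs K; apply: le_trans (FM n).
rewrite [leRHS](bigID (fun k => k \in K))/= -[leLHS]addr0 lerD//; last exact: sumr_ge0.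
rewrite -[leRHS]big_filter (perm_big [seq k <- freqs n | k \in K])//.
apply: uniq_perm => //; first by rewrite filter_uniq// uniq_freqs.
by move=> k; rewrite mem_filter; case: (boolP (k \in K)) => //= /Kn ->.
Qed.

Definition ptrig c n (x : point) : R := \sum_(k <- freqs n) trig (c k) k x.

Definition fser c (x : point) : R := limn (fun n => ptrig c n x).

(** A weighted l^1 norm at most [M], expressed through partial sums so that no limit has to be known
    to exist. *)
Definition bsum (w : freq -> R) c (M : R) : Prop :=
  forall n, \sum_(k <- freqs n) w k * amp (c k) <= M.

Definition summable_coef c : Prop := exists M, bsum (fun=> 1) c M.

Lemma ptrigB c m n x : (m <= n)%N ->
  `|ptrig c n x - ptrig c m x| <= \sum_(k <- freqs n) amp (c k) - \sum_(k <- freqs m) amp (c k).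
Proof.
move=> /subnK <-; elim: (n - m)%N => [|j IH]; first by rewrite add0n !subrr normr0.
rewrite addSn /ptrig freqsS !big_cat/= addrAC (le_trans (ler_normD _ _))//.
rewrite addrAC lerD//.
by case: pickle_inv => [k|]; rewrite ?big_seq1 ?big_nil ?normr0// norm_trig_le.
Qed.

Lemma bsum1 c M : bsum (fun=> 1) c M -> forall n, \sum_(k <- freqs n) amp (c k) <= M.
Proof. by move=> cM n; have := cM n; under eq_bigr do rewrite mul1r. Qed.

Lemma bsum_amp c M k : bsum (fun=> 1) c M -> amp (c k) <= M.
Proof.
move=> /bsum1/(sum_uniq_le_freqs (K := [:: k]) isT (fun k => amp_ge0 _)).
by rewrite big_seq1.
Qed.

Lemma cvg_amp_sum c : summable_coef c -> cvgn (fun n => \sum_(k <- freqs n) amp (c k)).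
Proof.
move=> [M /bsum1 cM]; apply: nondecreasing_is_cvgn.
  by apply: sum_freqs_mono => k; exact: amp_ge0.
by exists M => _ [n _ <-]; exact: cM.
Qed.

Lemma ptrig_series c n x : ptrig c n x = series (codes (fun k => trig (c k) k x)) n.
Proof. exact: sum_freqs. Qed.

Lemma fser_cvg c x : summable_coef c -> (fun n => ptrig c n x) @ \oo --> fser c x.
Proof.
move=> cM; rewrite /fser; suff : cvgn (fun n => ptrig c n x) by [].
under eq_fun do rewrite ptrig_series.
apply: normed_cvg; apply: (@series_le_cvg _ _ (codes (fun k => amp (c k)))).
- by move=> n; exact: normr_ge0.
- by move=> n; rewrite /codes; case: (pickle_inv n) => [k|] //=; exact: amp_ge0.
- move=> n; rewrite /codes /=; case: (pickle_inv n) => [k|] /=; first exact: norm_trig_le.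
  by rewrite normr0.
- have := cvg_amp_sum cM; under eq_fun do rewrite sum_freqs; exact.
Qed.

Lemma fser_dist c n x e : summable_coef c ->
  (forall m, (n <= m)%N -> \sum_(k <- freqs m) amp (c k) - \sum_(k <- freqs n) amp (c k) <= e) ->
  `|fser c x - ptrig c n x| <= e.
Proof.
move=> cM h; have cf := @fser_cvg c x cM.
apply: (@cvgr_to_le _ \oo _ R (fun m => `|ptrig c m x - ptrig c n x|)).
  by apply: cvg_norm; apply: cvgB; [exact: cf|exact: cvg_cst].
by near=> m; rewrite (le_trans (@ptrigB c n m x _)) ?h//; near: m; exact: nbhs_infty_ge.
Unshelve. all: by end_near. Qed.

Lemma fser_le c M x : bsum (fun=> 1) c M -> `|fser c x| <= M.
Proof.
move=> cM; rewrite -[fser c x]subr0.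
have -> : 0 = ptrig c 0 x by rewrite /ptrig big_nil.
apply: fser_dist => [|m _]; first by exists M.
by rewrite [X in _ - X]big_nil subr0; exact: bsum1.
Qed.

Lemma measurable_trig p k : measurable_fun setT (trig p k : point -> R).
Proof.
by apply: measurable_funD; apply: measurable_funM => //;
  [exact: measurable_cos_dot|exact: measurable_sin_dot].
Qed.

Lemma measurable_ptrig c n : measurable_fun setT (ptrig c n).
Proof. by apply: measurable_sum => k; exact: measurable_trig. Qed.

Lemma measurable_fser c : summable_coef c -> measurable_fun setT (fser c).
Proof.
move=> cM; apply: (@measurable_fun_cvg _ _ _ _ (fun n => ptrig c n)).
  by move=> n; exact: measurable_ptrig.
by move=> x _; exact: fser_cvg.
Qed.

Lemma ptrig_le c M n x : bsum (fun=> 1) c M -> `|ptrig c n x| <= M.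
Proof.
move=> /bsum1 cM; apply: le_trans (cM n).
by apply: le_trans (ler_norm_sum _ _ _) _; apply: ler_sum => k _; exact: norm_trig_le.
Qed.

Lemma bsumD w c1 c2 M1 M2 : (forall k, 0 <= w k) -> bsum w c1 M1 -> bsum w c2 M2 ->
  bsum w (fun k => c1 k + c2 k) (M1 + M2).
Proof.
move=> w0 h1 h2 n; rewrite (le_trans _ (lerD (h1 n) (h2 n)))// -big_split.
by apply: ler_sum => k _ /=; rewrite -mulrDr ler_wpM2l// ampD.
Qed.

Lemma bsumN w c M : bsum w c M -> bsum w (fun k => - c k) M.
Proof. by move=> h n; under eq_bigr do rewrite ampN; exact: h. Qed.

Lemma fserB c1 c2 x : summable_coef c1 -> summable_coef c2 ->
  fser (fun k => c1 k - c2 k) x = fser c1 x - fser c2 x.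
Proof.
move=> h1 h2; apply/cvg_lim => //.
have -> : (fun n => ptrig (fun k => c1 k - c2 k) n x) =
   (fun n => ptrig c1 n x - ptrig c2 n x).
  apply/funext => n; rewrite /ptrig -sumrB; apply: eq_bigr => k _.
  by rewrite trigD trigN.
by apply: cvgB; exact: fser_cvg.
Qed.

(* a list with the same partial sums, used to transfer facts about lists *)
Definition clist c (B : seq freq) : seq (@term R d) :=
  [seq (amp (c k), angle (c k), k) | k <- B].

Lemma nrm_clist a c B : nrm a (clist c B) = \sum_(k <- B) nk k ^+ a * amp (c k).
Proof.
rewrite /nrm big_map; apply: eq_bigr => k _ /=.
by rewrite ger0_norm ?amp_ge0// mulrC.
Qed.

Lemma ev_clist c n x : ev (clist c (freqs n)) x = ptrig c n x.
Proof.
rewrite /ev big_map; apply: eq_bigr => k _ /=; have [h1 h2] := angleP (c k).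
rewrite /trig h1 h2 cosD; ring.
Qed.

(** Here [c] may fail to be symmetric, and then the true coefficients of [fser c] differ from [c],
    as k and -k share their contributions. With the phases that are optimal for the limit held
    fixed, [lcoef_phase_le] for the partial sums passes to the limit. *)
Lemma fcoef_fser_sum a c M (K : seq freq) : summable_coef c -> uniq K ->
  bsum (fun k => nk k ^+ a) c M ->
  \sum_(k <- K) nk k ^+ a * amp (fcoef (fser c) k) <= M.
Proof.
move=> cM uK cw; have [M0 cM0] := cM.
have /choice[be beE] := fun k => amp_polarE (fcoef (fser c) k).
have E n : ev (clist c (freqs n)) = ptrig c n by apply/funext => x; exact: ev_clist.
under eq_bigr do rewrite beE.
apply: (@cvg_le_all _ (fun n => \sum_(k <- K) nk k ^+ a *
    ((lcoef (clist c (freqs n)) k).1 * cos (be k) + (lcoef (clist c (freqs n)) k).2 * sin (be k)))); last first.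
  by move=> n; rewrite (le_trans (lcoef_phase_le _ _ _ uK))// nrm_clist.
apply: cvg_sumr => k; apply: cvgMl_tmp.
have [h1 h2] := @cvg_fcoef R d (ptrig c) (fser c) M0 k (measurable_ptrig c)
  (fun n x => ptrig_le n x cM0) (fun x => @fser_cvg c x cM).
apply: cvgD; apply: cvgMr_tmp.
- apply: cvg_trans h1; apply: near_eq_cvg; apply: nearW => n.
  by rewrite -E -fcoef_ev.
- apply: cvg_trans h2; apply: near_eq_cvg; apply: nearW => n.
  by rewrite -E -fcoef_ev.
Qed.

Lemma trig_is_derive (p : R * R) k i (x : point) : is_derive x (basis_vec R i) (trig p k)
  (trig ((k ord0 i)%:~R * p.2, - ((k ord0 i)%:~R * p.1)) k x).
Proof.
pose c (t : R) : point := t *: basis_vec R i + x.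
have dE t : dotk k (c t) = (k ord0 i)%:~R * t + dotk k x.
  rewrite /c /dotk.
  transitivity (\sum_(j < d) (k ord0 j)%:~R * ((t *: basis_vec R i : point) ord0 j) + dotk k x).
    by rewrite -big_split; apply: eq_bigr => j _; rewrite !mxE /= mulrDr.
  rewrite (bigD1 i)//= big1 ?addr0 => [|j ji].
    by rewrite !mxE !eqxx mulr1.
  by rewrite !mxE (negbTE ji) andbF !mulr0.
pose G (t : R) : R := p.1 * cos ((k ord0 i)%:~R * t + dotk k x) + p.2 * sin ((k ord0 i)%:~R * t + dotk k x).
have GE : G = trig p k \o c by apply/funext => t; rewrite /G /= /trig dE.
have dG : is_derive (0 : R) (1 : R) G (trig ((k ord0 i)%:~R * p.2, - ((k ord0 i)%:~R * p.1)) k x).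
  apply: is_derive_eq; rewrite /GRing.scale/= mulr0 !(add0r, addr0) /trig /=.
  by rewrite !(mulr0, add0r, addr0, mulr1); ring.
have cE (h : R) : c (h *: 1 + 0) = h *: basis_vec R i + c 0.
  by rewrite /c scale0r add0r addr0 /GRing.scale/= mulr1.
have c0 : c 0 = x by rewrite /c scale0r add0r.
have dfE : (fun h : R => h^-1 *: (((trig p k) \o shift x) (h *: basis_vec R i) - trig p k x)) =
   (fun h : R => h^-1 *: ((G \o shift 0) (h *: 1) - G 0)).
  by apply/funext => h; rewrite GE /= cE c0.
apply: DeriveDef.
  by rewrite /derivable dfE; case: dG.
by rewrite /derive dfE; case: dG.
Qed.

Lemma trig_continuous p k : continuous (trig p k : point -> R).
Proof.
have cd : continuous (dotk k : point -> R).
  apply: continuous_sum_fun => i; apply: continuous_mul; first exact: continuous_const.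
  exact: coord_continuous.
by apply: continuous_add; apply: continuous_mul; [exact: continuous_const| |exact: continuous_const|];
  move=> x; apply: continuous_comp; [exact: cd|exact: continuous_cos|exact: cd|exact: continuous_sin].
Qed.

Lemma dotk_basis_int k (m : int) i x :
  dotk k (x + (2 * pi) *: basis_vec R i) = (k ord0 i)%:~R * (pi + pi) + dotk k x :> R.
Proof.
rewrite addrC /dotk.
transitivity (\sum_(j < d) (k ord0 j)%:~R * (((2 * pi) *: basis_vec R i : point) ord0 j) + dotk k x).
  by rewrite -big_split; apply: eq_bigr => j _; rewrite !mxE /= mulrDr.
rewrite (bigD1 i)//= big1 ?addr0 => [|j ji].
  by rewrite !mxE !eqxx mulr1 mulr_natl mulr2n.
by rewrite !mxE (negbTE ji) andbF !mulr0.
Qed.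

Lemma trig_periodic p k : torus_periodic (trig p k : point -> R).
Proof.
move=> x i; rewrite /trig (dotk_basis_int k 0) cos_shift; congr (_ + _ * _).
by rewrite !sin_as_cos -addrA cos_shift.
Qed.

Definition dcoef i c : freq -> R * R :=
  fun k => ((k ord0 i)%:~R * (c k).2, - ((k ord0 i)%:~R * (c k).1)).

(** The regularity required by one integration by parts, common to trigonometric functions and
    smooth periodic test functions. *)
Definition C1p (psi : point -> R) : Prop :=
  [/\ continuous psi, torus_periodic psi & forall i, (forall x, derivable psi x (basis_vec R i)) /\
     continuous (partial i psi)].

Lemma C1p_trig p k : C1p (trig p k).
Proof.
split; [exact: trig_continuous|exact: trig_periodic|move=> i; split].
  by move=> x; have [] := trig_is_derive p k i x.
rewrite (_ : partial i _ = trig ((k ord0 i)%:~R * p.2, - ((k ord0 i)%:~R * p.1)) k).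
  exact: trig_continuous.
by apply/funext => x; have [_ <-] := trig_is_derive p k i x.
Qed.

Lemma C1p_bounded psi : C1p psi -> exists M, forall x, `|psi x| <= M.
Proof. by move=> [? ? _]; exact: periodic_bounded. Qed.

Lemma integrable_C0p (psi : point -> R) : continuous psi -> torus_periodic psi ->
  dx.-integrable setT (EFin \o psi).
Proof.
move=> cp pp; have [M HM] := periodic_bounded cp pp.
by apply: (@integrable_bounded _ _ _ _ _ M) => //; exact: continuous_row_measurable.
Qed.

Lemma ibp psi f i : C1p psi -> C1p f ->
  \int[dx]_x (f x * partial i psi x) = - \int[dx]_x (partial i f x * psi x).
Proof.
move=> [cp pp dp] [cf pf df]; have [dpi cpi] := dp i; have [dfi cfi] := df i.
have dE : 'D_(basis_vec R i) (fun x => f x * psi x) = fun x => f x * partial i psi x + partial i f x * psi x.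
  apply/funext => x; rewrite (_ : (fun x => f x * psi x) = f * psi)//.
  by rewrite deriveM// /GRing.scale/= [psi x * _]mulrC.
have c1 := continuous_mul cf cpi.
have c2 := continuous_mul cfi cp.
have p1 := periodic_derive (basis_vec R i) pp.
have p2 := periodic_derive (basis_vec R i) pf.
apply/eqP; rewrite -subr_eq0 opprK -RintegralD//; last 2 first.
- by apply: integrable_C0p => // x j; rewrite pf [partial _ _ _]p1.
- by apply: integrable_C0p => // x j; rewrite pp [partial _ _ _]p2.
apply/eqP; rewrite -(@torus_derive0 _ _ (fun x => f x * psi x) i).
- by rewrite dE.
- exact: continuous_mul.
- by move=> x; apply: derivableM.
- by rewrite dE; exact: continuous_add.
- by move=> x j; rewrite pf pp.
Qed.

Lemma ibp_trig psi p k i : C1p psi ->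
  \int[dx]_x (trig p k x * partial i psi x) =
  - \int[dx]_x (trig ((k ord0 i)%:~R * p.2, - ((k ord0 i)%:~R * p.1)) k x * psi x).
Proof.
move=> C; rewrite (ibp i C (C1p_trig p k)); congr (- _); apply: eq_Rintegral => x _.
by rewrite /partial; have [_ ->] := trig_is_derive p k i x.
Qed.

Lemma Rintegral_ptrig c n (g : point -> R) (N : R) : measurable_fun setT g ->
  (forall x, `|g x| <= N) ->
  \int[dx]_x (ptrig c n x * g x) = \sum_(k <- freqs n) \int[dx]_x (trig (c k) k x * g x).
Proof.
move=> mg gN; rewrite -Rintegral_sum.
  by apply: eq_Rintegral => x _; rewrite mulr_suml.
move=> k; apply: (@integrable_bounded _ _ _ _ _ (amp (c k) * N)).
  by apply: measurable_funM => //; exact: measurable_trig.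
by move=> x; rewrite normrM ler_pM// norm_trig_le.
Qed.

Lemma cvg_fser_integral c (g : point -> R) (N : R) : summable_coef c -> measurable_fun setT g ->
  (forall x, `|g x| <= N) ->
  (fun n => \sum_(k <- freqs n) \int[dx]_x (trig (c k) k x * g x)) @ \oo -->
  \int[dx]_x (fser c x * g x).
Proof.
move=> cM mg gN; have [M cM0] := cM.
under eq_fun do rewrite -(Rintegral_ptrig _ _ mg gN).
apply: (@cvg_Rintegral_mul _ _ _ _ _ M N) => //.
- by move=> n; exact: measurable_ptrig.
- by move=> n x; exact: ptrig_le.
- by move=> x; exact: fser_cvg.
Qed.

Lemma weak_dcoef c psi i : summable_coef c -> summable_coef (dcoef i c) -> C1p psi ->
  \int[dx]_x (fser c x * partial i psi x) = - \int[dx]_x (fser (dcoef i c) x * psi x).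
Proof.
move=> c0 c1 C; have [M HM] := C1p_bounded C; have [cp pp dp] := C.
have [_ cpi] := dp i; have [N HN] := periodic_bounded cpi (periodic_derive (basis_vec R i) pp).
have h1 := cvg_fser_integral c0 (continuous_row_measurable cpi) HN.
have h2 : (fun n => - \sum_(k <- freqs n) \int[dx]_x (trig (dcoef i c k) k x * psi x)) @ \oo -->
    - \int[dx]_x (fser (dcoef i c) x * psi x).
  by apply: cvgN; exact: (cvg_fser_integral c1 (continuous_row_measurable cp) HM).
apply: (cvg_unique _ h1) => //; apply: cvg_ext h2 => n /=.
rewrite -sumrN; apply: eq_bigr => k _.
by rewrite ibp_trig.
Qed.

End code_series.

Lemma le_poweR {R : realType} (x y : \bar R) (r : R) : 0 <= r -> (0 <= x)%E -> (x <= y)%E ->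
  (x `^ r <= y `^ r)%E.
Proof.
move=> r0 x0 xy; apply: gt0_ler_poweR => //; rewrite in_itv/= leey andbT//.
exact: le_trans xy.
Qed.

Section real_integrable.
Context {disp : measure_display} {T : measurableType disp} {R : realType}.
Context (mu : {measure set T -> \bar R}).

Lemma integrableRD (f g : T -> R) : mu.-integrable setT (EFin \o f) ->
  mu.-integrable setT (EFin \o g) -> mu.-integrable setT (EFin \o (fun x => f x + g x)).
Proof. by move=> fi gi; exact: (integrableD measurableT fi gi). Qed.

Lemma integrableRZ (c : R) (f : T -> R) : mu.-integrable setT (EFin \o f) ->
  mu.-integrable setT (EFin \o (fun x => c * f x)).
Proof. by move=> fi; exact: (integrableZl measurableT c fi). Qed.

Lemma integrableR_sum (I : Type) (r : seq I) (F : I -> T -> R) :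
  (forall i, mu.-integrable setT (EFin \o F i)) ->
  mu.-integrable setT (EFin \o (fun x => \sum_(i <- r) F i x)).
Proof.
move=> Fi; rewrite (_ : _ \o _ = fun x => (\sum_(i <- r) (EFin \o F i) x)%E); last first.
  by apply/funext => x; rewrite /= sumEFin.
exact: integrable_sum.
Qed.

Lemma integrableR_bmul (f g : T -> R) (N : R) : mu.-integrable setT (EFin \o f) ->
  measurable_fun setT g -> (forall x, `|g x| <= N) ->
  mu.-integrable setT (EFin \o (fun x => f x * g x)).
Proof.
move=> fi mg gN; have mf : measurable_fun setT f by apply/measurable_EFinP; have /integrableP[] := fi.
apply: (@le_integrable _ _ _ _ _ measurableT _ (fun x => N%:E * (EFin \o f) x)%E).
- by apply/measurable_EFinP/measurable_funM.
- move=> x _; rewrite /= normrM lee_fin normrM mulrC ler_wpM2r//.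
  by rewrite (le_trans (gN x))// ler_norm.
- exact: integrableZl.
Qed.

End real_integrable.

Lemma Lfun_infty_bounded {disp : measure_display} {T : measurableType disp} {R : realType}
    (mu : {measure set T -> \bar R}) (f : T -> R) (M : R) : measurable_fun setT f ->
  (forall x, `|f x| <= M) -> f \in Lfun mu +oo%E.
Proof.
move=> mf fM; rewrite inE; apply/andP; split; rewrite inE//=.
rewrite /finite_norm unlock; case: ifPn => [_|_]; last exact: ltry.
apply: (@le_lt_trans _ _ `|M|%:E); last exact: ltry.
apply/ess_supP; apply: aeW => x /=.
by rewrite lee_fin (le_trans (fM x))// ler_norm.
Qed.

Section bounded_functions.
Context {disp : measure_display} {T : measurableType disp} {R : realType}.
Context (mu : {finite_measure set T -> \bar R}).

Lemma Lnorm_infty_le (f : T -> \bar R) (M : R) : 0 <= M ->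
  {ae mu, forall x, (`|f x| <= M%:E)%E} -> ('N[mu]_(+oo)[f] <= M%:E)%E.
Proof.
move=> M0 fM; rewrite unlock; case: ifPn => [_|_]; last by rewrite lee_fin.
exact/ess_supP.
Qed.

Lemma Lfun1_bounded (f : T -> R) (M : R) : measurable_fun setT f ->
  (forall x, `|f x| <= M) -> f \in Lfun mu 1%E.
Proof. by move=> mf fM; apply/Lfun1_integrable; exact: integrable_bounded fM. Qed.

Lemma Lnorm2_le (f : T -> R) (M : R) : measurable_fun setT f -> 0 <= M ->
  (forall x, `|f x| <= M) ->
  ('N[mu]_(2%:E)[EFin \o f] <= (M * Num.sqrt (fine (mu setT)))%:E)%E.
Proof.
move=> mf M0 fM; rewrite unlock.
have muT : mu setT = (fine (mu setT))%:E by rewrite fineK// fin_num_measure.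
have m0 : 0 <= fine (mu setT) by rewrite fine_ge0.
have -> : (M * Num.sqrt (fine (mu setT)))%:E = ((M ^+ 2 * fine (mu setT))%:E `^ 2^-1)%E.
  rewrite poweR_EFin powR12_sqrt ?mulr_ge0 ?sqr_ge0// sqrtrM ?sqr_ge0// sqrtr_sqr.
  by rewrite ger0_norm.
apply: le_poweR => //; first by apply: integral_ge0 => x _; exact: poweR_ge0.
rewrite EFinM -muT -integral_cst//; apply: ge0_le_integral => //.
- by move=> x _; exact: poweR_ge0.
- rewrite (_ : (fun x => _) = EFin \o (fun x => `|f x| `^ 2)); last exact/funext.
  apply/measurable_EFinP; apply: (measurableT_comp (measurable_powR 2)).
  exact: measurableT_comp.
- move=> x _; rewrite [leLHS](_ : _ = (`|f x| `^ 2)%:E)// lee_fin powR_mulrn//.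
  by rewrite lerXn2r// nnegrE.
Qed.

Lemma Lfun2_bounded (f : T -> R) (M : R) : measurable_fun setT f ->
  (forall x, `|f x| <= M) -> f \in Lfun mu 2%:E.
Proof.
move=> mf fM; rewrite inE; apply/andP; split; rewrite inE//=.
apply: le_lt_trans (@Lnorm2_le f `|M| mf _ _) (ltry _) => // x.
by rewrite (le_trans (fM x))// ler_norm.
Qed.

End bounded_functions.

Section fser_norms.
Context {R : realType} {d : nat}.
Local Notation nk := (@normk R d).
Local Notation point := 'rV[R]_d.
Local Notation freq := 'rV[int]_d.
Local Notation dx := (torus_measure R d).
Implicit Types (k : freq) (c : freq -> R * R).

Lemma bsum_ge0 w c (M : R) : bsum w c M -> 0 <= M.
Proof. by move/(_ 0%N); rewrite big_nil. Qed.

Lemma Lp_norm_infty_fser c M : bsum (fun=> 1) c M -> (Lp_norm +oo (fser c) <= M%:E)%E.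
Proof.
move=> cM; have sc : summable_coef c by exists M.
rewrite /Lp_norm asboolT; last exact: measurable_fser.
apply: Lnorm_infty_le; first exact: bsum_ge0 cM.
by apply: aeW => x; rewrite abse_EFin lee_fin fser_le.
Qed.

Lemma Lp_norm2_fser c M : bsum (fun=> 1) c M ->
  (Lp_norm 2%:E (fser c) <= (M * Num.sqrt ((2 * pi) ^+ d))%:E)%E.
Proof.
move=> cM; have sc : summable_coef c by exists M.
rewrite /Lp_norm asboolT; last exact: measurable_fser.
have -> : (2 * pi) ^+ d = fine (dx setT) :> R by rewrite (congr1 fine (torus_measureT d)).
apply: Lnorm2_le; [exact: measurable_fser|exact: bsum_ge0 cM|].
by move=> x; exact: fser_le.
Qed.

Lemma smooth_derive (psi : point -> R) w : smooth psi -> smooth ('D_w psi).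
Proof.
move=> sp ws; have := sp (rcons ws w); rewrite foldr_rcons; exact.
Qed.

Lemma smooth_C1p (psi : point -> R) : smooth psi -> torus_periodic psi -> C1p psi.
Proof.
move=> sp pp; split => //; first by have [] := sp [::].
move=> i; split; first by move=> x; have [_] := sp [::]; exact.
by have [] := sp [:: basis_vec R i].
Qed.

Lemma smooth_foldr_partial (psi : point -> R) (l : seq 'I_d) :
  smooth psi -> torus_periodic psi ->
  smooth (foldr (fun i g => partial i g) psi l) /\
  torus_periodic (foldr (fun i g => partial i g) psi l).
Proof.
move=> sp pp; elim: l => [//|i l [IH1 IH2]] /=.
by split; [exact: smooth_derive|exact: periodic_derive].
Qed.

Lemma multi_partialE (m : 'I_d -> nat) (psi : point -> R) :
  multi_partial m psi = foldr (fun i g => partial i g) psi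
    (flatten [seq nseq (m i) i | i <- enum 'I_d]).
Proof.
rewrite /multi_partial; elim: (enum _) => [//|i l IH] /=.
rewrite foldr_cat -IH; elim: (m i) => [//|n IHn] /=.
by rewrite IHn.
Qed.

Lemma size_multi (m : 'I_d -> nat) :
  size (flatten [seq nseq (m i) i | i <- enum 'I_d]) = (\sum_i m i)%N.
Proof.
rewrite size_flatten /shape -map_comp sumnE big_map big_enum/=.
by apply: eq_bigr => i _; rewrite size_nseq.
Qed.

Lemma bsum_dcoef j c M i : bsum (fun k => nk k ^+ j.+1) c M ->
  bsum (fun k => nk k ^+ j) (dcoef i c) M.
Proof.
move=> h n; apply: le_trans (h n); apply: ler_sum => k _.
rewrite exprSr -mulrA ler_wpM2l ?exprn_ge0 ?normk_ge0//.
rewrite /amp /dcoef /= sqrrN !exprMn -mulrDr sqrtrM ?sqr_ge0// sqrtr_sqr addrC.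
by rewrite ler_wpM2r ?amp_ge0// normk_int.
Qed.

(** A left fold, against the right fold of the partial derivatives: integration by parts strips the
    outermost derivative of the test function first. *)
Definition dcoefs (l : seq 'I_d) c : freq -> R * R := foldl (fun c i => dcoef i c) c l.

Lemma bsum_dcoefs l c M n : (forall j, (j <= n + size l)%N -> bsum (fun k => nk k ^+ j) c M) ->
  forall j, (j <= n)%N -> bsum (fun k => nk k ^+ j) (dcoefs l c) M.
Proof.
elim: l c => [|i l IH] c h j jn /=; first by apply: h; rewrite addn0.
apply: IH => // j' j'n; apply: bsum_dcoef; apply: h.
by rewrite /= addnS ltnS.
Qed.

Lemma bsum_expr0 c M : bsum (fun k => nk k ^+ 0) c M -> bsum (fun=> 1) c M.
Proof. by move=> h n; have := h n; under eq_bigr do rewrite expr0. Qed.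

Lemma weak_dcoefs l c M (psi : point -> R) : smooth psi -> torus_periodic psi ->
  (forall j, (j <= size l)%N -> bsum (fun k => nk k ^+ j) c M) ->
  \int[dx]_x (fser c x * foldr (fun i g => partial i g) psi l x) =
  (-1) ^+ size l * \int[dx]_x (fser (dcoefs l c) x * psi x).
Proof.
move=> sp pp; elim: l c => [|i l IH] c h /=; first by rewrite mul1r.
have [s1 p1] := smooth_foldr_partial l sp pp.
rewrite weak_dcoef; [|by exists M; apply/bsum_expr0/h| |exact: smooth_C1p].
- rewrite IH ?exprS ?mulN1r ?mulNr// => j jl.
  by apply: bsum_dcoef; exact: h.
- by exists M; apply/bsum_expr0/bsum_dcoef/h.
Qed.

(** The witnesses are the termwise differentiated series, each bounded by [M]. The cardinal counts
    all the index functions, including those of order above [n]. *)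
Lemma sobolev_norm_fser n c M : (forall j, (j <= n)%N -> bsum (fun k => nk k ^+ j) c M) ->
  (sobolev_norm n +oo (fser c) <= (#|{ffun 'I_d -> 'I_n.+1}|%:R * M)%:E)%E.
Proof.
move=> h.
have M0 : 0 <= M by exact: bsum_ge0 (h 0%N _).
pose l (m : {ffun 'I_d -> 'I_n.+1}) := flatten [seq nseq (m i) i | i <- enum 'I_d].
have lm (m : {ffun 'I_d -> 'I_n.+1}) : (\sum_i m i <= n)%N -> forall j, (j <= size (l m))%N -> bsum (fun k => nk k ^+ j) c M.
  by move=> mn j jl; apply: h; rewrite (leq_trans jl)// /l (size_multi (fun i => m i)).
have lm0 (m : {ffun 'I_d -> 'I_n.+1}) : (\sum_i m i <= n)%N -> bsum (fun=> 1) (dcoefs (l m) c) M.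
  move=> mn; apply: bsum_expr0; apply: (@bsum_dcoefs (l m) c M 0) => // j.
  by rewrite add0n; exact: lm.
apply: (@le_trans _ _ (\sum_(m : {ffun 'I_d -> 'I_n.+1} | (\sum_i m i <= n)%N)
    Lp_norm +oo (fser (dcoefs (l m) c)))%E).
  apply: ereal_inf_lbound => /=; exists (fun m => fser (dcoefs (l m) c)) => // m mn.
  split.
  - apply: (@Lfun1_bounded _ _ _ _ _ M); last by move=> x; apply: fser_le; apply/bsum_expr0/h.
    by apply: measurable_fser; exists M; apply/bsum_expr0/h.
  - apply: (@Lfun1_bounded _ _ _ _ _ M); last by move=> x; apply: fser_le; exact: lm0.
    by apply: measurable_fser; exists M; exact: lm0.
  - move=> psi sp pp; rewrite multi_partialE (weak_dcoefs sp pp (lm m mn)).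
    by rewrite /l (size_multi (fun i => m i)).
apply: (@le_trans _ _ (\sum_(m : {ffun 'I_d -> 'I_n.+1} | (\sum_i m i <= n)%N) M%:E)%E).
  by apply: lee_sum => m mn; apply: Lp_norm_infty_fser; exact: lm0.
rewrite sumEFin lee_fin mulr_natl -sumr_const big_mkcond ler_sum// => m _.
by case: ifP.
Qed.

Lemma fourier_fser_le c M k : bsum (fun=> 1) c M -> amp (fcoef (fser c) k) <= M.
Proof.
move=> cM; have := @fcoef_fser_sum _ _ 0 c M [:: k]; rewrite big_seq1 expr0 mul1r; apply => //.
by exists M.
Qed.

(** Interpolation: in |u_k|^2 one factor is bounded by [M0] and the other is summed against |k|^4. A
    fourth moment integrable in time thus makes this norm square integrable in time. *)
Lemma sobolev2_norm_fser c M0 M4 : bsum (fun=> 1) c M0 -> bsum (fun k => nk k ^+ 4) c M4 ->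
  (sobolev2_norm 2 (fser c) <= (M0 * M4)%:E `^ 2^-1)%E.
Proof.
move=> h0 h4; have sc : summable_coef c by exists M0.
rewrite /sobolev2_norm asboolT; last first.
  by apply: (@Lfun2_bounded _ _ _ _ _ M0); [exact: measurable_fser|move=> x; exact: fser_le].
have p0 := bsum_ge0 h0; have p4 := bsum_ge0 h4.
apply: le_poweR => //.
  by apply: esum_ge0 => k _; rewrite lee_fin mulr_ge0 ?powR_ge0// sqr_ge0.
apply: ge_ereal_sup => _ [X [finX _] <-].
rewrite fsbig_finite// sumEFin lee_fin.
have := finmap.fset_uniq (fset_set X); move: (finmap.enum_fset _) => K uK.
apply: (@le_trans _ _ (M0 * \sum_(k <- K) nk k ^+ 4 * amp (fcoef (fser c) k))).
  rewrite mulr_sumr; apply: ler_sum => k _.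
  rewrite normc_fourier -natrM powR_mulrn ?normk_ge0// expr2 mulrCA.
  by rewrite ler_wpM2r ?mulr_ge0 ?exprn_ge0 ?normk_ge0 ?amp_ge0// fourier_fser_le.
by rewrite ler_wpM2l// fcoef_fser_sum.
Qed.

End fser_norms.

(** * Uniqueness of Fourier coefficients *)

Section uniqueness.
Context {R : realType} {d : nat}.
Local Notation nk := (@normk R d).
Local Notation point := 'rV[R]_d.
Local Notation freq := 'rV[int]_d.
Local Notation dx := (torus_measure R d).

(** This is cos^2 (u / 2), whose powers are the de la Vallee Poussin kernels up to normalization. *)
Definition wgt (u : R) : R := (1 + cos u) / 2.

Lemma wgt_ge0 u : 0 <= wgt u.
Proof. by rewrite divr_ge0// -lerBlDl sub0r cos_geN1. Qed.

(* a positive trigonometric kernel concentrating at the origin as n grows *)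
Definition kern (n : nat) (z : point) : R := \prod_(i < d) wgt (z ord0 i) ^+ n.

Lemma kern_ge0 n z : 0 <= kern n z.
Proof. by apply: prodr_ge0 => i _; rewrite exprn_ge0// wgt_ge0. Qed.

Definition kern_list (n : nat) : seq (@term R d) :=
  foldr (fun i s => tmul (tpow [:: (2^-1, 0, 0); (2^-1, 0, delta_mx ord0 i)] n) s)
    [:: (1, 0, 0)] (enum 'I_d).

Lemma ev_kern_list n z : ev (kern_list n) z = kern n z.
Proof.
rewrite /kern /kern_list -(big_enum _ _ predT)/=.
elim: (enum 'I_d) => [|i l IH] /=.
  by rewrite big_nil /ev big_seq1 dotk0 addr0 cos0 mulr1.
rewrite ev_tmul IH ev_tpow big_cons; congr (_ ^+ _ * _).
rewrite /ev big_cons big_seq1/= dotk0 !addr0 cos0 mulr1 /wgt mulrDl mul1r mulrC; congr (_ + cos _ * _).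
rewrite /dotk (bigD1 i)//= big1 ?addr0 => [|j ji]; rewrite mxE eqxx/=.
  by rewrite eqxx mul1r.
by rewrite (negbTE ji) mul0r.
Qed.

(** With zero phases and nonnegative amplitudes, the integral is at least the contribution of a
    constant term. The property is stable under [tmul] and so gives positive mass to the kernel by
    algebra alone. *)
Definition pos_list (s : seq (@term R d)) : Prop :=
  (forall q, q \in s -> q.1.2 = 0 /\ 0 <= q.1.1) /\
  exists q, [/\ q \in s, q.2 = 0 & 0 < q.1.1].

Lemma mem_tmul (s t : seq (@term R d)) z : (z \in tmul s t) <->
  exists p q, [/\ p \in s, q \in t &
   z = (p.1.1 * q.1.1 / 2, p.1.2 + q.1.2, p.2 + q.2) \/
   z = (p.1.1 * q.1.1 / 2, p.1.2 - q.1.2, p.2 - q.2)].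
Proof.
have mb (I : eqType) (r : seq I) (G : I -> seq (@term R d)) :
    (z \in \big[cat/[::]]_(i <- r) G i) <-> exists2 i, i \in r & z \in G i.
  elim: r => [|i r IH]; first by rewrite big_nil; split => // -[].
  rewrite big_cons mem_cat; split.
    move=> /orP[zi|/IH[j jr zj]]; first by exists i; rewrite ?mem_head.
    by exists j; rewrite // inE jr orbT.
  move=> [j]; rewrite inE => /orP[/eqP -> ->//|jr zj].
  by apply/orP; right; apply/IH; exists j.
split.
  move=> /mb[p ps] /mb[q qt]; rewrite !inE => /orP[/eqP zE|/eqP zE].
    by exists p, q; split => //; left.
  by exists p, q; split => //; right.
move=> [p [q [ps qt zE]]]; apply/mb; exists p => //; apply/mb; exists q => //.
by rewrite !inE; case: zE => ->; rewrite eqxx ?orbT.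
Qed.

Lemma pos_tmul s t : pos_list s -> pos_list t -> pos_list (tmul s t).
Proof.
move=> [s1 [p [ps p0 pp]]] [t1 [q [qt q0 qp]]]; split.
  move=> z /mem_tmul[p' [q' [/s1[p1 p2] /t1[q1 q2]]]].
  by case=> ->; rewrite /= p1 q1 ?addr0 ?subr0; split => //; rewrite divr_ge0// mulr_ge0.
exists (p.1.1 * q.1.1 / 2, p.1.2 + q.1.2, p.2 + q.2); split.
- by apply/mem_tmul; exists p, q; split => //; left.
- by rewrite /= p0 q0 addr0.
- by rewrite /= divr_gt0// mulr_gt0.
Qed.

Lemma pos_one : pos_list [:: (1, 0, 0)].
Proof.
split; first by move=> q; rewrite inE => /eqP ->.
by exists (1, 0, 0); rewrite mem_head.
Qed.

Lemma pos_kern_list n : pos_list (kern_list n).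
Proof.
rewrite /kern_list; elim: (enum _) => [|i l IH] /=; first exact: pos_one.
apply: pos_tmul => //; elim: n {IH} => [|n IH] /=; first exact: pos_one.
apply: pos_tmul => //; split.
  by move=> q; rewrite !inE => /orP[] /eqP -> /=; rewrite invr_ge0.
by exists (2^-1, 0, 0); rewrite mem_head /= invr_gt0.
Qed.

Definition kern_integral n : R := (2 * pi) ^+ d * \sum_(q <- kern_list n) q.1.1 * (q.2 == 0)%:R * cos q.1.2.

Lemma kern_integral_gt0 n : 0 < kern_integral n.
Proof.
have [k1 [q [qs q0 qp]]] := pos_kern_list n.
rewrite /kern_integral mulr_gt0 ?exprn_gt0 ?mulr_gt0 ?pi_gt0// (big_rem q)//=.
rewrite q0 eqxx mulr1 (k1 q qs).1 cos0 mulr1 ltr_pwDl// big_seq sumr_ge0// => z /mem_rem/k1[-> z0].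
by rewrite cos0 mulr1 mulr_ge0.
Qed.

Lemma kern_mass n (x : point) : \int[dx]_y kern n (y - x) = kern_integral n.
Proof.
under eq_Rintegral do rewrite -ev_kern_list.
rewrite /ev Rintegral_sum; last first.
  move=> q; apply: (@integrable_bounded _ _ _ _ _ `|q.1.1|).
    apply: measurable_funM => //; under eq_fun do rewrite dotkBr -addrA.
    exact: measurable_cos_dotk.
  by move=> y; rewrite normrM ler_piMr// norm_cos_le1.
rewrite /kern_integral mulr_sumr; apply: eq_bigr => q _.
rewrite RintegralZl//; last first.
  apply: (@integrable_bounded _ _ _ _ _ 1); last by move=> y; exact: norm_cos_le1.
  by under eq_fun do rewrite dotkBr -addrA; exact: measurable_cos_dotk.
under eq_Rintegral do rewrite dotkBr -addrA.
rewrite torus_cos; case: eqP => [->|_]; last by rewrite !(mulr0, mul0r).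
by rewrite dotk0 oppr0 add0r mulr1 mulrCA.
Qed.

Lemma slice_is_derive (f : point -> R) i (x : point) (df : R) :
  is_derive (0 : R) (1 : R) (fun t => f (t *: basis_vec R i + x)) df ->
  is_derive x (basis_vec R i) f df.
Proof.
set G := (fun t => _) => dG.
have dfE : (fun h : R => h^-1 *: ((f \o shift x) (h *: basis_vec R i) - f x)) =
   (fun h : R => h^-1 *: ((G \o shift 0) (h *: 1) - G 0)).
  by apply/funext => h; rewrite /G /= !addr0 scale0r add0r /GRing.scale/= mulr1.
apply: DeriveDef.
  by rewrite /derivable dfE; case: dG.
by rewrite /derive dfE; case: dG.
Qed.

Lemma wgt_continuous : continuous wgt.
Proof.
apply: continuous_mul; last exact: continuous_const.
by apply: continuous_add; [exact: continuous_const|exact: continuous_cos].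
Qed.

Lemma coord_shift_continuous (x : point) i : continuous (fun y : point => (y - x) ord0 i).
Proof.
rewrite (_ : (fun y : point => _) = fun y => y ord0 i + (- x) ord0 i); last first.
  by apply/funext => y; rewrite mxE.
by apply: continuous_add; [exact: coord_continuous|exact: continuous_const].
Qed.

Lemma kern_continuous n (x : point) : continuous (fun y : point => kern n (y - x)).
Proof.
rewrite /kern; elim: (index_enum _) => [|i l IH].
  by under eq_fun do rewrite big_nil; exact: continuous_const.
under eq_fun do rewrite big_cons; apply: continuous_mul => //.
elim: (n) => [|m IHm]; first by under eq_fun do rewrite expr0; exact: continuous_const.
under eq_fun do rewrite exprS; apply: continuous_mul => //.
by move=> y; apply: continuous_comp; [exact: coord_shift_continuous|exact: wgt_continuous].
Qed.

Lemma cos_period (u : R) : cos (u + 2 * pi) = cos u.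
Proof. by have := cos_shift 1 u; rewrite mul1r addrC mulr_natl mulr2n. Qed.

Lemma sin_period (u : R) : sin (u + 2 * pi) = sin u.
Proof. by rewrite !sin_as_cos addrAC cos_period. Qed.

Lemma basis_coord (y x : point) i j : (y + (2 * pi) *: basis_vec R i - x) ord0 j =
  (y - x) ord0 j + 2 * pi * (j == i)%:R.
Proof. by rewrite !mxE eqxx/= addrAC. Qed.

Lemma kern_periodic n x : torus_periodic (fun y => kern n (y - x)).
Proof.
move=> y i; rewrite /kern; apply: eq_bigr => j _; rewrite basis_coord /wgt.
by case: (j == i); rewrite ?mulr0 ?addr0// mulr1 cos_period.
Qed.

(** The integrand is the derivative in direction [i] of sin (y_i - x_i) times the kernel: [wgt] has
    derivative - sin / 2, and sin^2 = (1 - cos) (1 + cos) restores the lost factor [wgt]. *)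
Lemma kern_moment_eq n i (x : point) :
  \int[dx]_y ((cos ((y - x) ord0 i) - n.+1%:R * (1 - cos ((y - x) ord0 i))) * kern n.+1 (y - x)) = 0.
Proof.
pose F (y : point) := sin ((y - x) ord0 i) * kern n.+1 (y - x).
pose dF (y : point) := (cos ((y - x) ord0 i) - n.+1%:R * (1 - cos ((y - x) ord0 i))) * kern n.+1 (y - x).
have cc : continuous (fun y : point => cos ((y - x) ord0 i)).
  by move=> y; apply: continuous_comp; [exact: coord_shift_continuous|exact: continuous_cos].
have cs : continuous (fun y : point => sin ((y - x) ord0 i)).
  by move=> y; apply: continuous_comp; [exact: coord_shift_continuous|exact: continuous_sin].
have cF : continuous F by apply: continuous_mul => //; exact: kern_continuous.
have cdF : continuous dF.
  apply: continuous_mul; last exact: kern_continuous.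
  apply: continuous_add => //; under eq_fun do rewrite -mulrN opprB.
  apply: continuous_mul; first exact: continuous_const.
  by apply: continuous_add => //; exact: continuous_const.
have pF : torus_periodic F.
  move=> y j; rewrite /F kern_periodic basis_coord.
  by case: (i == j); rewrite ?mulr0 ?addr0// mulr1 sin_period.
have dE y : is_derive y (basis_vec R i) F (dF y).
  apply: slice_is_derive; set a := (y - x) ord0 i.
  pose P := \prod_(j < d | j != i) wgt ((y - x) ord0 j) ^+ n.+1.
  rewrite (_ : (fun t => _) = fun t => sin (t + a) * (wgt (t + a) ^+ n.+1 * P)); last first.
    apply/funext => t; rewrite /F /kern (bigD1 i)//=.
    have E j : (t *: basis_vec R i + y - x) ord0 j = t * (j == i)%:R + (y - x) ord0 j.
      by rewrite !mxE eqxx/= addrA.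
    rewrite E eqxx mulr1; congr (_ * (_ * _)); apply: eq_bigr => j ji.
    by rewrite E (negbTE ji) mulr0 add0r.
  pose g t := wgt (t + a).
  have da : is_derive (0 : R) (1 : R) (fun t => t + a) 1.
    by apply: is_derive_eq; rewrite addr0.
  have ds : is_derive (0 : R) (1 : R) (fun t => sin (t + a)) (cos a).
    have := @is_derive1_comp _ sin (fun t => t + a) 0 _ _ _ da.
    by move=> /(_ _ (is_derive_sin _)); rewrite mulr1 add0r.
  have dg : is_derive (0 : R) (1 : R) g (- sin a / 2).
    have := @is_derive1_comp _ cos (fun t => t + a) 0 _ _ _ da.
    move=> /(_ _ (is_derive_cos _)); rewrite mulr1 add0r => dc.
    rewrite /g /wgt (_ : (fun t => _) = 2^-1 \*: (cst 1 + (cos \o (fun t => t + a)))); last first.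
      by apply/funext => t; rewrite /= mulrC.
    by apply: is_derive_eq; rewrite /GRing.scale/= add0r mulrC.
  rewrite (_ : (fun t => _) = (fun t => sin (t + a)) * (g ^+ n.+1 * cst P)); last first.
    by apply/funext => t; rewrite /= exprfctE.
  apply: is_derive_eq.
  rewrite /dF /kern (bigD1 i)//= -/a -/P /wgt.
  have s2 : sin a ^+ 2 = 1 - cos a ^+ 2 by rewrite sin2cos2.
  rewrite exprS; set W := ((1 + cos a) / 2) ^+ n; set c := n.+1%:R.
  have E2 : sin a * (c * W * (- sin a / 2)) = - (c * W * (sin a ^+ 2) / 2) by ring.
  rewrite s2 in E2.
  transitivity (sin a * (c * W * (- sin a / 2)) * P + (1 + cos a) / 2 * W * P * cos a).
    rewrite /GRing.scale/= !exprfctE !fctE /g /wgt !add0r -/W.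
    by ring.
  by rewrite E2 (exprS ((1 + cos a) / 2) n) -/W; field.
have -> : (fun y => (cos ((y - x) ord0 i) - n.+1%:R * (1 - cos ((y - x) ord0 i))) * kern n.+1 (y - x)) = 'D_(basis_vec R i) F.
  by apply/funext => y; have [_ ->] := dE y.
apply: torus_derive0 => //.
rewrite (_ : 'D_(basis_vec R i) F = dF)//.
by apply/funext => y; have [_ ->] := dE y.
Qed.

Lemma integrable_kern_mul n x (g : point -> R) : continuous g -> torus_periodic g ->
  dx.-integrable setT (EFin \o (fun y => g y * kern n (y - x))).
Proof.
move=> cg pg; apply: integrable_C0p; first by apply: continuous_mul => //; exact: kern_continuous.
by move=> y i; rewrite pg kern_periodic.
Qed.

(** As cos is at most 1, [kern_moment_eq] bounds the mean of 1 - cos by 1 / (n + 1). This is a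
    concentration estimate of Chebyshev type, obtained without asymptotics of [kern_integral]. *)
Lemma kern_moment n i (x : point) :
  n.+1%:R * \int[dx]_y ((1 - cos ((y - x) ord0 i)) * kern n.+1 (y - x)) <= kern_integral n.+1.
Proof.
have cc : continuous (fun y : point => cos ((y - x) ord0 i)).
  by move=> y; apply: continuous_comp; [exact: coord_shift_continuous|exact: continuous_cos].
have pc : torus_periodic (fun y : point => cos ((y - x) ord0 i)).
  move=> y j; rewrite basis_coord.
  by case: (i == j); rewrite ?mulr0 ?addr0// mulr1 cos_period.
have i1 := integrable_kern_mul n.+1 x cc pc.
have i2 : dx.-integrable setT (EFin \o (fun y => (1 - cos ((y - x) ord0 i)) * kern n.+1 (y - x))).
  apply: integrable_kern_mul; last by move=> y j; rewrite pc.
  apply: continuous_add; first exact: continuous_const.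
  under eq_fun do rewrite -mulN1r; apply: continuous_mul; last exact: cc.
  exact: continuous_const.
have := kern_moment_eq n i x.
under eq_Rintegral do rewrite mulrBl -mulrA.
rewrite RintegralB//; last exact: (integrableZl measurableT n.+1%:R i2).
rewrite RintegralZl// => /eqP; rewrite subr_eq0 => /eqP <-.
rewrite -(kern_mass n.+1 x); apply: le_Rintegral => //.
  have := @integrable_kern_mul n.+1 x (fun=> 1) (@continuous_const _ _ _) (fun _ _ => erefl).
  by under eq_fun do rewrite mul1r.
by move=> y _; rewrite ler_piMl ?kern_ge0// cos_le1.
Qed.

Lemma kern_cvg (phi : point -> R) (x : point) : continuous phi -> torus_periodic phi ->
  (fun n => (kern_integral n.+1)^-1 * \int[dx]_y (phi y * kern n.+1 (y - x))) @ \oo --> phi x.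
Proof.
move=> cp pp; have [M HM] := periodic_bounded cp pp.
have M0 : 0 <= M by exact: le_trans (HM 0).
apply/cvgrPdist_le => e e0.
have /cvgrPdist_le /(_ _ (divr_gt0 e0 (ltr0n _ 2))) := cp x.
move=> /nbhs_ballP[eta0 /= eta00]; rewrite -ball_normE => Heta0.
(* Below [eta0], so that the closed cube of radius [eta] lies in the open ball, and at most pi, so
   that cos decreases up to [eta]. *)
pose eta := Num.min (eta0 / 2) pi.
have eta_gt0 : 0 < eta by rewrite lt_min divr_gt0//= pi_gt0.
have eta_lt : eta < eta0.
  by rewrite gt_min ltr_pdivrMr// ltr_pMr// ltr1n.
pose q := 1 - cos eta.
have q0 : 0 < q.
  by rewrite subr_gt0 -cos0 ltr_cos ?in_itv/= ?lexx ?pi_ge0// (ltW eta_gt0) ge_min lexx orbT.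
pose C := (M + M) / q.
have C0 : 0 <= C by rewrite divr_ge0 ?(ltW q0)// addr_ge0.
(* Near [x] continuity gives e / 2; far from it 1 - cos is at least [q] in some coordinate, which
   pays for the trivial bound [M + M]. Periods first bring [y] within pi of [x] in each coordinate,
   where cos decreases with the distance. *)
have modulus y : `|phi x - phi y| <= e / 2 + C * \sum_(i < d) (1 - cos ((y - x) ord0 i)).
  have s0 : 0 <= \sum_(i < d) (1 - cos ((y - x) ord0 i)).
    by apply: sumr_ge0 => i _; rewrite subr_ge0 cos_le1.
  have p2 : 0 < 2 * pi :> R by rewrite mulr_gt0 ?pi_gt0.
  pose k := (\row_i (- Num.floor (((y - x) ord0 i + pi) / (2 * pi)))) : 'rV[int]_d.
  pose y' := (\row_i ((k ord0 i)%:~R * (2 * pi))) + y.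
  rewrite -(periodic_translate k y pp) -/y'.
  have yE i : (y' - x) ord0 i = (y - x) ord0 i + (k ord0 i)%:~R * (2 * pi) by rewrite !mxE; ring.
  have cosE i : cos ((y - x) ord0 i) = cos ((y' - x) ord0 i).
    rewrite yE addrC; have := cos_shift (k ord0 i) ((y - x) ord0 i).
    by rewrite -mulr2n -[pi *+ 2]mulr_natl => ->.
  have yI i : `|(y' - x) ord0 i| <= pi.
    rewrite yE; have := floor_itv (((y - x) ord0 i + pi) / (2 * pi)) => /andP[h1 h2].
    move: h1 h2; rewrite ler_pdivlMr// ltr_pdivrMr// intrD -[1%:~R]/(1 : R) /k [(\row__ _) _ _]mxE intrN.
    by move=> h1 h2; rewrite ler_norml; apply/andP; split; lra.
  have [near|] := pselect (forall i, `|(y' - x) ord0 i| < eta).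
    apply: (@le_trans _ _ (e / 2)); last by rewrite lerDl mulr_ge0.
    apply: Heta0 => /=; apply: le_lt_trans eta_lt.
    rewrite distrC; apply: row_norm_le; first exact: ltW.
    by move=> i; exact: ltW.
  move=> /existsNP[i /negP]; rewrite -leNgt => far.
  apply: (@le_trans _ _ (M + M)); first by rewrite (le_trans (ler_normB _ _))// lerD.
  apply: (@le_trans _ _ (C * (1 - cos ((y - x) ord0 i)))); last first.
    apply: ler_wpDl; first by rewrite ltW// divr_gt0.
    apply: ler_wpM2l => //; rewrite (bigD1 i)//= lerDl.
    by apply: sumr_ge0 => j _; rewrite subr_ge0 cos_le1.
  rewrite /C mulrAC ler_pdivlMr// ler_wpM2l ?addr_ge0// /q lerD2l lerN2 cosE.
  have -> : cos ((y' - x) ord0 i) = cos `|(y' - x) ord0 i|.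
    by have [h|h] := lerP 0 ((y' - x) ord0 i); [rewrite ger0_norm|rewrite ltr0_norm// cosN].
  have [->//|neq] := eqVneq `|(y' - x) ord0 i| eta.
  apply: ltW; rewrite ltr_cos ?in_itv/=.
  - by rewrite lt_neqAle eq_sym neq far.
  - by rewrite (ltW eta_gt0) ge_min lexx orbT.
  - by rewrite (le_trans (ltW eta_gt0) far) yI.
have [n0 n0P] : exists n0 : nat, C * d%:R / n0.+1%:R <= e / 2.
  have := near_infty_natSinv_lt (PosNum (divr_gt0 (divr_gt0 e0 (ltr0n _ 2)) (ltr_wpDl (mulr_ge0 C0 (ler0n _ d)) ltr01))).
  move=> [n0 _ /(_ n0 (leqnn _)) /= h]; exists n0.
  apply: (@le_trans _ _ ((1 + C * d%:R) * n0.+1%:R^-1)).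
    by rewrite ler_wpM2r// lerDr.
  have D0 : 0 < C * d%:R + 1 by apply: ltr_wpDl => //; rewrite mulr_ge0.
  by move: h; rewrite (ltr_pdivlMr _ _ D0) mulrC [1 + _]addrC => /ltW.
near=> n.
have nn0 : (n0 <= n)%N by near: n; exact: nbhs_infty_ge.
have k0 := kern_integral_gt0 n.+1.
have ik : dx.-integrable setT (EFin \o (fun y => kern n.+1 (y - x))).
  have := @integrable_kern_mul n.+1 x (fun=> 1) (@continuous_const _ _ _) (fun _ _ => erefl).
  by under eq_fun do rewrite mul1r.
have cc i : continuous (fun y : point => 1 - cos ((y - x) ord0 i)).
  apply: continuous_add; first exact: continuous_const.
  under eq_fun do rewrite -mulN1r; apply: continuous_mul; first exact: continuous_const.
  by move=> y; apply: continuous_comp; [exact: coord_shift_continuous|exact: continuous_cos].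
have pc i : torus_periodic (fun y : point => 1 - cos ((y - x) ord0 i)).
  move=> y j; rewrite basis_coord.
  by case: (i == j); rewrite ?mulr0 ?addr0// mulr1 cos_period.
have im i := integrable_kern_mul n.+1 x (cc i) (pc i).
have -> : phi x = (kern_integral n.+1)^-1 * \int[dx]_y (phi x * kern n.+1 (y - x)).
  by rewrite RintegralZl// kern_mass mulrCA mulVf ?mulr1// gt_eqF.
rewrite -mulrBr normrM ger0_norm ?invr_ge0 ?(ltW k0)// ler_pdivrMl//.
rewrite -RintegralB//; [|exact: (integrableRZ (phi x) ik)|exact: integrable_kern_mul].
apply: (@le_trans _ _ (\int[dx]_y (e / 2 * kern n.+1 (y - x) +
    C * \sum_(i < d) (1 - cos ((y - x) ord0 i)) * kern n.+1 (y - x)))).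
  apply: le_Rintegral_norm.
  - under eq_fun do rewrite -mulrBl; apply: integrable_kern_mul.
      apply: continuous_add; first exact: continuous_const.
      by under eq_fun do rewrite -mulN1r; apply: continuous_mul => //; exact: continuous_const.
    by move=> y i; rewrite pp.
  - by apply: integrableRD; apply: integrableRZ => //; exact: integrableR_sum.
  - move=> y; rewrite -mulr_suml mulrA -mulrDl -mulrBl normrM.
    by rewrite (ger0_norm (kern_ge0 _ _)) ler_wpM2r ?kern_ge0.
rewrite RintegralD//; [|exact: (integrableRZ (e / 2) ik)|]; last first.
  apply: integrableRZ; exact: integrableR_sum.
have -> : \int[dx]_y (e / 2 * kern n.+1 (y - x)) = kern_integral n.+1 * (e / 2).
  by rewrite (RintegralZl _ measurableT ik) kern_mass mulrC.
rewrite (RintegralZl _ measurableT (integrableR_sum (index_enum _) im)).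
rewrite Rintegral_sum// [e in leRHS]splitr [leRHS]mulrDr lerD2l.
apply: (@le_trans _ _ (C * (d%:R / n.+1%:R * kern_integral n.+1))).
  rewrite ler_wpM2l//; apply: (@le_trans _ _ (\sum_(i < d) (kern_integral n.+1 / n.+1%:R))).
    apply: ler_sum => i _; rewrite ler_pdivlMr// mulrC; exact: kern_moment.
  by rewrite sumr_const card_ord -[leLHS]mulr_natl mulrA [leRHS]mulrAC.
rewrite [leLHS]mulrA [leRHS](mulrC (kern_integral n.+1)); apply: ler_wpM2r; first exact: ltW.
apply: le_trans n0P.
rewrite mulrA; apply: ler_wpM2l; first exact: mulr_ge0.
by rewrite lef_pV2 ?posrE// ler_nat.
Unshelve. all: by end_near. Qed.

(* Convolving with [kern] yields trigonometric polynomials, which [h] annihilates. *)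
Lemma fcoef_unique (h phi : point -> R) : dx.-integrable setT (EFin \o h) ->
  (forall k, fcoef h k = 0) -> continuous phi -> torus_periodic phi ->
  \int[dx]_x (h x * phi x) = 0.
Proof.
move=> ih h0 cp pp; have [M HM] := periodic_bounded cp pp.
have mh : measurable_fun setT h by apply/measurable_EFinP; have /integrableP[] := ih.
pose K n x := (kern_integral n.+1)^-1 * \int[dx]_y (phi y * kern n.+1 (y - x)).
have p0 : (2 * pi) ^- d != 0 :> R by rewrite invr_neq0// expf_neq0// mulf_neq0// gt_eqF// pi_gt0.
have hc k : \int[dx]_x (h x * cos (dotk k x)) = 0.
  by have /(congr1 fst)/eqP := h0 k; rewrite /= /fcos mulf_eq0 (negbTE p0) => /eqP.
have hs k : \int[dx]_x (h x * sin (dotk k x)) = 0.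
  by have /(congr1 snd)/eqP := h0 k; rewrite /= /fsin mulf_eq0 (negbTE p0) => /eqP.
have mphi : measurable_fun setT phi by exact: continuous_row_measurable.
have ihc k : dx.-integrable setT (EFin \o (fun x => h x * cos (dotk k x))).
  by apply: (integrableR_bmul ih (measurable_cos_dot k)) => x; exact: norm_cos_le1.
have ihs k : dx.-integrable setT (EFin \o (fun x => h x * sin (dotk k x))).
  by apply: (integrableR_bmul ih (measurable_sin_dot k)) => x; exact: norm_sin_le1.
have KE n x : K n x = (kern_integral n.+1)^-1 * \sum_(q <- kern_list n.+1)
    ((\int[dx]_y (q.1.1 * phi y * cos (dotk q.2 y + q.1.2))) * cos (dotk q.2 x) +
     (\int[dx]_y (q.1.1 * phi y * sin (dotk q.2 y + q.1.2))) * sin (dotk q.2 x)).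
  rewrite /K; congr (_ * _); under eq_Rintegral do rewrite -ev_kern_list /ev mulr_sumr.
  have ib (f : point -> R) q : measurable_fun setT f -> (forall y, `|f y| <= 1) ->
      dx.-integrable setT (EFin \o (fun y => q * phi y * f y)).
    move=> mf f1; apply: (@integrable_bounded _ _ _ _ _ (`|q| * M * 1)).
      by apply: measurable_funM => //; apply: measurable_funM.
    by move=> y; rewrite !normrM ler_pM// ler_wpM2l.
  have ms (q : @term R d) : measurable_fun setT (fun y : point => sin (dotk q.2 y + q.1.2)).
    by under eq_fun do rewrite sin_as_cos -addrA; exact: measurable_cos_dotk.
  rewrite Rintegral_sum; last first.
    move=> q; under eq_fun do rewrite mulrA [phi _ * _]mulrC.
    apply: ib; last by move=> y; exact: norm_cos_le1.
    by under eq_fun do rewrite dotkBr -addrA; exact: measurable_cos_dotk.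
  have ib1 q := ib _ q.1.1 (measurable_cos_dotk q.2 q.1.2) (fun y => norm_cos_le1 _).
  have ib2 q := ib _ q.1.1 (ms q) (fun y => norm_sin_le1 _).
  apply: eq_bigr => q _.
  rewrite -RintegralZr//.
  rewrite -RintegralZr//.
  rewrite -RintegralD//; [|exact: (integrableZr measurableT _ (ib1 q))|exact: (integrableZr measurableT _ (ib2 q))].
  apply: eq_Rintegral => y _; rewrite dotkBr addrAC cosB; ring.
have mK n : measurable_fun setT (K n).
  rewrite (funext (KE n)); apply: measurable_funM => //; apply: measurable_sum => q.
  by apply: measurable_funD; apply: measurable_funM => //; [exact: measurable_cos_dot|exact: measurable_sin_dot].
have K0 n : \int[dx]_x (h x * K n x) = 0.
  have -> : (fun x => h x * K n x) = fun x => (kern_integral n.+1)^-1 * \sum_(q <- kern_list n.+1)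
    ((\int[dx]_y (q.1.1 * phi y * cos (dotk q.2 y + q.1.2))) * (h x * cos (dotk q.2 x)) +
     (\int[dx]_y (q.1.1 * phi y * sin (dotk q.2 y + q.1.2))) * (h x * sin (dotk q.2 x))).
    apply/funext => x; rewrite KE mulrCA mulr_sumr; congr (_ * _).
    by apply: eq_bigr => q _; rewrite mulrDr ![h x * (_ * _)]mulrCA.
  have iq q : dx.-integrable setT (EFin \o (fun x =>
    (\int[dx]_y (q.1.1 * phi y * cos (dotk q.2 y + q.1.2))) * (h x * cos (dotk q.2 x)) +
     (\int[dx]_y (q.1.1 * phi y * sin (dotk q.2 y + q.1.2))) * (h x * sin (dotk q.2 x)))).
    by apply: integrableRD; exact: integrableRZ.
  rewrite RintegralZl//; last first.
    exact: integrableR_sum.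
  rewrite Rintegral_sum// big1 ?mulr0// => q _.
  rewrite RintegralD//; [|exact: (integrableZl measurableT _ (ihc q.2))|exact: (integrableZl measurableT _ (ihs q.2))].
  by rewrite !RintegralZl// hc hs !mulr0 addr0.
have KM n x : `|K n x| <= M.
  rewrite /K normrM ger0_norm ?invr_ge0 ?(ltW (kern_integral_gt0 _))// ler_pdivrMl ?kern_integral_gt0//.
  have ik : dx.-integrable setT (EFin \o (fun y => kern n.+1 (y - x))).
    have := @integrable_kern_mul n.+1 x (fun=> 1) (@continuous_const _ _ _) (fun _ _ => erefl).
    by under eq_fun do rewrite mul1r.
  rewrite mulrC -(kern_mass _ x) -RintegralZl//; apply: le_Rintegral_norm.
  - exact: integrable_kern_mul.
  - exact: (integrableZl measurableT M ik).
  - by move=> y; rewrite normrM (ger0_norm (kern_ge0 _ _)) ler_wpM2r ?kern_ge0.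
have cv : (fun n => \int[dx]_x (h x * K n x)) @ \oo --> \int[dx]_x (h x * phi x).
  apply: (@Rdominated_cvg _ _ _ dx (fun n x => h x * K n x) (fun x => h x * phi x) (fun x => M * `|h x|) _ _ _ _ _).2.
  - by move=> n; exact: measurable_funM.
  - exact: measurable_funM.
  - apply: aeW => x; apply: cvgM; first exact: cvg_cst.
    exact: kern_cvg.
  - exact: (integrableZl measurableT M (integrable_norm ih)).
  - by apply: aeW => x n; rewrite normrM mulrC ler_wpM2r.
move: cv; rewrite (_ : (fun n => _) = fun=> 0) => [cv|]; last exact/funext.
by apply/esym/(cvg_unique _ _ cv) => //; exact: cvg_cst.
Qed.

End uniqueness.

(** * The Euler-Galerkin scheme *)

Section lists_as_series.
Context {R : realType} {d : nat}.
Local Notation nk := (@normk R d).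
Local Notation point := 'rV[R]_d.
Local Notation freq := 'rV[int]_d.
Local Notation dx := (torus_measure R d).
Implicit Types (k : freq) (s : seq (@term R d)).

Definition smul (a : R) (p : R * R) : R * R := (a * p.1, a * p.2).

Lemma amp_smul a p : amp (smul a p) = `|a| * amp p.
Proof. by rewrite /amp /smul /= !exprMn -mulrDr sqrtrM ?sqr_ge0// sqrtr_sqr. Qed.

Lemma amp_eq0 (p : R * R) : amp p <= 0 -> p = 0.
Proof.
move=> h; rewrite [p]surjective_pairing.
have /eqP -> : p.1 == 0 by rewrite -normr_le0 (le_trans (norm_fst_le_amp p)).
by have /eqP -> : p.2 == 0 by rewrite -normr_le0 (le_trans (norm_snd_le_amp p)).
Qed.

(** Coefficients of a real function at k and -k are complex conjugate; for pairs, the sine part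
    changes sign. *)
Definition csym (c : freq -> R * R) : Prop := forall k, c (- k) = ((c k).1, - (c k).2).

Lemma lcoef_sym s : csym (lcoef s).
Proof.
move=> k; rewrite [LHS]surjective_pairing; congr (_, _).
  by rewrite !lcoef1; apply: eq_bigr => q _; rewrite opprK [_%:R + _]addrC.
by rewrite !lcoef2 -sumrN; apply: eq_bigr => q _; rewrite opprK -mulNr -mulrN opprB.
Qed.

Lemma fcoef_sym (u : point -> R) : dx.-integrable setT (EFin \o u) -> csym (fcoef u).
Proof.
move=> ui k; rewrite /fcoef /fcos /fsin; congr (_, _).
  by congr (_ * _); apply: eq_Rintegral => x _; rewrite dotkN cosN.
rewrite -mulrN; congr (_ * _).
under eq_Rintegral do rewrite dotkN sinN mulrN.
under eq_Rintegral do rewrite -mulN1r.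
rewrite RintegralZl ?mulN1r//; apply: (integrableR_bmul ui (measurable_sin_dot k)) => x.
exact: norm_sin_le1.
Qed.

(** Evenness at [k] is required because terms of frequency -k contribute to the coefficient at [k]
    as well. *)
Lemma lcoef_scl (f : freq -> R) s k : f (- k) = f k -> lcoef (scl f s) k = smul (f k) (lcoef s k).
Proof.
move=> fk; have E (q : @term R d) :
    (q.2 == k)%:R * f q.2 = f k * (q.2 == k)%:R /\ (q.2 == - k)%:R * f q.2 = f k * (q.2 == - k)%:R.
  split; case: eqP => [->|_]; rewrite ?(mulr0, mul0r, mulr1, mul1r)//.
rewrite [LHS]surjective_pairing; congr (_, _).
  rewrite !lcoef1 big_map mulr_sumr; apply: eq_bigr => q _ /=; have [E1 E2] := E q.
  transitivity (q.1.1 / 2 * ((q.2 == k)%:R * f q.2 + (q.2 == - k)%:R * f q.2) * cos q.1.2); first by field.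
  by rewrite E1 E2; field.
rewrite !lcoef2 big_map mulr_sumr; apply: eq_bigr => q _ /=; have [E1 E2] := E q.
transitivity (q.1.1 / 2 * ((q.2 == - k)%:R * f q.2 - (q.2 == k)%:R * f q.2) * sin q.1.2); first by field.
by rewrite E1 E2; field.
Qed.

Lemma lcoef_filter (B : seq freq) s k : k \in B -> - k \in B ->
  lcoef [seq q <- s | q.2 \in B] k = lcoef s k.
Proof.
move=> kB kB'; rewrite /lcoef big_filter [in RHS](bigID (fun q => q.2 \in B))/=.
rewrite [X in _ + X]big1 ?addr0// => q qB.
have [/negbTE -> /negbTE ->] : q.2 != k /\ q.2 != - k.
  by split; apply: contraNneq qB => ->.
by rewrite addr0 subr0 !(mulr0, mul0r).
Qed.

Lemma lcoef_eq0 s k : (forall q, q \in s -> q.2 != k /\ q.2 != - k) -> lcoef s k = 0.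
Proof.
move=> sk; rewrite /lcoef big_seq big1// => q /sk[/negbTE -> /negbTE ->].
by rewrite addr0 subr0 !(mulr0, mul0r).
Qed.

Lemma lcoef_bsum a s : bsum (fun k => nk k ^+ a) (lcoef s) (nrm a s).
Proof. by move=> n; exact: lcoef_le_nrm (uniq_freqs n). Qed.

Lemma lcoef_summable_coef s : summable_coef (lcoef s).
Proof. by exists (nrm 0 s); exact/bsum_expr0/lcoef_bsum. Qed.

Lemma ev_fser s x : ev s x = fser (lcoef s) x.
Proof.
have [n nP] := @sub_freqs d ([seq q.2 | q <- s] ++ [seq - q.2 | q <- s]).
have evE m : (n <= m)%N -> ptrig (lcoef s) m x = ev s x.
  move=> nm; rewrite (@ev_trig _ _ s (freqs m)) ?uniq_freqs// => q qs.
  have sub k : k \in freqs n -> k \in freqs m by rewrite !mem_freqs => /leq_trans; apply.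
  split; apply/sub/nP; rewrite mem_cat; apply/orP; [left|right]; apply/mapP; by exists q.
apply/esym/cvg_lim => //; apply/cvgrPdist_le => e e0; near=> m.
rewrite evE ?subrr ?normr0 ?ltW//; near: m; exact: nbhs_infty_ge.
Unshelve. all: by end_near. Qed.

(* the Taylor polynomial of (1 + v)^-3, minus its affine part, is all that [Glist] contributes *)
Lemma lcoef_step N tau (B : seq freq) s k : k != 0 -> k \in B -> - k \in B ->
  lcoef (step N tau B s) k =
  lcoef s k + smul (tau * nk k ^+ 4) (lcoef (Flist N.+2 s) k).
Proof.
move=> k0 kB kB'; rewrite lcoef_cat !lcoef_scl ?normkN// lcoef_filter//.
have L0 : lcoef (scl (fun=> Fcoef 0) (tpow s 0)) k = 0.
  apply: lcoef_eq0 => q /mapP[p]; rewrite inE => /eqP -> -> /=.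
  by split; rewrite eq_sym ?oppr_eq0.
have L1 : lcoef (scl (fun=> Fcoef 1) (tpow s 1)) k = smul (- 3) (lcoef s k).
  rewrite lcoef_scl// -!fcoef_ev.
  have -> : ev (tpow s 1) = ev s by apply/funext => x; rewrite ev_tpow expr1.
  by rewrite /Fcoef expr1 (_ : 'C(3, 2) = 3)%N// mulN1r.
have -> : lcoef (Flist N.+2 s) k = smul (- 3) (lcoef s k) + lcoef (Glist N s) k.
  by rewrite /lcoef big_Flist -!/(lcoef _ _) L0 L1 add0r.
by rewrite /smul /=; congr (_, _) => /=; ring.
Qed.

(** By symmetry the two halves coming from k and -k add up to [c k]. *)
Lemma lcoef_clist c B k : csym c -> uniq B -> k \in B -> - k \in B -> lcoef (clist c B) k = c k.
Proof.
move=> cS uB kB kB'.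
have E (F : freq -> R) l : l \in B -> \sum_(j <- B) F j * (j == l)%:R = F l.
  move=> lB; have := sum_uniq_eq F l uB; rewrite lB mulr1 => <-.
  by under [RHS]eq_bigr do rewrite eq_sym.
rewrite [LHS]surjective_pairing [RHS]surjective_pairing; congr (_, _).
  rewrite lcoef1 big_map /=.
  transitivity (\sum_(j <- B) ((c j).1 / 2 * (j == k)%:R + (c j).1 / 2 * (j == - k)%:R)).
    by apply: eq_bigr => j _; rewrite (angleP (c j)).1; field.
  by rewrite big_split/= (E (fun j => _)) ?(E (fun j => _))// cS /=; field.
rewrite lcoef2 big_map /=.
transitivity (\sum_(j <- B) ((c j).2 / 2 * (j == k)%:R - (c j).2 / 2 * (j == - k)%:R)).
  by apply: eq_bigr => j _; rewrite (angleP (c j)).2; field.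
by rewrite sumrB (E (fun j => _)) ?(E (fun j => _))// cS /=; field.
Qed.

Lemma nrm_mono s : (forall q, q \in s -> q.2 != 0) -> nrm 0 s <= nrm 4 s.
Proof.
move=> s0; rewrite /nrm big_seq [leRHS]big_seq; apply: ler_sum => q /s0 q0.
by rewrite ler_wpM2l// expr0 exprn_ege1// normk_ge1.
Qed.

End lists_as_series.

Section scheme.
Context {R : realType} {d : nat}.
Local Notation nk := (@normk R d).
Local Notation freq := 'rV[int]_d.
Context (c0 : freq -> R * R) (r0 : R).
Hypotheses (c0sym : csym c0) (c00 : c0 0 = 0) (c0r : bsum (fun=> 1) c0 r0)
  (r1 : r0 < 1) (delta0 : 0 < delta_rate r0).
Local Notation delta := (delta_rate r0).

Let r00 : 0 <= r0. Proof. exact: bsum_ge0 c0r. Qed.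

Let delta3 : delta <= 3. Proof. by apply: delta_rate0_le; rewrite r00. Qed.

(** The zero mode is left out: it remains zero, and its absence gives |k| >= 1 and hence exponential
    decay. The list need not be stable under negation, whence the conditions below on the codes of
    both k and -k; each k meets them for all large [N]. *)
Definition modes N : seq freq := [seq k <- freqs N | k != 0].

(** The sum dominates every single |k|^4, which gives the stability condition [euler_dt_bound]; the
    summand [N.+1%:R] makes the step tend to 0. *)
Definition euler_dt N : R := (3 * (\sum_(k <- modes N) nk k ^+ 4 + N.+1%:R))^-1.

Definition euler N n : seq (@term R d) :=
  iter n (step N (euler_dt N) (modes N)) (clist c0 (modes N)).

Lemma euler_dt_gt0 N : 0 < euler_dt N.
Proof.
rewrite invr_gt0 mulr_gt0// ltr_wpDl// sumr_ge0// => k _.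
by rewrite exprn_ge0 ?normk_ge0.
Qed.

Lemma euler_dt_bound N k : k \in modes N -> 3 * (euler_dt N * nk k ^+ 4) <= 1.
Proof.
move=> kB; have p k' : 0 <= nk k' ^+ 4 by rewrite exprn_ge0 ?normk_ge0.
rewrite mulrCA /euler_dt mulrC ler_pdivrMr ?mul1r; last by rewrite -invr_gt0 euler_dt_gt0.
rewrite ler_wpM2l// (big_rem k)//= -addrA lerDl addr_ge0// sumr_ge0//.
Qed.

Lemma euler_dt_le N : 3 * euler_dt N <= N.+1%:R^-1.
Proof.
rewrite /euler_dt invfM mulrA divff// mul1r lef_pV2 ?posrE//.
  by rewrite lerDr sumr_ge0// => k _; rewrite exprn_ge0 ?normk_ge0.
by rewrite ltr_wpDl// sumr_ge0// => k _; rewrite exprn_ge0 ?normk_ge0.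
Qed.

Lemma euler_dt_delta N : euler_dt N * delta <= 1.
Proof.
apply: le_trans (ler_wpM2l (ltW (euler_dt_gt0 N)) delta3) _.
rewrite mulrC; apply: le_trans (euler_dt_le N) _.
by rewrite invf_le1// ler1n.
Qed.

Lemma euler_freq N n q : q \in euler N n -> q.2 \in modes N.
Proof.
elim: n q => [|n IH] q; first by move=> /mapP[k kB ->].
exact: step_freq.
Qed.

Lemma Bf_neq0 N k : k \in modes N -> k != 0.
Proof. by rewrite mem_filter => /andP[]. Qed.

Lemma euler_neq0 N n q : q \in euler N n -> q.2 != 0.
Proof. by move=> /euler_freq; exact: Bf_neq0. Qed.

Lemma euler_init N : nrm 0 (euler N 0) <= r0.
Proof.
rewrite nrm_clist big_filter; apply: le_trans (c0r N).
rewrite [leLHS]big_mkcond; apply: ler_sum => k _; rewrite expr0 mul1r.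
by case: ifP => _; rewrite ?amp_ge0.
Qed.

Lemma euler_le N n : nrm 0 (euler N n) <= r0 /\
  nrm 0 (euler N n.+1) <= nrm 0 (euler N n) - euler_dt N * (delta * nrm 4 (euler N n)).
Proof.
have S m : nrm 0 (euler N m) <= r0 ->
    nrm 0 (euler N m.+1) <= nrm 0 (euler N m) - euler_dt N * (delta * nrm 4 (euler N m)).
  move=> mr; apply: nrm_step => //; [exact/ltW/euler_dt_gt0|exact: euler_dt_bound|exact: euler_freq].
elim: n => [|n [IH1 IH2]]; first by split; [|apply: S]; exact: euler_init.
suff h : nrm 0 (euler N n.+1) <= r0 by split => //; exact: S.
apply: le_trans IH2 _; apply: le_trans IH1; rewrite gerBl.
by rewrite mulr_ge0 ?(ltW (euler_dt_gt0 N))// mulr_ge0 ?nrm_ge0// ltW.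
Qed.

(** Without zero mode the norm of order 4 dominates that of order 0, so that each step contracts by
    the factor 1 - dt delta, at most exp (- dt delta). *)
Lemma euler_decay N n : nrm 0 (euler N n) <= r0 * expR (- delta * (n%:R * euler_dt N)).
Proof.
elim: n => [|n IH]; first by rewrite mul0r mulr0 expR0 mulr1 euler_init.
have [_ h] := euler_le N n; apply: le_trans h _.
have m04 : nrm 0 (euler N n) <= nrm 4 (euler N n) by apply: nrm_mono => q; exact: euler_neq0.
have t0 := euler_dt_gt0 N.
apply: (@le_trans _ _ ((1 - euler_dt N * delta) * nrm 0 (euler N n))).
  rewrite [leRHS]mulrBl mul1r [euler_dt N * (_ * _)]mulrA lerD2l lerN2 ler_wpM2l//.
  by rewrite mulr_ge0 ?ltW.
have e1 : 1 - euler_dt N * delta <= expR (- delta * euler_dt N).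
  by rewrite (le_trans _ (expR_ge1Dx _))// mulNr mulrC.
have -> : - delta * (n.+1%:R * euler_dt N) = - delta * euler_dt N + - delta * (n%:R * euler_dt N).
  by rewrite -natr1; ring.
rewrite expRD mulrCA; apply: ler_pM => //; first by rewrite subr_ge0 euler_dt_delta.
exact: nrm_ge0.
Qed.

(** The dissipation in [euler_le] telescopes. This is the bound of the fourth moment in L^1 in time
    on which the later compactness rests. *)
Lemma euler_sum4 N n : euler_dt N * \sum_(i < n) nrm 4 (euler N i) <= r0 / delta.
Proof.
suff h : nrm 0 (euler N n) + delta * (euler_dt N * \sum_(i < n) nrm 4 (euler N i)) <= r0.
  rewrite ler_pdivlMr// mulrC; apply: le_trans h; rewrite lerDr; exact: nrm_ge0.
elim: n => [|n IH]; first by rewrite big_ord0 !mulr0 addr0 euler_init.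
rewrite big_ord_recr/=; have [_ h] := euler_le N n; move: h IH; rewrite !mulrDr.
rewrite [euler_dt N * (delta * _)]mulrCA; lra.
Qed.

Lemma mem_Bf N k : k != 0 -> (pickle k < N)%N -> (pickle (- k) < N)%N ->
  k \in modes N /\ - k \in modes N.
Proof. by move=> k0 kN kN'; rewrite !mem_filter oppr_eq0 k0 !mem_freqs kN kN'. Qed.

Lemma euler_coef0 N n : lcoef (euler N n) 0 = 0.
Proof.
by apply: lcoef_eq0 => q qs; rewrite oppr0; split; exact: euler_neq0 qs.
Qed.

Lemma euler_step N n k : (pickle k < N)%N -> (pickle (- k) < N)%N ->
  lcoef (euler N n.+1) k = lcoef (euler N n) k +
    smul (euler_dt N * nk k ^+ 4) (lcoef (Flist N.+2 (euler N n)) k).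
Proof.
move=> kN kN'; have [->|k0] := eqVneq k 0.
  by rewrite !euler_coef0 normk0 expr0n/= mulr0 /smul !mul0r addr0.
by have [kB kB'] := mem_Bf k0 kN kN'; exact: lcoef_step.
Qed.

Lemma euler_Flist N n k : amp (lcoef (Flist N.+2 (euler N n)) k) <= (1 - r0) ^- 3.
Proof.
have [h _] := euler_le N n.
have s1 : nrm 0 (euler N n) < 1 by apply: le_lt_trans h r1.
have := @lcoef_le_nrm _ _ 0 (Flist N.+2 (euler N n)) [:: k] isT.
rewrite big_seq1 expr0 mul1r => /le_trans; apply.
apply: le_trans (nrm0_Flist _ s1) _.
rewrite lef_pV2 ?posrE ?exprn_gt0 ?subr_gt0//.
by rewrite lerXn2r ?nnegrE ?subr_ge0 ?(ltW r1) ?(ltW s1)// lerD2l lerN2.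
Qed.

(** The flux has coefficients bounded by (1 - r0)^-3 uniformly in [N], so the Lipschitz constant
    depends only on the frequency and on [r0]. *)
Lemma euler_lip N m n k : (pickle k < N)%N -> (pickle (- k) < N)%N -> (m <= n)%N ->
  amp (lcoef (euler N n) k - lcoef (euler N m) k) <=
  (n%:R * euler_dt N - m%:R * euler_dt N) * (nk k ^+ 4 * (1 - r0) ^- 3).
Proof.
move=> kN kN' /subnK <-; elim: (n - m)%N => [|j IH].
  by rewrite add0n !subrr amp0 mul0r.
rewrite addSn euler_step// addrAC (le_trans (ampD _ _))// amp_smul.
apply: le_trans (lerD IH (ler_wpM2l (normr_ge0 _) (euler_Flist _ _ _))) _.
rewrite ger0_norm ?mulr_ge0 ?exprn_ge0 ?normk_ge0 ?(ltW (euler_dt_gt0 N))//.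
by rewrite -natr1 le_eqVlt; apply/orP; left; apply/eqP; ring.
Qed.

(** Truncation gives 0 at negative times, where the paths therefore keep their initial value; later
    statements can range over all real times. *)
Definition time_steps N (t : R) : nat := Num.truncn (t / euler_dt N).

Lemma time_steps_le N (t : R) : 0 <= t -> (time_steps N t)%:R * euler_dt N <= t < (time_steps N t)%:R * euler_dt N + euler_dt N.
Proof.
move=> t0; have t1 := euler_dt_gt0 N.
have /truncn_itv/andP[h1 h2] : 0 <= t / euler_dt N by rewrite divr_ge0// ltW.
by rewrite -ler_pdivlMr// h1/= -[X in _ + X]mul1r -mulrDl natr1 -ltr_pdivrMr.
Qed.

Lemma time_steps_neg N (t : R) : t <= 0 -> time_steps N t = 0%N.
Proof.
move=> t0; apply/eqP; rewrite -leqn0 leqNgt /time_steps truncn_gt0 -ltNge.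
by rewrite (le_lt_trans _ ltr01)// ler_pdivrMr ?euler_dt_gt0// mul0r.
Qed.

Lemma time_steps_mono N : {homo time_steps N : s t / s <= t >-> (s <= t)%N}.
Proof.
by move=> s t st; apply: le_truncn; rewrite ler_wpM2r// invr_ge0 ltW// euler_dt_gt0.
Qed.

Definition euler_path N (t : R) : seq (@term R d) := euler N (time_steps N t).

Lemma path_lip N k s t : (pickle k < N)%N -> (pickle (- k) < N)%N ->
  amp (lcoef (euler_path N t) k - lcoef (euler_path N s) k) <=
  (`|t - s| + euler_dt N) * (nk k ^+ 4 * (1 - r0) ^- 3).
Proof.
move=> kN kN'; wlog st : s t / s <= t.
  move=> W; have [/W//|/ltW/W] := leP s t.
  by rewrite ampC distrC.
apply: le_trans (euler_lip kN kN' (time_steps_mono N st)) _.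
have C0 : 0 <= nk k ^+ 4 * (1 - r0) ^- 3.
  by rewrite mulr_ge0 ?exprn_ge0 ?normk_ge0// invr_ge0 exprn_ge0// subr_ge0 ltW.
rewrite ler_wpM2r// ger0_norm ?subr_ge0//.
have t0 := euler_dt_gt0 N.
have [t0'|tp] := leP t 0.
  by rewrite (time_steps_neg N t0') (time_steps_neg N (le_trans st t0')) subrr addr_ge0 ?subr_ge0// ltW.
have [s0|sp] := leP s 0.
  rewrite (time_steps_neg N s0) mul0r subr0.
  by have := time_steps_le N (ltW tp) => /andP[h _]; lra.
by have := time_steps_le N (ltW tp) => /andP[h _]; have := time_steps_le N (ltW sp) => /andP[_ h2]; lra.
Qed.

Lemma path_nrm N t : nrm 0 (euler_path N t) <= r0.
Proof. by have [] := euler_le N (time_steps N t). Qed.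

Lemma path_decay N t : 0 <= t -> nrm 0 (euler_path N t) <= r0 * expR (- delta * (t - euler_dt N)).
Proof.
move=> t0; apply: le_trans (euler_decay _ _) _; rewrite ler_wpM2l// ler_expR.
rewrite !mulNr lerN2 ler_wpM2l ?(ltW delta0)//.
by have := time_steps_le N t0 => /andP[_ h]; lra.
Qed.

Lemma path_amp N t k : amp (lcoef (euler_path N t) k) <= r0.
Proof.
apply: le_trans (path_nrm N t); have := @lcoef_le_nrm _ _ 0 (euler_path N t) [:: k] isT.
by rewrite big_seq1 expr0 mul1r.
Qed.

Lemma path_init N k : (pickle k < N)%N -> (pickle (- k) < N)%N -> lcoef (euler_path N 0) k = c0 k.
Proof.
move=> kN kN'; rewrite /euler_path time_steps_neg//.
have [->|k0] := eqVneq k 0; first by rewrite euler_coef0 c00.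
have [kB kB'] := mem_Bf k0 kN kN'.
by rewrite /euler lcoef_clist// filter_uniq// uniq_freqs.
Qed.

Definition amp_cvg (F : set_system nat) (u : nat -> R * R) (l : R * R) : Prop :=
  forall e : R, 0 < e -> \forall N \near F, amp (u N - l) <= e.

Lemma bounded_ultra_cvg (U : set_system nat) (u : nat -> R) (M : R) : UltraFilter U ->
  (forall N, `|u N| <= M) -> exists l : R, u @ U --> l.
Proof.
move=> UU uM; have PU : ProperFilter U by exact: ultra_proper.
have [|l [_ ul]] := @segment_compact R (- M) M (u @ U) _.
  by apply: (@filterS _ U _ setT) filterT => N _ /=; rewrite in_itv/= -ler_norml.
exists l; apply/cvgrPdist_le => e e0.
have [//|FC] := in_ultra_setVsetC (u @^-1` [set y | `|l - y| <= e]) UU.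
have [|y []//] := ul (~` [set y | `|l - y| <= e]) [set y | `|l - y| <= e] FC.
  by apply/nbhs_ballP; exists e => //= y; rewrite -ball_normE /= => /ltW.
Qed.

(* Limits are first taken along an ultrafilter, which makes the choice of a
   converging subsequence explicit. *)
Lemma path_ultra : exists U : set_system nat, [/\ UltraFilter U, \oo `<=` U &
  exists c : R -> freq -> R * R, forall t k, amp_cvg U (fun N => lcoef (euler_path N t) k) (c t k)].
Proof.
have [U [UU sU]] := ultraFilterLemma eventually_filter.
exists U; split => //.
have cv (t : R) k : exists p : R * R, amp_cvg U (fun N => lcoef (euler_path N t) k) p.
  have [a ua] := bounded_ultra_cvg UU (fun N => le_trans (norm_fst_le_amp _) (path_amp N t k)).
  have [b ub] := bounded_ultra_cvg UU (fun N => le_trans (norm_snd_le_amp _) (path_amp N t k)).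
  exists (a, b) => e e0; have e20 : 0 < e / 2 by rewrite divr_gt0.
  move/cvgrPdist_le/(_ _ e20) : ua => ha; move/cvgrPdist_le/(_ _ e20) : ub => hb.
  near=> N; apply: le_trans (amp_le_norm _) _; rewrite (splitr e) lerD//= distrC.
    by near: N.
  by near: N.
have /choice[c cP] := fun z : R * freq => cv z.1 z.2.
by exists (fun t k => c (t, k)) => t k; exact: (cP (t, k)).
Unshelve. all: by end_near. Qed.

Let lip k : R := nk k ^+ 4 * (1 - r0) ^- 3.

Let lip_ge0 k : 0 <= lip k.
Proof. by rewrite mulr_ge0 ?exprn_ge0 ?normk_ge0// invr_ge0 exprn_ge0// subr_ge0 ltW. Qed.

Lemma euler_dt_lt N : euler_dt N <= N.+1%:R^-1.
Proof. by apply: le_trans (euler_dt_le N); have := euler_dt_gt0 N; lra. Qed.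

Lemma near_seq (T I : Type) (F : set_system T) (FF : Filter F) (s : seq I) (P : I -> T -> Prop) :
  (forall i, \forall x \near F, P i x) -> \forall x \near F, List.Forall (P ^~ x) s.
Proof.
move=> h; elim: s => [|i s IH]; first by apply: nearW => x; constructor.
by near=> x; constructor; near: x.
Unshelve. all: by end_near. Qed.

Lemma amp_cvg_le (F : set_system nat) (FF : ProperFilter F) (u : nat -> R * R) l p (M : R) :
  amp_cvg F u l -> (\forall N \near F, amp (u N - p) <= M) -> amp (l - p) <= M.
Proof.
move=> ul uM; apply/ler_addgt0Pr => e e0.
have [N [h1 h2]] : exists N, amp (u N - l) <= e /\ amp (u N - p) <= M.
  by apply: (@filter_ex _ F); near=> N; split; near: N => //; exact: ul.
have -> : l - p = (u N - p) - (u N - l) by rewrite opprB [RHS]addrC addrA subrK.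
by rewrite (le_trans (ampB _ _))// lerD.
Unshelve. all: by end_near. Qed.

(** Dominated convergence requires a sequence, so [phi m] is picked to be within 1 / (m + 1) of the
    ultrafilter limit for finitely many frequencies and grid times. Equicontinuity of each
    coefficient then gives convergence at all times. *)
Lemma path_subseq : exists (phi : nat -> nat) (c : R -> freq -> R * R),
  [/\ forall m, (m <= phi m)%N,
   forall t k, amp_cvg \oo (fun m => lcoef (euler_path (phi m) t) k) (c t k) &
   forall s t k, amp (c t k - c s k) <= `|t - s| * lip k].
Proof.
have [U [UU sU [c cP]]] := path_ultra.
have PU : ProperFilter U by exact: ultra_proper.
have nU n : \forall N \near U, (n <= N)%N by apply: sU; exact: nbhs_infty_ge.
have large k n : \forall N \near U, [/\ (n <= N)%N, (pickle k < N)%N & (pickle (- k) < N)%N].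
  by near=> N; split; near: N; exact: nU.
have cL s t k : amp (c t k - c s k) <= `|t - s| * lip k.
  apply/ler_addgt0Pr => e e0.
  have e3 : 0 < e / 3 / (lip k + 1) by rewrite divr_gt0 ?divr_gt0// ltr_wpDl.
  have e4 : 0 < e / 3 by rewrite divr_gt0.
  have := near_infty_natSinv_lt (PosNum e3) => -[n0 _ /(_ n0 (leqnn _)) /= hn0].
  have [N [h1 h2 [nN kN kN']]] : exists N, [/\ amp (lcoef (euler_path N t) k - c t k) <= e / 3,
      amp (lcoef (euler_path N s) k - c s k) <= e / 3 &
      [/\ (n0 <= N)%N, (pickle k < N)%N & (pickle (- k) < N)%N]].
    by apply: (@filter_ex _ U); near=> N; split; near: N; [exact: cP|exact: cP|exact: large].
  have := path_lip s t kN kN'; rewrite -/(lip k) => h3.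
  have tN : euler_dt N * lip k <= e / 3.
    have : euler_dt N <= e / 3 / (lip k + 1).
      apply: le_trans (euler_dt_lt N) _; apply: le_trans (ltW hn0).
      by rewrite lef_pV2 ?posrE// ler_nat.
    rewrite ler_pdivlMr ?ltr_wpDl//; have := euler_dt_gt0 N; nra.
  have -> : c t k - c s k = (lcoef (euler_path N t) k - lcoef (euler_path N s) k)
     - (lcoef (euler_path N t) k - c t k) + (lcoef (euler_path N s) k - c s k).
    by congr (_, _) => /=; ring.
  apply: le_trans (ampD _ _) _.
  have := ampB (lcoef (euler_path N t) k - lcoef (euler_path N s) k) (lcoef (euler_path N t) k - c t k).
  move: h3; rewrite mulrDl; lra.
(* The times j / (m + 1) with j <= (m + 1)^2 fill [0, m + 1], and only finitely many conditions are
   imposed. *)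
have ex m : exists N, (m <= N)%N /\ forall k j, k \in freqs m -> (j <= m.+1 ^ 2)%N ->
    amp (lcoef (euler_path N (j%:R / m.+1%:R)) k - c (j%:R / m.+1%:R) k) <= m.+1%:R^-1.
  have : \forall N \near U, List.Forall (fun z : freq * nat =>
     amp (lcoef (euler_path N (z.2%:R / m.+1%:R)) z.1 - c (z.2%:R / m.+1%:R) z.1) <= m.+1%:R^-1)
     [seq (k, j) | k <- freqs m, j <- iota 0 (m.+1 ^ 2).+1].
    by apply: near_seq => z; apply: cP; rewrite invr_gt0.
  move=> h; have [N [N1 N2]] : exists N, (m <= N)%N /\ List.Forall (fun z : freq * nat =>
     amp (lcoef (euler_path N (z.2%:R / m.+1%:R)) z.1 - c (z.2%:R / m.+1%:R) z.1) <= m.+1%:R^-1)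
     [seq (k, j) | k <- freqs m, j <- iota 0 (m.+1 ^ 2).+1].
    by apply: (@filter_ex _ U); near=> N; split; near: N.
  exists N; split => // k j kK jm.
  have : (k, j) \in [seq (k, j) | k <- freqs m, j <- iota 0 (m.+1 ^ 2).+1].
    by apply: allpairs_f => //; rewrite mem_iota.
  elim: N2 => [//|z s zP _ IH]; rewrite inE => /orP[/eqP E|]; [by rewrite -E in zP|exact: IH].
have /choice[phi phiP] := ex.
exists phi, c; split => //; first by move=> m; have [] := phiP m.
have cneg t k : t <= 0 -> c t k = c 0 k.
  move=> t0; apply/eqP; rewrite -subr_eq0; apply/eqP/amp_eq0.
  apply/ler_addgt0Pr => e e0; rewrite add0r.
  have pathE N : euler_path N t = euler_path N 0 by rewrite /euler_path !time_steps_neg.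
  apply: (amp_cvg_le PU (cP t k)); apply: filterS (cP 0 k e e0) => N.
  by rewrite pathE.
have pos t k : 0 <= t -> amp_cvg \oo (fun m => lcoef (euler_path (phi m) t) k) (c t k).
  move=> t0 e e0.
  (* Three Lipschitz errors of size 1 / (m + 1), from the path, its time step and the limit, and one
     grid tolerance. *)
  have L0 : 0 < 3 * lip k + 1 by rewrite ltr_wpDl// mulr_ge0.
  have [n0 n0P] : exists n0 : nat, (3 * lip k + 1) * n0.+1%:R^-1 <= e.
    have := near_infty_natSinv_lt (PosNum (divr_gt0 e0 L0)) => -[n0 _ /(_ n0 (leqnn _)) /= hn0].
    by exists n0; rewrite mulrC -ler_pdivlMr// ltW.
  near=> m; have [mphi mP] := phiP m.
  have km : (pickle k < m)%N by near: m; exact: nbhs_infty_gt.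
  have km' : (pickle (- k) < m)%N by near: m; exact: nbhs_infty_gt.
  have nm : (n0 <= m)%N by near: m; exact: nbhs_infty_ge.
  have tm : t <= m.+1%:R.
    have /(le_trans (ltW (truncnS_gt t))) : (Num.truncn t).+1%:R <= m.+1%:R :> R.
      by rewrite ler_nat; near: m; exact: nbhs_infty_ge.
    exact.
  have m0 : 0 < m.+1%:R :> R by [].
  pose j := Num.truncn (t * m.+1%:R).
  have /truncn_itv/andP[j1 j2] : 0 <= t * m.+1%:R by rewrite mulr_ge0.
  have jm : (j <= m.+1 ^ 2)%N.
    rewrite -(ler_nat R) (le_trans j1)// natrX expr2; exact: ler_wpM2r.
  have ts : `|t - j%:R / m.+1%:R| <= m.+1%:R^-1.
    rewrite ger0_norm ?subr_ge0 ?ler_pdivrMr//.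
    by rewrite lerBlDl -[X in _ + X]mul1r -mulrDl ler_pdivlMr// natr1 ltW.
  have h1 := mP k j (etrans (mem_freqs _ _) km) jm.
  have h2 := path_lip (j%:R / m.+1%:R) t (leq_trans km mphi) (leq_trans km' mphi).
  have h3 := cL t (j%:R / m.+1%:R) k.
  set s := j%:R / m.+1%:R in ts h1 h2 h3.
  have -> : lcoef (euler_path (phi m) t) k - c t k = (lcoef (euler_path (phi m) t) k - lcoef (euler_path (phi m) s) k)
     + (lcoef (euler_path (phi m) s) k - c s k) + (c s k - c t k).
    by congr (_, _) => /=; ring.
  rewrite (le_trans (ampD _ _))//.
  have h4 := ampD (lcoef (euler_path (phi m) t) k - lcoef (euler_path (phi m) s) k) (lcoef (euler_path (phi m) s) k - c s k).
  have {}h3 : amp (c s k - c t k) <= `|t - s| * lip k by rewrite ampC.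
  rewrite -/(lip k) in h2.
  have i1 : euler_dt (phi m) <= m.+1%:R^-1.
    by rewrite (le_trans (euler_dt_lt _))// lef_pV2 ?posrE// ler_nat.
  have i2 : (3 * lip k + 1) * m.+1%:R^-1 <= e.
    by rewrite (le_trans _ n0P)// ler_wpM2l ?(ltW L0)// lef_pV2 ?posrE// ler_nat.
  have i3 := ler_wpM2r (lip_ge0 k) ts; have i4 := ler_wpM2r (lip_ge0 k) i1.
  move: h1 h2 h3 h4 i2 i3 i4; rewrite mulrDl.
  move: (amp _) (amp _) (amp _) (amp _) (lip k) (euler_dt _) m.+1%:R^-1 `|_| => A B C D L u M z.
  rewrite !mulrDl => h1 h2 h3 h4 i2 i3 i4; nra.
move=> t k; have [t0|/ltW t0] := leP 0 t; first exact: pos.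
rewrite (cneg t k t0); have := pos 0 k (lexx _).
have pathE N : euler_path N 0 = euler_path N t by rewrite /euler_path !time_steps_neg.
by under eq_fun do rewrite pathE.
Unshelve. all: by end_near. Qed.

End scheme.

Lemma measurable_inv_cube {disp : measure_display} {T : measurableType disp} {R : realType}
    (u : T -> R) : measurable_fun setT u -> (forall x, `|u x| <= 1) ->
  measurable_fun setT (fun x => (1 + u x) ^- 3).
Proof.
move=> mu u1; have h : measurable_fun setT (fun x => (1 + u x) ^+ 3).
  by apply: (measurable_funX 3); exact: measurable_funD.
rewrite (_ : (fun x => _) = (fun y : R => y `^ (-1)) \o (fun x => (1 + u x) ^+ 3)).
  by apply: measurableT_comp h; exact: measurable_powR.
apply/funext => x /=; rewrite powR_inv1// exprn_ge0//.
by have := u1 x; rewrite ler_norml => /andP[h1 _]; rewrite -lerBlDl sub0r.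
Qed.

Lemma measurable_amp {disp : measure_display} {T : measurableType disp} {R : realType}
    (u : T -> R * R) : measurable_fun setT (fun x => (u x).1) ->
  measurable_fun setT (fun x => (u x).2) -> measurable_fun setT (fun x => amp (u x)).
Proof.
move=> m1 m2; have ms : measurable_fun setT (Num.sqrt : R -> R).
  by apply: continuous_measurable_fun; exact: sqrt_continuous.
by apply: (measurableT_comp ms); apply: measurable_funD; exact: measurable_funX.
Qed.

(** * Passing to the limit in the scheme *)

Section interval_comparison.
Context {R : realType}.
Implicit Types (a b t T : R).

Lemma ae_interval a b : {ae interval_measure a b, forall s, a <= s <= b}.
Proof.
exists (~` `[a, b]); split; first exact: measurableC.
  by rewrite [LHS]/(lebesgue_measure _) setICl measure0.
by move=> s; apply: contra_not => /=; rewrite in_itv.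
Qed.

Lemma eq_Rintegral_interval a b (f g : R -> R) : measurable_fun setT f -> measurable_fun setT g ->
  (forall s, a <= s <= b -> f s = g s) ->
  \int[interval_measure a b]_s f s = \int[interval_measure a b]_s g s.
Proof.
move=> mf mg fg; rewrite /Rintegral; congr fine; apply: ae_eq_integral => //.
- exact/measurable_EFinP.
- exact/measurable_EFinP.
- by apply: filterS (ae_interval a b) => s /fg ->.
Qed.

Lemma integrable_interval a b (f : R -> R) (M : R) : measurable_fun setT f ->
  (forall s, a <= s <= b -> `|f s| <= M) -> (interval_measure a b).-integrable setT (EFin \o f).
Proof.
move=> mf fM; pose g s := f s * \1_(`[a, b] : set R) s.
have mg : measurable_fun setT g by apply: measurable_funM => //; exact: measurable_indic.
have gi : (interval_measure a b).-integrable setT (EFin \o g).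
  apply: (@integrable_bounded _ _ _ _ _ `|M|) => // s; rewrite /g indicE.
  case: (boolP (s \in _)) => [|_]; last by rewrite mulr0 normr0.
  by rewrite inE /= in_itv/= => /fM h; rewrite mulr1 (le_trans h)// ler_norm.
apply/integrableP; split; first exact/measurable_EFinP.
have /integrableP[_] := gi; apply: le_lt_trans; rewrite le_eqVlt; apply/orP; left; apply/eqP.
apply: ae_eq_integral => //.
- by apply: measurableT_comp => //; exact/measurable_EFinP.
- by apply: measurableT_comp => //; exact/measurable_EFinP.
- apply: filterS (ae_interval a b) => s ab _ /=; rewrite /g indicE mem_set ?mulr1//=.
Qed.

Lemma Rintegral_sub_interval a t T (f : R -> R) : t <= T -> measurable_fun setT f ->
  \int[interval_measure a t]_s f s = \int[interval_measure a T]_s (f s * ((s <= t)%R)%:R).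
Proof.
move=> tT mf; have mt : measurable_fun setT (fun s : R => ((s <= t)%R)%:R : R).
  have -> : (fun s : R => ((s <= t)%R)%:R : R) = \1_(`]-oo, t] : set R).
    by apply/funext => s; rewrite indicE mem_setE in_itv.
  exact: measurable_indic.
rewrite !Rintegral_interval//; last exact: measurable_funM.
rewrite /Rintegral; congr fine.
rewrite [LHS]integral_mkcond [RHS]integral_mkcond; apply: eq_integral => s _.
rewrite !patchE !mem_setE !in_itv/=; case: (leP a s) => //= sa.
case: (leP s t) => st /=; last by case: ifP => // _; rewrite mulr0.
by rewrite (le_trans st tT) mulr1.
Qed.

Lemma interval_cst T (x : R) : 0 <= T -> \int[interval_measure 0 T]__ x = x * T.
Proof.
move=> T0; rewrite Rintegral_cstT; congr (_ * _).
by apply: etrans (congr1 fine (interval_measureT T0)) _; rewrite subr0.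
Qed.

End interval_comparison.

(** * The map v -> (1 + v)^-3 on coefficient sequences *)

Section nemytskii.
Context {R : realType} {d : nat}.
Local Notation nk := (@normk R d).
Local Notation point := 'rV[R]_d.
Local Notation freq := 'rV[int]_d.
Local Notation dx := (torus_measure R d).
Implicit Types (k : freq) (s : seq (@term R d)) (c : freq -> R * R).

Definition cube c (x : point) : R := (1 + fser c x) ^- 3.

Lemma cube_le (r v : R) : r < 1 -> `|v| <= r -> `|(1 + v) ^- 3| <= (1 - r) ^- 3.
Proof.
move=> r1 vr; have v1 : 1 - r <= 1 + v by rewrite lerD2l lerNl (le_trans _ vr)// -normrN ler_norm.
have r0 : 0 < 1 - r by rewrite subr_gt0.
have v0 : 0 < 1 + v by exact: lt_le_trans v1.
rewrite ger0_norm ?invr_ge0 ?exprn_ge0 ?(ltW v0)// lef_pV2 ?posrE ?exprn_gt0//.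
by rewrite lerXn2r ?nnegrE ?(ltW r0) ?(ltW v0).
Qed.

Lemma cube_lip (r v w : R) : r < 1 -> `|v| <= r -> `|w| <= r ->
  `|(1 + v) ^- 3 - (1 + w) ^- 3| <= 3 * (1 - r) ^- 4 * `|v - w|.
Proof.
move=> r1.
have h u : `|u| <= r -> 0 < 1 + u /\ (1 + u)^-1 <= (1 - r)^-1.
  move=> ur; have u1 : 1 - r <= 1 + u by rewrite lerD2l lerNl (le_trans _ ur)// -normrN ler_norm.
  have r0 : 0 < 1 - r by rewrite subr_gt0.
  have u0 : 0 < 1 + u by exact: lt_le_trans u1.
  by split => //; rewrite lef_pV2 ?posrE.
move=> /h[v0 vr] /h[w0 wr].
have -> : (1 + v) ^- 3 - (1 + w) ^- 3 = (w - v) * ((1 + v)^-1 * (1 + w)^-1 *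
   ((1 + v)^-1 ^+ 2 + (1 + v)^-1 * (1 + w)^-1 + (1 + w)^-1 ^+ 2)).
  by field; rewrite !gt_eqF.
have a0 : 0 < (1 + v)^-1 by rewrite invr_gt0.
have b0 : 0 < (1 + w)^-1 by rewrite invr_gt0.
rewrite normrM distrC [leLHS]mulrC ler_wpM2r// -exprVn.
move: a0 b0 vr wr; move: (1 + v)^-1 (1 + w)^-1 (1 - r)^-1 => a b q a0 b0 aq bq.
rewrite ger0_norm; last by rewrite !(mulr_ge0, addr_ge0, exprn_ge0) ?ltW.
have q0 : 0 < q by exact: lt_le_trans aq.
have p2 x y : 0 < x -> 0 < y -> x <= q -> y <= q -> x * y <= q ^+ 2.
  by move=> x0 y0 xq yq; rewrite expr2 ler_pM// ltW.
rewrite (_ : 3 * q ^+ 4 = q ^+ 2 * (q ^+ 2 + q ^+ 2 + q ^+ 2)); last by ring.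
apply: ler_pM; rewrite ?p2// ?mulr_ge0 ?(ltW a0) ?(ltW b0)//.
  by rewrite !(addr_ge0, mulr_ge0, exprn_ge0) ?ltW.
by rewrite !lerD// expr2 p2.
Qed.

(** Each coordinate is an average against a function bounded by 1; the factor 2 comes from
    [amp_le_norm]. *)
Lemma fcoef_dist (u w : point -> R) k (e M : R) : measurable_fun setT u -> measurable_fun setT w ->
  (forall x, `|u x| <= M) -> (forall x, `|w x| <= M) -> (forall x, `|u x - w x| <= e) ->
  amp (fcoef u k - fcoef w k) <= 2 * e.
Proof.
move=> mu mw uM wM uw; have e0 : 0 <= e by exact: le_trans (uw 0).
have p0 : 0 < (2 * pi) ^+ d :> R by rewrite exprn_gt0// mulr_gt0 ?pi_gt0.
have key (g : point -> R) : measurable_fun setT g -> (forall x, `|g x| <= 1) ->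
   `|(2 * pi) ^- d * \int[dx]_x (u x * g x) - (2 * pi) ^- d * \int[dx]_x (w x * g x)| <= e.
  move=> mg g1.
  have i (h : point -> R) : measurable_fun setT h -> (forall x, `|h x| <= M) ->
      dx.-integrable setT (EFin \o (fun x => h x * g x)).
    move=> mh hM; apply: (@integrable_bounded _ _ _ _ _ (M * 1)); first exact: measurable_funM.
    by move=> x; rewrite normrM ler_pM.
  rewrite -mulrBr -RintegralB//; [|exact: i|exact: i].
  rewrite normrM gtr0_norm ?invr_gt0// ler_pdivrMl// mulrC -torus_cst.
  apply: le_Rintegral_norm.
  - under eq_fun do rewrite -mulrBl.
    apply: (@integrable_bounded _ _ _ _ _ (e * 1)).
      by apply: measurable_funM => //; exact: measurable_funB.
    by move=> x; rewrite normrM ler_pM.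
  - by apply: (@integrable_bounded _ _ _ _ _ `|e|).
  - by move=> x; rewrite -mulrBl normrM -[leRHS]mulr1 ler_pM.
apply: le_trans (amp_le_norm _) _; rewrite mulr_natl mulr2n lerD//=.
  by apply: key; [exact: measurable_cos_dot|move=> x; exact: norm_cos_le1].
by apply: key; [exact: measurable_sin_dot|move=> x; exact: norm_sin_le1].
Qed.

(** The constant term has frequency 0 and vanishes, the linear one contributes 3, and the rest at
    most [3 - delta_rate r]. *)
Lemma nrm4_Flist N s r : nrm 0 s <= r -> r < 1 ->
  nrm 4 (Flist N.+2 s) <= (6 - delta_rate r) * nrm 4 s.
Proof.
move=> sr r1; rewrite /nrm big_Flist -!/(nrm 4 _) !nrm_scl.
have -> : nrm 4 (tpow s 0) = 0 :> R by rewrite /nrm big_seq1 /= normk0 expr0n/= mulr0.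
have h1 : nrm 4 (tpow s 1) <= nrm 4 s.
  by apply: le_trans (nrm4_tpow s 0) _; rewrite expr1n mul1r expr0 mul1r.
have := nrm4_Glist N sr r1.
rewrite mulr0 add0r /Fcoef expr1 mulN1r normrN ger0_norm// (_ : 'C(3, 2) = 3)%N//.
have := nrm_ge0 4 (tpow s 1); lra.
Qed.

Lemma nrm_clist_le a c M n : bsum (fun k => nk k ^+ a) c M -> nrm a (clist c (freqs n)) <= M.
Proof. by move=> cM; rewrite nrm_clist. Qed.

Lemma bsum1_expr0 c M : bsum (fun=> 1) c M -> bsum (fun k => nk k ^+ 0) c M.
Proof. by move=> h n; have := h n; under [in X in _ -> X]eq_bigr do rewrite expr0. Qed.

Lemma amp_cvg_amp (F : set_system nat) (FF : Filter F) (u : nat -> R * R) l : amp_cvg F u l ->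
  amp (u N) @[N --> F] --> amp l.
Proof.
move=> ul; apply/cvgrPdist_le => e /ul; apply: filterS => N; apply: le_trans.
rewrite ler_norml; apply/andP; split.
  by rewrite lerNl opprB lerBlDl -[X in amp X <= _](subrK l) addrC ampD.
by rewrite lerBlDl -[X in amp X <= _](subrK (u N)) ampC addrC ampD.
Qed.

Lemma amp_cvg_sum_le (F : set_system nat) (FF : ProperFilter F) (K : seq freq) (w : freq -> R)
    (u : nat -> freq -> R * R) l (M : R) : (forall k, 0 <= w k) ->
  (forall k, amp_cvg F (u ^~ k) (l k)) ->
  (\forall N \near F, \sum_(k <- K) w k * amp (u N k) <= M) ->
  \sum_(k <- K) w k * amp (l k) <= M.
Proof.
move=> w0 ul uM; apply: (@cvgr_to_le _ F _ R (fun N => \sum_(k <- K) w k * amp (u N k))) => //.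
by apply: cvg_sumr => k; apply: cvgMl_tmp; exact: amp_cvg_amp.
Qed.

Section fixed_coefficients.
Context (c : freq -> R * R) (r : R).
Hypotheses (cr : bsum (fun=> 1) c r) (r1 : r < 1).

Let r0 : 0 <= r. Proof. exact: bsum_ge0 cr. Qed.
Let sc : summable_coef c. Proof. by exists r. Qed.

Lemma cube_bound x : `|cube c x| <= (1 - r) ^- 3.
Proof. by apply: cube_le => //; exact: fser_le. Qed.

Lemma measurable_cube : measurable_fun setT (cube c).
Proof.
apply: measurable_inv_cube (measurable_fser sc) _ => x.
by rewrite (le_trans (fser_le x cr))// ltW.
Qed.

(** The series of [c] and the power series are truncated together. The resulting functions converge
    pointwise under a uniform bound, so their coefficients converge by dominated convergence. *)
Lemma cvg_fcoef_cube k : amp_cvg \oo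
  (fun N => lcoef (Flist N.+2 (clist c (freqs N))) k) (fcoef (cube c) k).
Proof.
pose u N x := ev (Flist N.+2 (clist c (freqs N))) x : R.
have uE N x : u N x = fpoly N.+2 (ptrig c N x) by rewrite /u ev_Flist ev_clist.
have uB N x : `|u N x| <= (1 - r) ^- 3.
  apply: le_trans (ev_le_nrm _ _) _; apply: le_trans (nrm0_Flist _ _) _.
    by apply: le_lt_trans r1; apply: nrm_clist_le; exact: bsum1_expr0.
  have h : nrm 0 (clist c (freqs N)) <= r by apply: nrm_clist_le; exact: bsum1_expr0.
  have h1 : 1 - r <= 1 - nrm 0 (clist c (freqs N)) by rewrite lerD2l lerN2.
  have h0 : 0 < 1 - r by rewrite subr_gt0.
  rewrite lef_pV2 ?posrE ?exprn_gt0 ?(lt_le_trans h0 h1)//.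
  by rewrite lerXn2r ?nnegrE ?(ltW h0) ?(ltW (lt_le_trans h0 h1)).
have B : (fun N : nat => 'C(N.+2 + 2, 2)%:R * r ^+ N.+2) @ \oo --> (0 : R).
  have r01 : 0 <= r < 1 by rewrite r0.
  have := cvg_binomial_geometric r01; rewrite -(cvg_shiftn 2); apply: cvg_trans.
  by apply: near_eq_cvg; apply: nearW => N; rewrite /= !addn2.
have ucvg x : u ^~ x @ \oo --> cube c x.
  have E1 : (fun N => u N x - (1 + ptrig c N x) ^- 3) @ \oo --> 0.
    apply: (@squeeze_cvgr _ _ _ _ (fun N => - ((1 - r) ^- 3 * (4 * ('C(N.+2 + 2, 2)%:R * r ^+ N.+2))))
      (fun N => (1 - r) ^- 3 * (4 * ('C(N.+2 + 2, 2)%:R * r ^+ N.+2)))).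
    - apply: nearW => N; rewrite -ler_norml uE.
      by apply: fpoly_dist; [rewrite r0|exact: ptrig_le].
    - rewrite -oppr0; apply: cvgN; rewrite -[X in _ --> X](mulr0 ((1 - r) ^- 3)); apply: cvgMl_tmp.
      rewrite -[X in _ --> X](mulr0 4); apply: cvgMl_tmp.
      exact: B.
    - rewrite -[X in _ --> X](mulr0 ((1 - r) ^- 3)); apply: cvgMl_tmp.
      rewrite -[X in _ --> X](mulr0 4); apply: cvgMl_tmp.
      exact: B.
  have E2 : (fun N => (1 + ptrig c N x) ^- 3) @ \oo --> cube c x.
    have f1 : 1 + fser c x != 0.
      have := fser_le x cr; rewrite ler_norml => /andP[h1 _].
      by rewrite gt_eqF// -ltrBlDl sub0r (lt_le_trans _ h1)// ltrN2.
    apply: cvgV; first by rewrite expf_neq0.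
    have cx : (fun N => 1 + ptrig c N x) @ \oo --> 1 + fser c x.
      by apply: cvgD; [exact: cvg_cst|exact: fser_cvg].
    exact: (cvgM cx (cvgM cx cx)).
  have E3 : (fun N => u N x - (1 + ptrig c N x) ^- 3 + (1 + ptrig c N x) ^- 3) @ \oo --> 0 + cube c x.
    exact: cvgD.
  by rewrite add0r in E3; apply: (cvg_ext _ E3) => N; rewrite subrK.
have [h1 h2] := @cvg_fcoef _ _ u (cube c) ((1 - r) ^- 3) k (fun N => @measurable_ev _ _ _) uB ucvg.
move=> e e0; have e2 : 0 < e / 2 by rewrite divr_gt0.
move/cvgrPdist_le/(_ _ e2) : h1 => h1; move/cvgrPdist_le/(_ _ e2) : h2 => h2.
near=> N; rewrite -fcoef_ev; apply: le_trans (amp_le_norm _) _; rewrite (splitr e) lerD//= distrC.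
  by near: N.
by near: N.
Unshelve. all: by end_near. Qed.

Lemma bsum_cube0 : bsum (fun=> 1) (fcoef (cube c)) ((1 - r) ^- 3).
Proof.
move=> n; apply: (@amp_cvg_sum_le \oo _ (freqs n) (fun=> 1) (fun N => lcoef (Flist N.+2 (clist c (freqs N))))) => //.
  by move=> k; exact: cvg_fcoef_cube.
apply: nearW => N; apply: le_trans (_ : nrm 0 (Flist N.+2 (clist c (freqs N))) <= _).
  exact: (bsum_expr0 (lcoef_bsum 0 _)).
have h : nrm 0 (clist c (freqs N)) <= r by apply: nrm_clist_le; exact: bsum1_expr0.
apply: le_trans (nrm0_Flist _ (le_lt_trans h r1)) _.
have h1 : 1 - r <= 1 - nrm 0 (clist c (freqs N)) by rewrite lerD2l lerN2.
have h0 : 0 < 1 - r by rewrite subr_gt0.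
rewrite lef_pV2 ?posrE ?exprn_gt0 ?(lt_le_trans h0 h1)//.
by rewrite lerXn2r ?nnegrE ?(ltW h0) ?(ltW (lt_le_trans h0 h1)).
Qed.

(** [nrm4_Flist] holds for every truncation and passes to the limit over each finite set of
    frequencies. In this way the flux inherits the fourth moment of [c]. *)
Lemma bsum_cube4 M : bsum (fun k => nk k ^+ 4) c M ->
  bsum (fun k => nk k ^+ 4) (fcoef (cube c)) ((6 - delta_rate r) * M).
Proof.
move=> cM n; apply: (@amp_cvg_sum_le \oo _ (freqs n) (fun k => nk k ^+ 4)
  (fun N => lcoef (Flist N.+2 (clist c (freqs N))))) => [k|k|].
- by rewrite exprn_ge0 ?normk_ge0.
- exact: cvg_fcoef_cube.
-
apply: nearW => N; apply: le_trans (lcoef_bsum _ _ _) _.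
have h : nrm 0 (clist c (freqs N)) <= r by apply: nrm_clist_le; exact: bsum1_expr0.
apply: le_trans (nrm4_Flist _ h r1) _; apply: ler_wpM2l; last exact: nrm_clist_le.
have r01 : 0 <= r < 1 by rewrite r0.
by have := delta_rate0_le r01; lra.
Qed.

End fixed_coefficients.

Lemma fcoef_fser c : summable_coef c -> csym c -> forall k, fcoef (fser c) k = c k.
Proof.
move=> [M cM] cs k; have sc : summable_coef c by exists M.
have [h1 h2] := @cvg_fcoef _ _ (ptrig c) (fser c) M k (measurable_ptrig c)
  (fun n x => ptrig_le n x cM) (fun x => @fser_cvg _ _ c x sc).
have E : \forall n \near \oo, fcoef (ptrig c n) k = c k.
  near=> n; have -> : ptrig c n = ev (clist c (freqs n)) by apply/funext => x; rewrite ev_clist.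
  rewrite fcoef_ev lcoef_clist ?uniq_freqs// mem_freqs; near: n; exact: nbhs_infty_gt.
rewrite [LHS]surjective_pairing [RHS]surjective_pairing; congr (_, _).
  by apply: (cvg_unique _ h1) => //; apply: cvg_near_cst; apply: filterS E => n <-.
by apply: (cvg_unique _ h2) => //; apply: cvg_near_cst; apply: filterS E => n <-.
Unshelve. all: by end_near. Qed.

Definition csum c : R := limn (fun n => \sum_(k <- freqs n) amp (c k)).

Lemma csum_ge c n : summable_coef c -> \sum_(k <- freqs n) amp (c k) <= csum c.
Proof.
move=> sc; apply: nondecreasing_cvgn_le; last exact: cvg_amp_sum.
by apply: sum_freqs_mono => k; exact: amp_ge0.
Qed.

Lemma large_freq (e : R) : 0 < e -> exists n, forall k, k \notin freqs n -> 1 <= e * nk k ^+ 4.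
Proof.
move=> e0; pose L := (Num.truncn e^-1).+1.
have L1 : 1 <= e * L%:R.
  by rewrite -ler_pdivrMl// mulr1 ltW// truncnS_gt.
(* The exceptional vectors have all entries between -L and L; they are listed by functions into
   ['I_(L + L).+1], shifted by L. *)
pose K : seq freq := [seq \row_i ((f i : nat)%:Z - L%:Z) | f : {ffun 'I_d -> 'I_(L + L).+1}].
have [n Kn] := sub_freqs K; exists n => k; apply: contraNle => kL; apply: Kn.
have kb i : (- L%:Z <= k ord0 i <= L%:Z)%R.
  rewrite -ler_norml -(ler_int R) intr_norm; apply: le_trans (normk_int k i) _.
  rewrite leNgt; apply/negP => Lk.
  have L0 : 1 <= L%:R :> R by rewrite ler1n.
  suff : 1 <= e * nk k ^+ 4 by rewrite leNgt kL.
  apply: le_trans L1 _; rewrite ler_wpM2l ?(ltW e0)//.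
  apply: le_trans (ltW Lk) _; rewrite -[leLHS]expr1; apply: ler_weXn2l => //.
  exact: le_trans L0 (ltW Lk).
apply/mapP; exists [ffun i => inord (absz (k ord0 i + L%:Z))]; first by rewrite mem_enum.
apply/rowP => i; rewrite mxE ffunE inordK.
  by have := kb i; move: (k ord0 i) => z; lia.
by have := kb i; move: (k ord0 i) => z; lia.
Qed.

(* frequencies outside [freqs n] are absorbed by the fourth moment, at a rate independent of [s] *)
Lemma ev_fser_dist s c n (lam : R) x : summable_coef c -> (forall k, k \notin freqs n -> 1 <= lam * nk k ^+ 4) ->
  0 <= lam ->
  `|ev s x - fser c x| <= \sum_(k <- freqs n) amp (lcoef s k - c k) + lam * nrm 4 s +
    (csum c - \sum_(k <- freqs n) amp (c k)).
Proof.
move=> sc lamP lam0; rewrite ev_fser -fserB//; last exact: lcoef_summable_coef.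
apply: fser_le => m; under eq_bigr do rewrite mul1r.
pose m' := maxn m n; apply: (@le_trans _ _ (\sum_(k <- freqs m') amp (lcoef s k - c k))).
  by apply: sum_freqs_mono; [move=> k; exact: amp_ge0|exact: leq_maxl].
have E (F : freq -> R) : \sum_(k <- freqs m') F k =
    \sum_(k <- freqs n) F k + \sum_(k <- freqs m' | k \notin freqs n) F k.
  rewrite (bigID (fun k => k \in freqs n))/=; congr (_ + _).
  rewrite -big_filter; apply: perm_big; apply: uniq_perm; rewrite ?filter_uniq ?uniq_freqs// => k.
  rewrite mem_filter !mem_freqs; case: (ltnP (pickle k) n) => //= kn.
  by rewrite (leq_trans kn)// leq_maxr.
rewrite E -!addrA lerD2l.
apply: (@le_trans _ _ (\sum_(k <- freqs m' | k \notin freqs n) (lam * (nk k ^+ 4 * amp (lcoef s k)) + amp (c k)))).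
  apply: ler_sum => k kn; apply: le_trans (ampB _ _) _; rewrite lerD2r mulrA.
  by rewrite ler_peMl ?amp_ge0// lamP.
rewrite big_split/= lerD//.
  rewrite -mulr_sumr ler_wpM2l//; apply: le_trans (lcoef_bsum 4 s m').
  rewrite [leRHS](bigID (fun k => k \notin freqs n))/= lerDl.
  by apply: sumr_ge0 => k _; rewrite mulr_ge0 ?amp_ge0 ?exprn_ge0 ?normk_ge0.
by rewrite lerBrDl -E csum_ge.
Qed.

End nemytskii.

(** * Step functions in time *)

Section step_functions.
Context {R : realType} {d : nat}.
Local Notation tau N := (@euler_dt R d N).
Local Notation np N := (@time_steps R d N).

Lemma measurable_time_steps N (h : nat -> R) : measurable_fun setT (fun t : R => h (np N t)).
Proof.
apply: (measurable_countable_fun (E := np N)) => n.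
have mn : measurable_fun setT (fun t : R => (np N t)%:R : R).
  by apply: nondecreasing_measurable => // s t st; rewrite ler_nat time_steps_mono.
rewrite (_ : [set _ | _] = (fun t : R => (np N t)%:R : R) @^-1` [set n%:R]).
  by rewrite -[X in measurable X]setTI; exact: mn.
by apply/seteqP; split => t /= => [->//|/eqP]; rewrite eqr_nat => /eqP.
Qed.

(** The interval is cut into [np N t] complete steps and a last incomplete one. The sums produced by
    the scheme can then be read as time integrals. *)
Lemma step_integral N (h : nat -> R) (t : R) : 0 <= t ->
  \int[interval_measure 0 t]_s h (np N s) =
  tau N * \sum_(i < np N t) h i + (t - (np N t)%:R * tau N) * h (np N t).
Proof.
move=> t0; have tau0 := @euler_dt_gt0 R d N.
pose n := np N t; pose I (i : nat) : set R := `[i%:R * tau N, i%:R * tau N + tau N[%classic.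
have InP s i : 0 <= s -> I i s <-> np N s = i.
  move=> s0; rewrite /I /= in_itv/=; have := @time_steps_le R d N s s0 => /andP[h1 h2].
  split=> [/andP[i1 i2]|<-]; last by rewrite h1 h2.
  apply/eqP; rewrite eqn_leq -ltnS -[X in _ && X]ltnS.
  have l1 : (np N s)%:R < i.+1%:R :> R.
    by rewrite -(ltr_pM2r tau0) (le_lt_trans h1)// -natr1 mulrDl mul1r.
  have l2 : i%:R < (np N s).+1%:R :> R.
    by rewrite -(ltr_pM2r tau0) (le_lt_trans i1)// -natr1 mulrDl mul1r.
  by rewrite -(ltr_nat R) l1 -(ltr_nat R) l2.
have mI i : measurable (I i) by exact: measurable_itv.
have /andP[n1 n2] := @time_steps_le R d N t t0.
transitivity (\int[interval_measure 0 t]_s \sum_(i < n.+1) (h i * \1_(I i) s)).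
  apply: eq_Rintegral_interval; first exact: measurable_time_steps.
    by apply: measurable_sum => i; apply: measurable_funM => //; exact: measurable_indic.
  move=> s /andP[s0 st]; have sn : (np N s < n.+1)%N by rewrite ltnS time_steps_mono.
  rewrite (bigD1 (Ordinal sn))//= big1 ?addr0.
    by rewrite indicE mem_set ?mulr1//; exact/InP.
  move=> i ine; rewrite indicE memNset ?mulr0// => /InP => /(_ s0) E.
  by move: ine; rewrite -val_eqE /= E eqxx.
rewrite Rintegral_sum; last first.
  move=> i; apply: (@integrable_bounded _ _ _ _ _ `|h i|).
    by apply: measurable_funM => //; exact: measurable_indic.
  move=> s; rewrite normrM indicE; case: (_ \in _); rewrite ?normr1 ?mulr1 ?normr0 ?mulr0//.
have E (i : nat) : \int[interval_measure 0 t]_s (h i * \1_(I i) s) =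
    h i * fine (interval_measure 0 t (I i)).
  rewrite RintegralZl//; last first.
    apply: (@integrable_bounded _ _ _ _ _ 1); first exact: measurable_indic.
    by move=> s; rewrite indicE; case: (_ \in _); rewrite ?normr1 ?normr0.
  by rewrite /Rintegral integral_indic// setIT.
under eq_bigr do rewrite E.
rewrite big_ord_recr/= -/n; congr (_ + _); first rewrite mulr_sumr.
  apply: eq_bigr => i _; rewrite mulrC; congr (_ * _); rewrite /interval_measure.
  have -> : I i `&` `[0, t] = I i.
    apply/setIidPl => s; rewrite /I /= 2!in_itv/= => /andP[s1 s2]; apply/andP; split.
      by apply: (le_trans _ s1); rewrite mulr_ge0 ?(ltW tau0).
    apply: le_trans (ltW s2) _; apply: le_trans n1; rewrite -[X in _ + X]mul1r -mulrDl.
    by rewrite ler_wpM2r ?(ltW tau0)// natr1 ler_nat.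
  by rewrite /I (@lebesgue_measure_itv R `[_, _[)/= lte_fin ltrDl tau0 -EFinB/= addrC addKr.
rewrite mulrC; congr (_ * _); rewrite /interval_measure.
have -> : I n `&` `[0, t] = `[n%:R * tau N, t]%classic.
  apply/seteqP; split => s; rewrite /I /= 3!in_itv/=.
    by move=> [/andP[-> _] /andP[_ ->]].
  move=> /andP[s1 s2].
  by rewrite s1 s2 (le_lt_trans s2 n2) (le_trans _ s1)// mulr_ge0 ?(ltW tau0).
rewrite (@lebesgue_measure_itv R `[_, _])/= lte_fin.
case: ltP => // h1; rewrite (@le_anti _ _ t (n%:R * tau N)) ?h1 ?n1// subrr//.
Qed.

Lemma step_integral_le N (h : nat -> R) (M T : R) : 0 <= T -> (forall i, 0 <= h i) ->
  (forall n, tau N * \sum_(i < n) h i <= M) ->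
  \int[interval_measure 0 T]_s h (np N s) <= M.
Proof.
move=> T0 h0 hM; rewrite step_integral//; apply: le_trans (hM (np N T).+1).
rewrite big_ord_recr/= mulrDr lerD2l ler_wpM2r//.
have /andP[_ h2] := @time_steps_le R d N T T0; lra.
Qed.

End step_functions.

Lemma fun_cvg_measurable {disp : measure_display} {T : measurableType disp} {R : realType}
    (f : nat -> T -> R) (g : T -> R) : (forall n, measurable_fun setT (f n)) ->
  (forall x, f ^~ x @ \oo --> g x) -> measurable_fun setT g.
Proof. by move=> mf fg; apply: (@measurable_fun_cvg _ _ _ _ f) => // x _; exact: fg. Qed.

Section time_dependent_series.
Context {R : realType} {d : nat}.
Local Notation point := 'rV[R]_d.
Local Notation freq := 'rV[int]_d.
Local Notation dx := (torus_measure R d).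
Context (c : R -> freq -> R * R).
Hypotheses (mc : forall k, measurable_fun setT (fun t => (c t k).1) /\
                           measurable_fun setT (fun t => (c t k).2)).

Lemma measurable_ptrig2 n : measurable_fun setT (fun z : R * point => ptrig (c z.1) n z.2).
Proof.
apply: measurable_sum => k; have [m1 m2] := mc k.
apply: measurable_funD; apply: measurable_funM.
- exact: (measurableT_comp m1).
- by apply: (measurableT_comp (measurable_cos_dot k)).
- exact: (measurableT_comp m2).
- by apply: (measurableT_comp (measurable_sin_dot k)).
Qed.

Hypothesis sc : forall t, summable_coef (c t).

Lemma measurable_fser2 : measurable_fun setT (fun z : R * point => fser (c z.1) z.2).
Proof.
apply: (@fun_cvg_measurable _ _ _ (fun n (z : R * point) => ptrig (c z.1) n z.2)).
  exact: measurable_ptrig2.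
by move=> z; exact: fser_cvg.
Qed.

Lemma measurable_csum : measurable_fun setT (fun t => csum (c t)).
Proof.
apply: (@fun_cvg_measurable _ _ _ (fun n t => \sum_(k <- freqs n) amp (c t k))).
  by move=> n; apply: measurable_sum => k; have [] := mc k; exact: measurable_amp.
by move=> t; exact: cvg_amp_sum.
Qed.

End time_dependent_series.

(** * Properties of the limit coefficients *)

Section limit.
Context {R : realType} {d : nat}.
Local Notation nk := (@normk R d).
Local Notation point := 'rV[R]_d.
Local Notation freq := 'rV[int]_d.
Local Notation dx := (torus_measure R d).
Context (c0 : freq -> R * R) (r0 : R).
Hypotheses (c0sym : csym c0) (c00 : c0 0 = 0) (c0r : bsum (fun=> 1) c0 r0)
  (r1 : r0 < 1) (delta0 : 0 < delta_rate r0).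
Local Notation delta := (delta_rate r0).
Context (phi : nat -> nat) (c : R -> freq -> R * R).
Hypotheses (phi_ge : forall m, (m <= phi m)%N)
  (cvc : forall t k, amp_cvg \oo (fun m => lcoef (euler_path c0 (phi m) t) k) (c t k))
  (clip : forall s t k, amp (c t k - c s k) <= `|t - s| * (nk k ^+ 4 * (1 - r0) ^- 3)).
Local Notation pa m t := (euler_path c0 (phi m) t).

Let r00 : 0 <= r0. Proof. exact: bsum_ge0 c0r. Qed.

Let r0p : 0 < 1 - r0. Proof. by rewrite subr_gt0. Qed.

Lemma amp_cvg_unique (F : set_system nat) (FF : ProperFilter F) (u : nat -> R * R) l l' :
  amp_cvg F u l -> amp_cvg F u l' -> l = l'.
Proof.
move=> ul ul'; apply/eqP; rewrite -subr_eq0; apply/eqP/amp_eq0/ler_addgt0Pr => e e0.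
by rewrite add0r; exact: (amp_cvg_le FF ul (ul' e e0)).
Qed.

Lemma lim_init t : t <= 0 -> c t = c0.
Proof.
move=> t0; apply/funext => k; apply: amp_cvg_unique (cvc t k) _ => e e0.
near=> m; have km : (pickle k < phi m)%N.
  by apply: leq_trans (phi_ge m); near: m; exact: nbhs_infty_gt.
have km' : (pickle (- k) < phi m)%N.
  by apply: leq_trans (phi_ge m); near: m; exact: nbhs_infty_gt.
have -> : pa m t = pa m 0 by rewrite /euler_path !time_steps_neg.
by rewrite path_init// subrr amp0 ltW.
Unshelve. all: by end_near. Qed.

Lemma lim_sym t : csym (c t).
Proof.
move=> k; apply: amp_cvg_unique (cvc t (- k)) _ => e /(cvc t k); apply: filterS => m.
rewrite lcoef_sym; congr (_ <= _); rewrite /amp /=; congr (Num.sqrt (_ + _)).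
by rewrite -opprD sqrrN.
Qed.

Lemma lim_le (w : freq -> R) t n (M : R) : (forall k, 0 <= w k) ->
  (\forall m \near \oo, \sum_(k <- freqs n) w k * amp (lcoef (pa m t) k) <= M) ->
  \sum_(k <- freqs n) w k * amp (c t k) <= M.
Proof.
move=> w0; apply: (@amp_cvg_sum_le _ _ \oo _ (freqs n) w (fun m => lcoef (pa m t))) => //.
Qed.

Lemma lim_bsum t : bsum (fun=> 1) (c t) r0.
Proof.
move=> n; apply: lim_le => //; apply: nearW => m.
exact: le_trans (bsum_expr0 (lcoef_bsum 0 _) n) (path_nrm c0r r1 delta0 _ _).
Qed.

Lemma lim_summable_coef t : summable_coef (c t).
Proof. by exists r0; exact: lim_bsum. Qed.

Lemma tau_small (e : R) : 0 < e -> \forall m \near \oo, @euler_dt R d (phi m) <= e.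
Proof.
move=> e0; have := near_infty_natSinv_lt (PosNum e0); apply: filterS => m /= /ltW.
apply: le_trans; apply: le_trans (euler_dt_lt _) _.
by rewrite lef_pV2 ?posrE// ler_nat ltnS phi_ge.
Qed.

(** The bound [path_decay] lags by one time step; the step tends to 0 and continuity of the
    exponential removes it. *)
Lemma lim_decay t : 0 <= t -> bsum (fun=> 1) (c t) (r0 * expR (- delta * t)).
Proof.
move=> t0 n; apply/ler_addgt0Pr => e e0.
have cE : {for 0, continuous (fun s : R => r0 * expR (- delta * (t - s)))}.
  apply: (@continuous_mul _ _ (fun=> r0)); first exact: continuous_const.
  move=> s; apply: continuous_comp; last exact: continuous_expR.
  apply: (@continuous_mul _ _ (fun=> - delta)); first exact: continuous_const.
  move=> u; apply: cvgB; [exact: cvg_cst|exact: cvg_id].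
have /cvgrPdist_le/(_ e e0) := cE; rewrite subr0 => /nbhs_ballP[eta /= eta0 h].
apply: lim_le => //; near=> m.
have tm : @euler_dt R d (phi m) <= eta / 2 by near: m; apply: tau_small; rewrite divr_gt0.
apply: le_trans (bsum_expr0 (lcoef_bsum 0 _) n) _.
apply: le_trans (path_decay c0r r1 delta0 (phi m) t0) _.
have : `|r0 * expR (- delta * t) - r0 * expR (- delta * (t - @euler_dt R d (phi m)))| <= e.
  apply: h; rewrite -ball_normE /= sub0r normrN gtr0_norm ?euler_dt_gt0//.
  by rewrite (le_lt_trans tm)// ltr_pdivrMr// ltr_pMr// ltr1n.
by rewrite ler_norml => /andP[h1 _]; lra.
Unshelve. all: by end_near. Qed.

Lemma lim_continuous k : continuous (fun t => (c t k).1) /\ continuous (fun t => (c t k).2).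
Proof.
have L0 : 0 < nk k ^+ 4 * (1 - r0) ^- 3 + 1.
  by rewrite ltr_wpDl// mulr_ge0 ?exprn_ge0 ?normk_ge0// invr_ge0 exprn_ge0// ltW.
have key (F : R * R -> R) : (forall p q, `|F p - F q| <= amp (p - q)) -> continuous (fun t => F (c t k)).
  move=> Fl t; apply/cvgrPdist_le => e e0; have e1 : 0 < e / (nk k ^+ 4 * (1 - r0) ^- 3 + 1) by rewrite divr_gt0.
  exists (e / (nk k ^+ 4 * (1 - r0) ^- 3 + 1)) => // s /= st.
  apply: le_trans (Fl _ _) _; apply: le_trans (clip _ _ _) _.
  move: st; rewrite ltr_pdivlMr// => /ltW; apply: le_trans.
  by rewrite ler_wpM2l// lerDl.
split; apply: key => p q; first exact: norm_fst_le_amp (p - q).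
exact: norm_snd_le_amp (p - q).
Qed.

Lemma lim_measurable k : measurable_fun setT (fun t => (c t k).1) /\
  measurable_fun setT (fun t => (c t k).2).
Proof. by have [h1 h2] := lim_continuous k; split; exact: continuous_measurable_fun. Qed.

Lemma measurable_path (F : seq (@term R d) -> R) m : measurable_fun setT (fun t => F (pa m t)).
Proof. exact: (measurable_time_steps (phi m) (fun n => F (euler c0 (phi m) n))). Qed.

Lemma path_moment m T : 0 <= T -> \int[interval_measure 0 T]_t nrm 4 (pa m t) <= r0 / delta.
Proof.
move=> T0; apply: (step_integral_le T0 (h := fun n => nrm 4 (euler c0 (phi m) n))).
  by move=> i; exact: nrm_ge0.
by move=> n; exact: euler_sum4.
Qed.

Lemma path_nrm4_integrable m T : (interval_measure 0 T).-integrable setT (EFin \o (fun t => nrm 4 (pa m t))).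
Proof.
apply: (@integrable_interval _ _ _ _ (\sum_(i < (@time_steps R d (phi m) T).+1) nrm 4 (euler c0 (phi m) i))).
  exact: (measurable_path (nrm 4)).
move=> t /andP[_ tT]; rewrite ger0_norm ?nrm_ge0//.
have tn : (@time_steps R d (phi m) t < (@time_steps R d (phi m) T).+1)%N by rewrite ltnS time_steps_mono.
rewrite (bigD1 (Ordinal tn))//= lerDl sumr_ge0// => i _; exact: nrm_ge0.
Qed.

(** For finitely many frequencies the integrands are bounded uniformly in [m], so bounded
    convergence suffices; the full sum is recovered afterwards by monotone convergence. *)
Lemma lim_moment n T : 0 <= T ->
  \int[interval_measure 0 T]_t (\sum_(k <- freqs n) nk k ^+ 4 * amp (c t k)) <= r0 / delta.
Proof.
move=> T0; have w0 k : 0 <= nk k ^+ 4 by rewrite exprn_ge0 ?normk_ge0.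
apply: (@cvg_le_all _ (fun m => \int[interval_measure 0 T]_t
    (\sum_(k <- freqs n) nk k ^+ 4 * amp (lcoef (pa m t) k)))).
  apply: (@Rbounded_cvg _ _ _ _ _ _ (\sum_(k <- freqs n) nk k ^+ 4 * r0)).
  - by move=> m; exact: (measurable_path (fun s => \sum_(k <- freqs n) nk k ^+ 4 * amp (lcoef s k))).
  - move=> m t; rewrite ger0_norm; last by apply: sumr_ge0 => k _; rewrite mulr_ge0 ?amp_ge0.
    by apply: ler_sum => k _; rewrite ler_wpM2l// path_amp.
  - by move=> t; apply: cvg_sumr => k; apply: cvgMl_tmp; exact: amp_cvg_amp.
move=> m; apply: le_trans (path_moment m T0); apply: le_Rintegral => //.
- apply: (@integrable_bounded _ _ _ _ _ (\sum_(k <- freqs n) nk k ^+ 4 * r0)).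
    exact: (measurable_path (fun s => \sum_(k <- freqs n) nk k ^+ 4 * amp (lcoef s k))).
  move=> t; rewrite ger0_norm; last by apply: sumr_ge0 => k _; rewrite mulr_ge0 ?amp_ge0.
  by apply: ler_sum => k _; rewrite ler_wpM2l// path_amp.
- exact: path_nrm4_integrable.
- by move=> t _; exact: lcoef_bsum.
Qed.

Definition flux (t : R) : freq -> R * R := fcoef (cube (c t)).

Lemma measurable_flux k : measurable_fun setT (fun t => (flux t k).1) /\
  measurable_fun setT (fun t => (flux t k).2).
Proof.
have mF : measurable_fun setT (fun z : R * point => cube (c z.1) z.2).
  apply: measurable_inv_cube; first exact: (measurable_fser2 lim_measurable lim_summable_coef).
  by move=> z; rewrite (le_trans (fser_le z.2 (lim_bsum z.1)))// ltW.
have key (g : point -> R) : measurable_fun setT g -> (forall x, `|g x| <= 1) ->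
    measurable_fun setT (fun t => (2 * pi) ^- d * \int[dx]_x (cube (c t) x * g x)).
  move=> mg g1; apply: measurable_funM => //.
  apply: (@measurable_Rfubini _ _ _ _ _ (interval_measure 0 1) dx (fun z => cube (c z.1) z.2 * g z.2)).
  apply: (@integrable_bounded_prod _ _ _ _ _ _ _ _ ((1 - r0) ^- 3 * 1)).
    by apply: measurable_funM => //; exact: (measurableT_comp mg).
  move=> z; rewrite normrM; apply: ler_pM => //; exact: (cube_bound (lim_bsum _) r1).
split; apply: key.
- exact: measurable_cos_dot.
- by move=> x; exact: norm_cos_le1.
- exact: measurable_sin_dot.
- by move=> x; exact: norm_sin_le1.
Qed.

Lemma flux_amp t k : amp (flux t k) <= (1 - r0) ^- 3.
Proof. exact: bsum_amp (bsum_cube0 (lim_bsum t) r1). Qed.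

Definition list_flux m t : freq -> R * R := lcoef (Flist (phi m).+2 (pa m t)).

Lemma list_flux_amp m t k : amp (list_flux m t k) <= (1 - r0) ^- 3.
Proof. exact: euler_Flist. Qed.

(** Two errors: truncation of the power series at the argument [ev (pa m t)], and replacement of
    this argument by its limit, which costs the Lipschitz constant 3 (1 - r0)^-4 times the uniform
    distance of [ev_fser_dist]. The factor 2 is that of [fcoef_dist]. *)
Lemma list_flux_dist m t k n (lam : R) : (forall k, k \notin freqs n -> 1 <= lam * nk k ^+ 4) -> 0 <= lam ->
  amp (list_flux m t k - flux t k) <= 2 * ((1 - r0) ^- 3 * (4 * ('C((phi m).+2 + 2, 2)%:R * r0 ^+ (phi m).+2)) +
   3 * (1 - r0) ^- 4 * (\sum_(k <- freqs n) amp (lcoef (pa m t) k - c t k) + lam * nrm 4 (pa m t) +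
    (csum (c t) - \sum_(k <- freqs n) amp (c t k)))).
Proof.
move=> lamP lam0; rewrite /list_flux -fcoef_ev /flux.
have evr x : `|ev (pa m t) x| <= r0.
  exact: le_trans (ev_le_nrm _ _) (path_nrm c0r r1 delta0 _ _).
apply: (@fcoef_dist _ _ _ _ _ _ ((1 - r0) ^- 3)).
- exact: measurable_ev.
- exact: measurable_cube (lim_bsum t) r1.
- move=> x; apply: le_trans (ev_le_nrm _ _) _.
  have h := path_nrm c0r r1 delta0 (phi m) t.
  apply: le_trans (nrm0_Flist _ (le_lt_trans h r1)) _.
  have h1 : 1 - r0 <= 1 - nrm 0 (pa m t) by rewrite lerD2l lerN2.
  rewrite lef_pV2 ?posrE ?exprn_gt0 ?(lt_le_trans r0p h1)//.
  by rewrite lerXn2r ?nnegrE ?(ltW r0p) ?(ltW (lt_le_trans r0p h1)).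
- move=> x; exact: cube_bound (lim_bsum t) r1 x.
move=> x; rewrite ev_Flist.
have -> : fpoly (phi m).+2 (ev (pa m t) x) - cube (c t) x =
  (fpoly (phi m).+2 (ev (pa m t) x) - (1 + ev (pa m t) x) ^- 3) +
  ((1 + ev (pa m t) x) ^- 3 - (1 + fser (c t) x) ^- 3) by rewrite /cube addrA subrK.
apply: le_trans (ler_normD _ _) _; apply: lerD.
  by apply: fpoly_dist => //; rewrite r00.
apply: le_trans (cube_lip r1 (evr x) (fser_le x (lim_bsum t))) _.
apply: ler_wpM2l; first by rewrite mulr_ge0// invr_ge0 exprn_ge0// ltW.
by apply: ev_fser_dist => //; exact: lim_summable_coef.
Qed.

(** The convergence is in L^1 in time because the term [lam * nrm 4 (pa m t)] is controlled only
    through its integral, by [path_moment]. *)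
Lemma list_flux_cvg k T : 0 <= T ->
  (fun m => \int[interval_measure 0 T]_t amp (list_flux m t k - flux t k)) @ \oo --> (0 : R).
Proof.
move=> T0; pose L := 3 * (1 - r0) ^- 4 : R.
have L0 : 0 <= L by rewrite mulr_ge0// invr_ge0 exprn_ge0// ltW.
pose eps m := (1 - r0) ^- 3 * (4 * ('C((phi m).+2 + 2, 2)%:R * r0 ^+ (phi m).+2)) : R.
pose g n m t := \sum_(k <- freqs n) amp (lcoef (pa m t) k - c t k).
pose tl n t := csum (c t) - \sum_(k <- freqs n) amp (c t k).
have mg n m : measurable_fun setT (g n m).
  apply: measurable_sum => l; have [m1 m2] := lim_measurable l; apply: measurable_amp.
    by apply: measurable_funB => //; exact: (measurable_path (fun s => (lcoef s l).1)).
  by apply: measurable_funB => //; exact: (measurable_path (fun s => (lcoef s l).2)).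
have gB n m t : `|g n m t| <= \sum_(k <- freqs n : seq freq) (r0 + r0).
  rewrite ger0_norm; last by apply: sumr_ge0 => l _; exact: amp_ge0.
  rewrite /g; apply: ler_sum => l _; apply: le_trans (ampB _ _) _; apply: lerD; first exact: path_amp.
  have := bsum1 (lim_bsum t) => /(sum_uniq_le_freqs (K := [:: l]) isT (fun k => amp_ge0 _)).
  by rewrite big_seq1.
have mtl n : measurable_fun setT (tl n).
  apply: measurable_funB; first exact: (measurable_csum lim_measurable lim_summable_coef).
  by apply: measurable_sum => l; have [] := lim_measurable l; exact: measurable_amp.
have csr t : csum (c t) <= r0.
  apply: limr_le; first exact: (cvg_amp_sum (lim_summable_coef t)).
  by apply: nearW => n; exact: bsum1 (lim_bsum t) n.
have tlB n t : `|tl n t| <= r0.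
  rewrite ger0_norm; last by rewrite subr_ge0 csum_ge//; exact: lim_summable_coef.
  rewrite /tl; have h : 0 <= \sum_(k <- freqs n) amp (c t k) by apply: sumr_ge0 => l _; exact: amp_ge0.
  by have := csr t; lra.
have ig n m : (interval_measure 0 T).-integrable setT (EFin \o g n m).
  exact: (integrable_bounded _ (mg n m) (gB n m)).
have itl n : (interval_measure 0 T).-integrable setT (EFin \o tl n).
  exact: (integrable_bounded _ (mtl n) (tlB n)).
have cg n : (fun m => \int[interval_measure 0 T]_t g n m t) @ \oo --> (0 : R).
  rewrite [X in _ --> X](_ : 0 = \int[interval_measure 0 T]_t ((fun=> 0) t : R)); last first.
    by rewrite Rintegral_cstT mul0r.
  apply: (@Rbounded_cvg _ _ _ _ (g n) (fun=> 0) _ (mg n) (gB n)) => t.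
  rewrite [X in _ --> X](_ : 0 = \sum_(k <- freqs n : seq freq) (0 : R)); last by rewrite big1.
  apply: cvg_sumr => l; apply/cvgrPdist_le => e /(cvc t l); apply: filterS => m.
  by rewrite sub0r normrN ger0_norm// amp_ge0.
have ctl : (fun n => \int[interval_measure 0 T]_t tl n t) @ \oo --> (0 : R).
  rewrite [X in _ --> X](_ : 0 = \int[interval_measure 0 T]_t ((fun=> 0) t : R)); last first.
    by rewrite Rintegral_cstT mul0r.
  apply: (@Rbounded_cvg _ _ _ _ tl (fun=> 0) _ mtl tlB) => t.
  rewrite -(subrr (csum (c t))); apply: cvgB; [exact: cvg_cst|exact: (cvg_amp_sum (lim_summable_coef t))].
have ceps : eps @ \oo --> (0 : R).
  have r01 : 0 <= r0 < 1 by rewrite r00.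
  rewrite /eps -[X in _ --> X](mulr0 ((1 - r0) ^- 3)); apply: cvgMl_tmp.
  rewrite -[X in _ --> X](mulr0 4); apply: cvgMl_tmp.
  apply/cvgrPdist_le => e e0; have /cvgrPdist_le/(_ e e0) := cvg_binomial_geometric r01.
  move=> [n0 _ h]; exists n0 => // m /= nm; apply: h => /=.
  by rewrite !leqW// (leq_trans nm).
have mQP m : measurable_fun setT (fun t => amp (list_flux m t k - flux t k)).
  have [m1 m2] := measurable_flux k; apply: measurable_amp; apply: measurable_funB => //.
    exact: (measurable_path (fun s => (lcoef (Flist (phi m).+2 s) k).1)).
  exact: (measurable_path (fun s => (lcoef (Flist (phi m).+2 s) k).2)).
have QPB m t : `|amp (list_flux m t k - flux t k)| <= (1 - r0) ^- 3 + (1 - r0) ^- 3.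
  rewrite ger0_norm ?amp_ge0// (le_trans (ampB _ _))// lerD//; [exact: list_flux_amp|exact: flux_amp].
apply/cvgrPdist_le => e e0.
pose rd := r0 / delta; have rd0 : 0 <= rd by rewrite divr_ge0// ltW.
(* Parameters are fixed in the order [lam], [n], [m]. There are four error terms, each carrying a
   factor 2, hence 8; the summands 1 avoid division by zero. *)
pose lam := e / (8 * (L + 1) * (rd + 1)).
have lam0 : 0 < lam by rewrite divr_gt0// !mulr_gt0// ltr_wpDl.
have [n1 n1P] := @large_freq R d lam lam0.
have e8 : 0 < e / (8 * (L + 1)) by rewrite divr_gt0// mulr_gt0// ltr_wpDl.
have eT : 0 < e / (8 * (T + 1)) by rewrite divr_gt0// mulr_gt0// ltr_wpDl.
have [n2 _ n2P] : \forall n \near \oo, `|0 - \int[interval_measure 0 T]_t tl n t| <= e / (8 * (L + 1)).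
  by move/cvgrPdist_le : ctl; exact.
pose n := maxn n1 n2.
have nP l : l \notin freqs n -> 1 <= lam * nk l ^+ 4.
  move=> ln; apply: n1P; apply: contraNN ln; rewrite !mem_freqs => /leq_trans; apply.
  exact: leq_maxl.
near=> m.
have h1 : `|0 - \int[interval_measure 0 T]_t g n m t| <= e / (8 * (L + 1)).
  by near: m; move/cvgrPdist_le : (cg n); exact.
have h2 : `|0 - eps m| <= e / (8 * (T + 1)).
  by near: m; move/cvgrPdist_le : ceps; exact.
have h3 : `|0 - \int[interval_measure 0 T]_t tl n t| <= e / (8 * (L + 1)).
  by apply: n2P; exact: leq_maxr.
have i4 := path_nrm4_integrable m T.
have h4 := path_moment m T0.
rewrite sub0r normrN ger0_norm; last by apply: Rintegral_ge0 => t _; exact: amp_ge0.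
apply: (@le_trans _ _ (\int[interval_measure 0 T]_t (2 * eps m + 2 * L * (g n m t + lam * nrm 4 (pa m t) + tl n t)))).
  apply: le_Rintegral => //.
  - exact: (integrable_bounded _ (mQP m) (QPB m)).
  - apply: integrableRD; first exact: (@integrable_bounded _ _ _ _ _ `|2 * eps m|).
    apply: integrableRZ; apply: integrableRD => //; apply: integrableRD => //.
    exact: integrableRZ.
  - move=> t _; rewrite -mulrA -mulrDr.
    exact: (@list_flux_dist m t k n lam nP (ltW lam0)).
rewrite RintegralD//; [|by apply: (@integrable_bounded _ _ _ _ _ `|2 * eps m|)|]; last first.
  by apply: integrableRZ; do 2 apply: integrableRD => //; exact: integrableRZ.
rewrite interval_cst// RintegralZl//; last first.
  by do 2 apply: integrableRD => //; exact: integrableRZ.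
rewrite RintegralD//; last by apply: integrableRD => //; exact: integrableRZ.
rewrite RintegralD//; last exact: integrableRZ.
rewrite RintegralZl//.
have {}h1 : \int[interval_measure 0 T]_t g n m t <= e / (8 * (L + 1)).
  by apply: le_trans h1; rewrite sub0r normrN ler_norm.
have {}h2 : eps m <= e / (8 * (T + 1)) by apply: le_trans h2; rewrite sub0r normrN ler_norm.
have {}h3 : \int[interval_measure 0 T]_t tl n t <= e / (8 * (L + 1)).
  by apply: le_trans h3; rewrite sub0r normrN ler_norm.
have {}h4 : lam * \int[interval_measure 0 T]_t nrm 4 (pa m t) <= e / (8 * (L + 1)).
  apply: le_trans (ler_wpM2l (ltW lam0) h4) _; rewrite -/rd /lam.
  have -> : e / (8 * (L + 1) * (rd + 1)) * rd = e / (8 * (L + 1)) * (rd / (rd + 1)).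
    by field; rewrite !gt_eqF// ltr_wpDl.
  apply: ler_piMr; first exact: ltW.
  by rewrite ler_pdivrMr ?ltr_wpDl// mul1r lerDl.
have E1 : L * (e / (8 * (L + 1))) <= e / 8.
  rewrite mulrA ler_pdivrMr ?mulr_gt0 ?ltr_wpDl//.
  have -> : e / 8 * (8 * (L + 1)) = L * e + e by field.
  by rewrite lerDl ltW.
have E2 : T * (e / (8 * (T + 1))) <= e / 8.
  rewrite mulrA ler_pdivrMr ?mulr_gt0 ?ltr_wpDl//.
  have -> : e / 8 * (8 * (T + 1)) = T * e + e by field.
  by rewrite lerDl ltW.
have := ler_wpM2l L0 (lerD (lerD h1 h4) h3); have := ler_wpM2l T0 h2.
move: E1 E2 {h1 h2 h3 h4}; move: (e / (8 * (L + 1))) (e / (8 * (T + 1))) => a b E1 E2.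
move: (_ + _ + _) (eps m) => S u hu hS; nra.
Unshelve. all: by end_near. Qed.

(* [F] is one of the two coordinates *)
Lemma lim_equation_coord (F : R * R -> R) k t : 0 <= t ->
  (forall p q, F (p + q) = F p + F q) -> (forall a p, F (smul a p) = a * F p) ->
  (forall p, `|F p| <= amp p) ->
  measurable_fun setT (fun s => F (flux s k)) ->
  F (c t k) = F (c0 k) + nk k ^+ 4 * \int[interval_measure 0 t]_s F (flux s k).
Proof.
move=> t0 FD FZ Fh mF.
have FB p q : F (p - q) = F p - F q.
  have -> : p - q = p + smul (-1) q by rewrite /smul !mulN1r; case: q.
  by rewrite FD FZ mulN1r.
pose w := nk k ^+ 4; have w0 : 0 <= w by rewrite exprn_ge0 ?normk_ge0.
pose B := (1 - r0) ^- 3.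
have B0 : 0 <= B by rewrite invr_ge0 exprn_ge0// ltW.
have c1 : (fun m => F (lcoef (pa m t) k)) @ \oo --> F (c t k).
  apply/cvgrPdist_le => e /(cvc t k); apply: filterS => m; rewrite ampC -FB.
  by apply: le_trans.
have c2 : (fun m => F (lcoef (pa m t) k)) @ \oo --> F (c0 k) + w * \int[interval_measure 0 t]_s F (flux s k).
  apply/cvgrPdist_le => e e0.
  have e1 : 0 < e / 2 / (w * B + 1) by rewrite !divr_gt0// ltr_wpDl// mulr_ge0.
  have e2 : 0 < e / 2 / (w + 1) by rewrite !divr_gt0// ltr_wpDl.
  near=> m.
  have km : (pickle k < phi m)%N.
    by apply: leq_trans (phi_ge m); near: m; exact: nbhs_infty_gt.
  have km' : (pickle (- k) < phi m)%N.
    by apply: leq_trans (phi_ge m); near: m; exact: nbhs_infty_gt.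
  have h1 : @euler_dt R d (phi m) <= e / 2 / (w * B + 1) by near: m; exact: tau_small.
  have h2 : `|0 - \int[interval_measure 0 t]_s amp (list_flux m s k - flux s k)| <= e / 2 / (w + 1).
    by near: m; move/cvgrPdist_le : (list_flux_cvg k t0); exact.
  pose n := @time_steps R d (phi m) t.
  pose q i := F (lcoef (Flist (phi m).+2 (euler c0 (phi m) i)) k).
  have S j : F (lcoef (euler c0 (phi m) j) k) = F (c0 k) + w * (@euler_dt R d (phi m) * \sum_(i < j) q i).
    elim: j => [|j IH].
      by rewrite big_ord0 !mulr0 addr0 -(path_init c0sym c00 km km') /euler_path time_steps_neg.
    by rewrite euler_step// FD FZ IH big_ord_recr /= -/(q j) -/w; ring.
  have mq : measurable_fun setT (fun s => F (list_flux m s k)).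
    exact: (measurable_path (fun s => F (lcoef (Flist (phi m).+2 s) k))).
  have Q0 i : `|q i| <= B by apply: le_trans (Fh _) _; exact: euler_Flist.
  (* The sum over the steps is the time integral of the discrete flux up to the last incomplete
     step, which [J] bounds below. *)
  have I1 : \int[interval_measure 0 t]_s F (list_flux m s k) =
      @euler_dt R d (phi m) * \sum_(i < n) q i + (t - n%:R * @euler_dt R d (phi m)) * q n.
    exact: (step_integral (phi m) q t0).
  have iQ : (interval_measure 0 t).-integrable setT (EFin \o (fun s => F (list_flux m s k))).
    apply: (@integrable_bounded _ _ _ _ _ B) => // s; apply: le_trans (Fh _) _; exact: list_flux_amp.
  have iP : (interval_measure 0 t).-integrable setT (EFin \o (fun s => F (flux s k))).
    apply: (@integrable_bounded _ _ _ _ _ B) => // s; apply: le_trans (Fh _) _; exact: flux_amp.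
  have I2 : `|\int[interval_measure 0 t]_s F (list_flux m s k) - \int[interval_measure 0 t]_s F (flux s k)| <=
      e / 2 / (w + 1).
    rewrite -RintegralB//; apply: le_trans h2; rewrite sub0r normrN.
    apply: le_trans (ler_norm _); apply: le_Rintegral_norm.
    - have := integrableRD iQ (integrableRZ (-1) iP).
      by under eq_fun do rewrite mulN1r.
    - have [m1 m2] := measurable_flux k.
      apply: (@integrable_bounded _ _ _ _ _ (B + B)).
        apply: measurable_amp; apply: measurable_funB => //.
          exact: (measurable_path (fun s => (lcoef (Flist (phi m).+2 s) k).1)).
        exact: (measurable_path (fun s => (lcoef (Flist (phi m).+2 s) k).2)).
      move=> s; rewrite ger0_norm ?amp_ge0// (le_trans (ampB _ _))// lerD//; [exact: list_flux_amp|exact: flux_amp].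
    - by move=> s; rewrite -FB; exact: Fh.
  rewrite /euler_path S -/n.
  have -> : F (c0 k) + w * \int[interval_measure 0 t]_s F (flux s k) -
      (F (c0 k) + w * (@euler_dt R d (phi m) * \sum_(i < n) q i)) =
    w * ((t - n%:R * @euler_dt R d (phi m)) * q n -
      (\int[interval_measure 0 t]_s F (list_flux m s k) - \int[interval_measure 0 t]_s F (flux s k))).
    by rewrite I1; ring.
  rewrite normrM ger0_norm//.
  have J : `|(t - n%:R * @euler_dt R d (phi m)) * q n| <= @euler_dt R d (phi m) * B.
    have /andP[n1 n2] := @time_steps_le R d (phi m) t t0.
    rewrite normrM; apply: ler_pM => //; rewrite ger0_norm ?subr_ge0//.
    by rewrite lerBlDl ltW.
  apply: le_trans (ler_wpM2l w0 (le_trans (ler_normB _ _) (lerD J I2))) _.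
  have w1 : 0 < w + 1 by rewrite ltr_wpDl.
  have B1 : 0 < w * B + 1 by rewrite ltr_wpDl// mulr_ge0.
  have x1 : e / 2 / (w + 1) * (w + 1) = e / 2 by rewrite divfK// gt_eqF.
  move: h1 (@euler_dt_gt0 R d (phi m)); rewrite ler_pdivlMr// => h1 t1; nra.
exact: (cvg_unique _ c1 c2).
Unshelve. all: by end_near. Qed.

Lemma lim_equation k t : 0 <= t -> c t k = c0 k + smul (nk k ^+ 4)
  (\int[interval_measure 0 t]_s (flux s k).1, \int[interval_measure 0 t]_s (flux s k).2).
Proof.
move=> t0; have [m1 m2] := measurable_flux k.
rewrite [LHS]surjective_pairing [RHS]surjective_pairing; congr (_, _).
  by apply: (lim_equation_coord (F := fst)) => // p; exact: norm_fst_le_amp.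
by apply: (lim_equation_coord (F := snd)) => // p; exact: norm_snd_le_amp.
Qed.

End limit.

(** Differentiability is demanded only inside the interval: the coefficients are constant for
    negative times and need not be differentiable at 0. *)
Lemma Rintegral_FTC_open {R : realType} (a b : R) (F f : R -> R) : a < b -> continuous F ->
  (forall t : R, a < t < b -> is_derive t 1 F (f t)) -> continuous f ->
  \int[interval_measure a b]_t f t = F b - F a.
Proof.
move=> ab cF dF cf; rewrite Rintegral_interval; last exact: continuous_measurable_fun.
rewrite /Rintegral (@continuous_FTC2 _ f F)//.
- exact: continuous_subspaceT.
- split.
  + by move=> t; rewrite in_itv/= => /dF dt; exact: ex_derive.
  + exact/cvg_at_right_filter/cF.
  + exact/cvg_at_left_filter/cF.
- by move=> t; rewrite in_itv/= => /dF dt; rewrite derive1E derive_val.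
Qed.

(** * The weak formulation *)

Section real_derivatives.
Context {R : realType}.
Implicit Types (f g : R -> R) (a b t df dg : R).

Lemma is_derive_affine f a b t df : is_derive t (1 : R) f df ->
  is_derive t (1 : R) (fun u : R => a + b * f u) (b * df).
Proof.
move=> h; rewrite (_ : (fun u => _) = cst a + b \*: f)//.
by apply: is_derive_eq; rewrite add0r.
Qed.

Lemma is_derive_mul f g t df dg : is_derive t (1 : R) f df -> is_derive t (1 : R) g dg ->
  is_derive t (1 : R) (fun u : R => f u * g u) (df * g t + f t * dg).
Proof.
move=> hf hg; rewrite (_ : (fun u => _) = f * g)//; apply: is_derive_eq.
by rewrite /GRing.scale/= addrC mulrC.
Qed.

Lemma is_derive_lin f g a b t df dg : is_derive t (1 : R) f df -> is_derive t (1 : R) g dg ->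
  is_derive t (1 : R) (fun u : R => f u * a + g u * b) (df * a + dg * b).
Proof.
move=> hf hg; rewrite (_ : (fun u => _) = a \*: f + b \*: g); last first.
  by apply/funext => u; rewrite [f u * a]mulrC [g u * b]mulrC.
by apply: is_derive_eq; rewrite /GRing.scale/= [a * _]mulrC [b * _]mulrC.
Qed.

End real_derivatives.

(** * Test functions, their slices and their bilaplacian *)

Section test_functions.
Context {R : realType} {d : nat}.
Local Notation nk := (@normk R d).
Local Notation point := 'rV[R]_d.
Local Notation freq := 'rV[int]_d.
Local Notation dx := (torus_measure R d).
Local Notation Dx i := (basis_vec R (i : 'I_d)).

Lemma partial_trig2 (psi : point -> R) p k i : smooth psi -> torus_periodic psi ->
  \int[dx]_x (partial i (partial i psi) x * trig p k x) =
  - ((k ord0 i)%:~R ^+ 2 * \int[dx]_x (psi x * trig p k x)).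
Proof.
move=> sp pp; have C1 := smooth_C1p sp pp.
have C2 : C1p (partial i psi).
  by apply: smooth_C1p; [exact: smooth_derive|exact: periodic_derive].
under eq_Rintegral do rewrite mulrC; rewrite ibp_trig// ibp_trig// opprK /= -[RHS]mulNr -RintegralZl//.
- apply: eq_Rintegral => x _; rewrite /trig /=; ring.
- have [cp _ _] := C1p_trig p k; have [_ tp _] := C1p_trig p k; have [cpsi _ _] := C1.
  by apply: integrable_C0p; [exact: continuous_mul|move=> x j; rewrite pp tp].
Qed.

Lemma derive_fun_sum (I : Type) (r : seq I) (f : I -> point -> R) (x w : point) :
  (forall i, derivable (f i) x w) ->
  derivable (fun y => \sum_(i <- r) f i y) x w /\
  'D_w (fun y => \sum_(i <- r) f i y) x = \sum_(i <- r) 'D_w (f i) x.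
Proof.
move=> df; elim: r => [|i r [IH1 IH2]].
  have -> : (fun y => \sum_(i <- [::]) f i y) = cst (0 : R) by apply/funext => y; rewrite big_nil.
  by rewrite big_nil; split; [exact: derivable_cst|exact: derive_cst].
have E : (fun y => \sum_(j <- i :: r) f j y) = f i + (fun y => \sum_(j <- r) f j y).
  by apply/funext => y; rewrite big_cons.
rewrite E big_cons; split; first exact: derivableD.
rewrite deriveD; [by rewrite IH2|exact: df|exact: IH1].
Qed.

Lemma bilaplacianE (psi : point -> R) x : smooth psi -> bilaplacian psi x =
  \sum_(j < d) \sum_(i < d) partial j (partial j (partial i (partial i psi))) x.
Proof.
move=> sp; apply: eq_bigr => j _.
have s2 i : smooth (partial i (partial i psi)) by do 2 apply: smooth_derive.
have E1 : partial j (laplacian psi) = fun y => \sum_(i < d) partial j (partial i (partial i psi)) y.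
  apply/funext => y; apply: (derive_fun_sum _ _).2 => i.
  by have [_] := s2 i [::]; exact.
rewrite E1; apply: (derive_fun_sum _ _).2 => i.
by have [_] := s2 i [:: Dx j]; exact.
Qed.

(** Two integrations by parts in each of two directions produce k_j^2 k_i^2, whose double sum is the
    square of |k|^2. *)
Lemma bilaplacian_trig (psi : point -> R) p k : smooth psi -> torus_periodic psi ->
  \int[dx]_x (bilaplacian psi x * trig p k x) = nk k ^+ 4 * \int[dx]_x (psi x * trig p k x).
Proof.
move=> sp pp.
have s2 i : smooth (partial i (partial i psi)) by do 2 apply: smooth_derive.
have p2 i : torus_periodic (partial i (partial i psi)) by do 2 apply: periodic_derive.
have s4 i j : smooth (partial j (partial j (partial i (partial i psi)))) by do 2 apply: smooth_derive.
have p4 i j : torus_periodic (partial j (partial j (partial i (partial i psi)))).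
  by do 2 apply: periodic_derive.
have [ct tp _] := C1p_trig p k.
have i4 i j : dx.-integrable setT (EFin \o (fun x => partial j (partial j (partial i (partial i psi))) x * trig p k x)).
  apply: integrable_C0p; last by move=> x l; rewrite p4 tp.
  by apply: continuous_mul => //; have [] := s4 i j [::].
under eq_Rintegral do rewrite bilaplacianE// mulr_suml.
under eq_Rintegral do under eq_bigr do rewrite mulr_suml.
rewrite Rintegral_sum; last by move=> j; apply: integrableR_sum => i; exact: i4.
under eq_bigr => j _ do rewrite Rintegral_sum//.
have E i j : \int[dx]_x (partial j (partial j (partial i (partial i psi))) x * trig p k x) =
   ((k ord0 j)%:~R ^+ 2 * (k ord0 i)%:~R ^+ 2) * \int[dx]_x (psi x * trig p k x).
  by rewrite !partial_trig2// mulrN opprK mulrA.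
under eq_bigr do under eq_bigr do rewrite E.
under eq_bigr do rewrite -mulr_suml -mulr_sumr.
by rewrite -mulr_suml -mulr_suml -(normk_sqr k) -exprD.
Qed.

Context (Phi : R * point -> R).
Hypotheses (sPhi : smooth Phi) (pPhi : forall t, torus_periodic (fun x => Phi (t, x))).

Lemma slice_derive (G : R * point -> R) w t x :
  'D_w (fun y => G (t, y)) x = 'D_((0, w) : R * point) G (t, x).
Proof.
have := @derive_slice_val R point (R * point)%type G (fun y => (t, y)) x w (0, w).
by apply => h; congr (_, _); rewrite /= scaler0 add0r.
Qed.

Lemma foldr_slice ws t :
  foldr (fun w h => 'D_w h) (fun x => Phi (t, x)) ws =
  fun x => foldr (fun w h => 'D_w h) Phi [seq ((0, w) : R * point) | w <- ws] (t, x).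
Proof.
elim: ws => [//|w ws IH] /=; rewrite IH; apply/funext => x; exact: slice_derive.
Qed.

Lemma continuous_slice (G : R * point -> R) t : continuous G -> continuous (fun x => G (t, x)).
Proof.
move=> cG x; apply: continuous_comp; last exact: cG.
have h : (fun=> t) @ x --> t by exact: (@continuous_const point R t x).
exact: (@cvg_pair _ _ _ (nbhs x) (nbhs t) (nbhs x) _ _ _ (fun=> t) id h (fun A => id)).
Qed.

Lemma continuous_slice2 (G : R * point -> R) (x : point) : continuous G -> continuous (fun t : R => G (t, x)).
Proof.
move=> cG t; apply: continuous_comp; last exact: cG.
exact: (cvg_pair cvg_id (cvg_cst x)).
Qed.

Lemma smooth_slice t : smooth (fun x => Phi (t, x)).
Proof.
move=> ws; rewrite foldr_slice /=; have [h1 h2] := sPhi [seq ((0, w) : R * point) | w <- ws].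
split; first exact: continuous_slice.
move=> x w; have := @derivable_slice R point (R * point)%type _ (fun y => (t, y)) x w (0, w) _ (h2 (t, x) (0, w)).
by apply => h; congr (_, _); rewrite /= scaler0 add0r.
Qed.

Definition dtime : R * point -> R := 'D_((1, 0) : R * point) Phi.

Lemma dtime_is_derive t x : is_derive t (1 : R) (fun u : R => Phi (u, x)) (dtime (t, x)).
Proof.
have cE (h : R) : (h *: (1 : R) + t, x) = h *: ((1, 0) : R * point) + (t, x).
  by congr (_, _); rewrite /= scaler0 add0r.
have [_ dP] := sPhi [::].
apply: DeriveDef.
  exact: (@derivable_slice R R (R * point)%type Phi (fun u => (u, x)) t 1 (1, 0) cE (dP (t, x) (1, 0))).
exact: (@derive_slice_val R R (R * point)%type Phi (fun u => (u, x)) t 1 (1, 0) cE).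
Qed.

Lemma dtime_continuous : continuous dtime.
Proof. by have [] := sPhi [:: ((1, 0) : R * point)]. Qed.

Lemma dtime_periodic t : torus_periodic (fun x => dtime (t, x)).
Proof.
move=> x i; have [_ <-] := dtime_is_derive t (x + (2 * pi) *: basis_vec R i).
have [_ <-] := dtime_is_derive t x; congr (derive _ _ _).
by apply/funext => u; have := @pPhi u x i.
Qed.

Definition bilap (z : R * point) : R := bilaplacian (fun x => Phi (z.1, x)) z.2.

Lemma bilap_continuous : continuous bilap.
Proof.
rewrite (_ : bilap = fun z => \sum_(j < d) \sum_(i < d)
  foldr (fun w h => 'D_w h) Phi [seq ((0, w) : R * point) | w <- [:: Dx j; Dx j; Dx i; Dx i]] z).
  apply: continuous_sum_fun => j; apply: continuous_sum_fun => i.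
  by have [] := sPhi [seq ((0, w) : R * point) | w <- [:: Dx j; Dx j; Dx i; Dx i]].
apply/funext => -[t x]; rewrite /bilap bilaplacianE; last exact: smooth_slice.
apply: eq_bigr => j _; apply: eq_bigr => i _.
by have := congr1 (fun f => f x) (foldr_slice [:: Dx j; Dx j; Dx i; Dx i] t).
Qed.

Lemma bilap_periodic t : torus_periodic (fun x => bilap (t, x)).
Proof.
move=> x l; rewrite /bilap /= !bilaplacianE; [|exact: smooth_slice|exact: smooth_slice].
apply: eq_bigr => j _; apply: eq_bigr => i _.
by have := @periodic_derive _ _ _ (Dx j) (periodic_derive (Dx j) (periodic_derive (Dx i)
  (periodic_derive (Dx i) (@pPhi t)))) x l.
Qed.

Lemma periodic_bounded_interval (G : R * point -> R) (T : R) : continuous G ->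
  (forall t, torus_periodic (fun x => G (t, x))) ->
  exists M : R, forall z, 0 <= z.1 <= T -> `|G z| <= M.
Proof.
move=> cG pG.
pose B := [set w : point | forall i, `[0, 2 * pi]%classic (w ord0 i)].
have cB : compact B.
  by apply: (@rV_compact _ _ (fun=> `[0, 2 * pi]%classic)) => i; exact: segment_compact.
have cK : compact ((`[0, T]%classic : set R) `*` B) by apply: compact_setX => //; exact: segment_compact.
have : compact (G @` ((`[0, T]%classic : set R) `*` B)).
  by apply: continuous_compact => //; exact: continuous_subspaceT.
move=> /compact_bounded [M [_ HM]]; exists (M + 1) => -[t x] /= tT.
have p2 : 0 < 2 * pi :> R by rewrite mulr_gt0 ?pi_gt0.
pose k := (\row_i (- Num.floor (x ord0 i / (2 * pi)))) : 'rV[int]_d.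
rewrite -(periodic_translate k x (pG t)).
apply: (HM (M + 1)); first by rewrite ltrDl.
eexists; last reflexivity.
split; first by rewrite /= in_itv.
move=> i; rewrite !mxE /= in_itv/= intrN.
have := floor_itv (x ord0 i / (2 * pi)) => /andP[h1 h2].
move: h1 h2; rewrite ler_pdivlMr// ltr_pdivrMr// intrD => h1 h2.
rewrite -[1%:~R]/(1 : R) mulrDl mul1r in h2.
by rewrite mulNr addrC subr_ge0 h1/= lerBlDl ltW.
Qed.

End test_functions.

(** The measure charges only times in [a, b], so a bound there suffices: [f] agrees almost
    everywhere with its cut-off [g]. *)
Lemma integrable_interval_prod {R : realType} {disp : measure_display} {X : measurableType disp}
    (mu : {finite_measure set X -> \bar R}) (a b M : R) (f : R * X -> R) : measurable_fun setT f ->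
  (forall z, a <= z.1 <= b -> `|f z| <= M) ->
  (interval_measure a b \x mu)%E.-integrable setT (EFin \o f).
Proof.
move=> mf fM; pose I : set R := `[a, b]%classic; pose g (z : R * X) := f z * \1_I z.1.
have mI : measurable I by exact: measurable_itv.
have mg : measurable_fun setT g.
  have mI1 : measurable_fun setT (\1_I : R -> R) by exact: measurable_indic.
  by apply: measurable_funM => //; exact: (measurableT_comp mI1 measurable_fst).
have gi : (interval_measure a b \x mu)%E.-integrable setT (EFin \o g).
  apply: (@integrable_bounded_prod _ _ _ _ _ _ _ _ `|M|) => // z; rewrite /g indicE.
  case: (boolP (z.1 \in I)) => [|_]; last by rewrite mulr0 normr0.
  by rewrite inE /I /= in_itv/= => /fM h; rewrite mulr1 (le_trans h)// ler_norm.
have ae : {ae (interval_measure a b \x mu)%E, forall z, f z = g z}.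
  exists (~` I `*` setT); split.
  - by apply: measurableX => //; exact: measurableC.
  - have := @product_measure1E _ _ _ _ _ (interval_measure a b) mu (~` I) setT (measurableC mI) measurableT.
    have I0 : interval_measure a b (~` I) = 0%E by rewrite [LHS]/(lebesgue_measure _) setICl measure0.
    by move=> h; apply: (etrans h); rewrite -[RHS](mul0e (mu setT)); congr (_ * _)%E.
  - move=> z /=; apply: contra_notP => /not_andP[/contrapT zI|//].
    by rewrite /g indicE mem_set// mulr1.
apply/integrableP; split; first exact/measurable_EFinP.
have /integrableP[_] := gi; apply: le_lt_trans; rewrite le_eqVlt; apply/orP; left; apply/eqP.
apply: ae_eq_integral => //.
- by apply: measurableT_comp => //; exact/measurable_EFinP.
- by apply: measurableT_comp => //; exact/measurable_EFinP.
- by apply: filterS ae => z /= ->.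
Qed.

Section ae_comparison.
Context {disp : measure_display} {T : measurableType disp} {R : realType}.
Context (mu : {measure set T -> \bar R}).

Lemma ae_le_Rintegral (f g : T -> R) : measurable_fun setT f -> (forall x, 0 <= f x) ->
  mu.-integrable setT (EFin \o g) -> (forall x, 0 <= g x) -> {ae mu, forall x, f x <= g x} ->
  \int[mu]_x f x <= \int[mu]_x g x.
Proof.
move=> mf f0 ig g0 fg; have mg : measurable_fun setT g by apply/measurable_EFinP; have /integrableP[] := ig.
have le : (\int[mu]_x (f x)%:E <= \int[mu]_x (g x)%:E)%E.
  apply: ae_ge0_le_integral => //.
  - by move=> x _; rewrite lee_fin.
  - exact/measurable_EFinP.
  - by move=> x _; rewrite lee_fin.
  - exact/measurable_EFinP.
  - by apply: filterS fg => x; rewrite lee_fin.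
have gfin : (\int[mu]_x (g x)%:E < +oo)%E.
  have /integrableP[_] := ig; apply: le_lt_trans; apply: ge0_le_integral => //.
  - by move=> x _; rewrite lee_fin.
  - exact/measurable_EFinP.
  - by apply: measurableT_comp => //; exact/measurable_EFinP.
  - by move=> x _; rewrite /= lee_fin ler_norm.
have f1 : (0 <= \int[mu]_x (f x)%:E)%E by apply: integral_ge0 => x _; rewrite lee_fin.
rewrite /Rintegral fine_le//.
- by rewrite ge0_fin_numE// (le_lt_trans le).
- by rewrite ge0_fin_numE// (le_trans f1 le).
Qed.

(** At the phase where the left modulus is attained it is the integral of a linear form, which is
    pointwise at most [amp]. *)
Lemma amp_Rintegral_le (u : T -> R * R) :
  mu.-integrable setT (EFin \o (fun x => (u x).1)) -> mu.-integrable setT (EFin \o (fun x => (u x).2)) ->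
  mu.-integrable setT (EFin \o (fun x => amp (u x))) ->
  amp (\int[mu]_x (u x).1, \int[mu]_x (u x).2) <= \int[mu]_x amp (u x).
Proof.
move=> i1 i2 ih; have [a ->] := amp_polarE (\int[mu]_x (u x).1, \int[mu]_x (u x).2).
rewrite /= -RintegralZr// -RintegralZr// -RintegralD//; last first.
- exact: (integrableZr measurableT _ i2).
- exact: (integrableZr measurableT _ i1).
apply: le_Rintegral => //; last by move=> x _; exact: polar_le_amp.
by apply: integrableRD; [exact: (integrableZr measurableT _ i1)|exact: (integrableZr measurableT _ i2)].
Qed.

End ae_comparison.

(** * Fourth moment and time evolution of the coefficients *)

Section evolution.
Context {R : realType} {d : nat}.
Local Notation nk := (@normk R d).
Local Notation point := 'rV[R]_d.
Local Notation freq := 'rV[int]_d.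
Local Notation dx := (torus_measure R d).
Context (c0 : freq -> R * R) (r0 : R) (c : R -> freq -> R * R).
Local Notation delta := (delta_rate r0).
Hypotheses (r1 : r0 < 1) (delta0 : 0 < delta)
  (cinit : forall t, t <= 0 -> c t = c0) (cb : forall t, bsum (fun=> 1) (c t) r0)
  (cc : forall k, continuous (fun t => (c t k).1) /\ continuous (fun t => (c t k).2))
  (cmom : forall n T, 0 <= T ->
     \int[interval_measure 0 T]_t (\sum_(k <- freqs n) nk k ^+ 4 * amp (c t k)) <= r0 / delta)
  (ceq : forall k t, 0 <= t -> c t k = c0 k + smul (nk k ^+ 4)
     (\int[interval_measure 0 t]_s (flux c s k).1, \int[interval_measure 0 t]_s (flux c s k).2))
  (mP : forall k, measurable_fun setT (fun t => (flux c t k).1) /\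
     measurable_fun setT (fun t => (flux c t k).2)).
Local Notation v t := (fser (c t)).
Local Notation P := (flux c).

Let sc t : summable_coef (c t). Proof. by exists r0; exact: cb. Qed.
Let r00 : 0 <= r0. Proof. exact: bsum_ge0 (cb 0). Qed.
Let r0p : 0 < 1 - r0. Proof. by rewrite subr_gt0. Qed.
Let nk4 k : 0 <= nk k ^+ 4. Proof. by rewrite exprn_ge0 ?normk_ge0. Qed.
Let mc k : measurable_fun setT (fun t => (c t k).1) /\ measurable_fun setT (fun t => (c t k).2).
Proof. by have [h1 h2] := cc k; split; exact: continuous_measurable_fun. Qed.
Let P0 t : bsum (fun=> 1) (P t) ((1 - r0) ^- 3). Proof. exact: bsum_cube0 (cb t) r1. Qed.
Let Ph t k : amp (P t k) <= (1 - r0) ^- 3.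
Proof. exact: bsum_amp (P0 t). Qed.

Definition moment4_part n t : R := \sum_(k <- freqs n) nk k ^+ 4 * amp (c t k).

Lemma measurable_moment4_part n : measurable_fun setT (moment4_part n).
Proof.
apply: measurable_sum => k; apply: measurable_funM => //.
by have [] := mc k; exact: measurable_amp.
Qed.

Lemma moment4_part_ge0 n t : 0 <= moment4_part n t.
Proof. by apply: sumr_ge0 => k _; rewrite mulr_ge0 ?amp_ge0. Qed.

Lemma moment4_part_mono t : nondecreasing_seq (moment4_part ^~ t).
Proof. by apply: sum_freqs_mono => k; rewrite mulr_ge0 ?amp_ge0. Qed.

(** Extended-real valued, as the moment may be infinite at exceptional times; the real version
    [rmoment4] is 0 there. *)
Definition moment4 t : \bar R := ereal_sup (range (fun n => (moment4_part n t)%:E)).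

Lemma moment4_part_cvg t : (fun n => (moment4_part n t)%:E) @ \oo --> moment4 t.
Proof. by apply: ereal_nondecreasing_cvgn => m n mn; rewrite lee_fin moment4_part_mono. Qed.

Lemma moment4_ge n t : ((moment4_part n t)%:E <= moment4 t)%E.
Proof. by apply: ereal_sup_ubound; exists n. Qed.

Lemma moment4_ge0 t : (0 <= moment4 t)%E.
Proof. by apply: le_trans (moment4_ge 0 t); rewrite lee_fin moment4_part_ge0. Qed.

Lemma measurable_moment4 : measurable_fun setT moment4.
Proof.
apply: (@emeasurable_fun_cvg _ _ _ _ (fun n t => (moment4_part n t)%:E)).
  by move=> n; apply/measurable_EFinP; exact: measurable_moment4_part.
by move=> t _; exact: moment4_part_cvg.
Qed.

Lemma integrable_moment4_part n T : (interval_measure 0 T).-integrable setT (EFin \o moment4_part n).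
Proof.
apply: (@integrable_bounded _ _ _ _ _ (\sum_(k <- freqs n : seq freq) nk k ^+ 4 * r0)) => [|t].
  exact: measurable_moment4_part.
rewrite ger0_norm ?moment4_part_ge0//; apply: ler_sum => k _; rewrite ler_wpM2l//.
exact: bsum_amp (cb t).
Qed.

Lemma moment4_integral T : 0 <= T -> (\int[interval_measure 0 T]_t moment4 t <= (r0 / delta)%:E)%E.
Proof.
move=> T0; have := @cvg_monotone_convergence _ _ _ (interval_measure 0 T) setT measurableT
  (fun n t => (moment4_part n t)%:E).
move=> /(_ (fun n => measurableT_comp (@EFin_measurable R setT) (measurable_moment4_part n))).
move=> /(_ (fun n t _ => moment4_part_ge0 n t) (fun t _ m n mn => moment4_part_mono t mn)).
have -> : (fun t => limn (fun n => (moment4_part n t)%:E)) = moment4.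
  by apply/funext => t; apply/cvg_lim => //; exact: moment4_part_cvg.
move=> h; rewrite -(cvg_lim _ h)//; apply: lime_le; first by apply/cvg_ex; eexists; exact: h.
apply: nearW => n.
have := cmom n T0; rewrite -lee_fin; apply: le_trans.
by rewrite /Rintegral fineK//; exact: integrable_fin_num (integrable_moment4_part n T).
Qed.

Definition rmoment4 t : R := fine (moment4 t).

Lemma rmoment4_ge0 t : 0 <= rmoment4 t. Proof. exact/fine_ge0/moment4_ge0. Qed.

Lemma integrable_moment4 T : 0 <= T -> (interval_measure 0 T).-integrable setT moment4.
Proof.
move=> T0; apply/integrableP; split; first exact: measurable_moment4.
apply: le_lt_trans (_ : _ <= (r0 / delta)%:E)%E (ltry _).
by under eq_integral do rewrite (gee0_abs (moment4_ge0 _)); exact: moment4_integral.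
Qed.

Lemma ae_rmoment4 T : 0 <= T -> {ae interval_measure 0 T, forall t, moment4 t = (rmoment4 t)%:E}.
Proof.
move=> T0; apply: filterS (integrable_ae measurableT (integrable_moment4 T0)) => t h.
by rewrite /rmoment4 fineK// h.
Qed.

Lemma measurable_rmoment4 : measurable_fun setT rmoment4.
Proof. by apply: (measurableT_comp (fine_measurable measurableT)); exact: measurable_moment4. Qed.

Lemma integrable_rmoment4 T : 0 <= T -> (interval_measure 0 T).-integrable setT (EFin \o rmoment4).
Proof.
move=> T0; apply: le_integrable (integrable_moment4 T0) => //.
  by apply/measurable_EFinP; exact: measurable_rmoment4.
move=> t _ /=; rewrite /rmoment4 ger0_norm; last exact/fine_ge0/moment4_ge0.
by rewrite (gee0_abs (moment4_ge0 t)); case: (moment4 t) (moment4_ge0 t) => //= ?; rewrite ?leey.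
Qed.

Lemma bsum4_moment4 t M : (moment4 t <= M%:E)%E -> bsum (fun k => nk k ^+ 4) (c t) M.
Proof. by move=> GM n; have := le_trans (moment4_ge n t) GM; rewrite lee_fin. Qed.

(* The fourth moment of [P] bounds the time derivative of [c]. *)
Lemma c_modulus T (e : R) : 0 <= T -> 0 < e -> exists2 eta : R, 0 < eta &
  forall s t, 0 <= s -> s <= t -> t <= T -> t - s < eta ->
    bsum (fun=> 1) (fun k => c t k - c s k) e.
Proof.
move=> T0 e0; pose C : R := 6 - delta.
have C1 : 0 < C.
  have r01 : 0 <= r0 < 1 by rewrite r00.
  by rewrite /C; have := delta_rate0_le r01; lra.
(* The time derivative is bounded in l^1 by [C * rmoment4], integrable but possibly unbounded, so
   the modulus comes from absolute continuity of the integral. The constant [C] is that of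
   [bsum_cube4]. *)
have [eta [eta0 etaP]] := integral_normr_continuous (integrable_rmoment4 T0) (divr_gt0 e0 C1).
exists eta => // s t s0 st tT ts n; under eq_bigr do rewrite mul1r.
pose A : set R := `]s, t]%classic; have mA : measurable A by exact: measurable_itv.
have muA : (interval_measure 0 T A < eta%:E)%E.
  apply: (@le_lt_trans _ _ (lebesgue_measure A)).
    by apply: le_measure; rewrite ?inE//; exact: measurableI.
  rewrite /A (@lebesgue_measure_itv R `]_, _])/= lte_fin.
  by case: ifP => _; rewrite ?lte_fin// -EFinB lte_fin.
have h := etaP A mA muA.
have mI : measurable_fun setT (\1_A : R -> R) by exact: measurable_indic.
have I1 u : `|\1_A u : R| <= 1 by rewrite indicE; case: (_ \in _); rewrite ?normr1 ?normr0.
have I0 u : 0 <= (\1_A u : R) by [].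
have ib (f : R -> R) : measurable_fun setT f -> (forall u, `|f u| <= (1 - r0) ^- 3) ->
    (interval_measure 0 T).-integrable setT (EFin \o (fun u => f u * \1_A u)).
  move=> mf fB; apply: (@integrableR_bmul _ _ _ _ _ _ 1) => //.
  exact: (integrable_bounded _ mf fB).
have coord (F : R * R -> R) k : measurable_fun setT (fun u => F (P u k)) ->
    (forall p, `|F p| <= amp p) ->
    \int[interval_measure 0 t]_u F (P u k) - \int[interval_measure 0 s]_u F (P u k) =
    \int[interval_measure 0 T]_u (F (P u k) * \1_A u).
  move=> mF Fh; rewrite (Rintegral_sub_interval _ tT)// (Rintegral_sub_interval _ (le_trans st tT))//.
  have iB b : (interval_measure 0 T).-integrable setT (EFin \o (fun u => F (P u k) * ((u <= b)%R)%:R)).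
    have mt : measurable_fun setT (fun u : R => ((u <= b)%R)%:R : R).
      have -> : (fun u : R => ((u <= b)%R)%:R : R) = \1_(`]-oo, b] : set R).
        by apply/funext => u; rewrite indicE mem_setE in_itv.
      exact: measurable_indic.
    apply: (@integrableR_bmul _ _ _ _ _ _ 1) => //.
      by apply: (@integrable_bounded _ _ _ _ _ ((1 - r0) ^- 3)) => // u; exact: le_trans (Fh _) (Ph _ _).
    by move=> u; case: (u <= b); rewrite ?normr1 ?normr0.
  rewrite -RintegralB//; apply: eq_Rintegral => u _; rewrite -mulrBr; congr (_ * _).
  rewrite indicE /A mem_setE in_itv/=.
  by case: (leP u s) => us /=; [rewrite (le_trans us st) subrr|rewrite subr0].
have hc k : amp (c t k - c s k) <= \int[interval_measure 0 T]_u (nk k ^+ 4 * amp (P u k) * \1_A u).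
  have [m1 m2] := mP k.
  have -> : c t k - c s k = smul (nk k ^+ 4) (\int[interval_measure 0 T]_u ((smul (\1_A u) (P u k)).1),
      \int[interval_measure 0 T]_u ((smul (\1_A u) (P u k)).2)).
    rewrite (ceq k (le_trans s0 st)) (ceq k s0) opprD addrACA subrr add0r /smul /=.
    congr (_, _); rewrite /= -mulrBr; congr (_ * _).
      by rewrite (coord fst)//; [under eq_Rintegral do rewrite mulrC|move=> p; exact: norm_fst_le_amp].
    by rewrite (coord snd)//; [under eq_Rintegral do rewrite mulrC|move=> p; exact: norm_snd_le_amp].
  have mh : measurable_fun setT (fun u => amp (P u k)) by exact: measurable_amp.
  have ih := ib _ mh (fun u => _); rewrite amp_smul ger0_norm//.
  have {}ih : (interval_measure 0 T).-integrable setT (EFin \o (fun u => amp (P u k) * \1_A u)).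
    by apply: ib => // u; rewrite ger0_norm ?amp_ge0.
  under [in leRHS]eq_Rintegral do rewrite -mulrA.
  rewrite RintegralZl// ler_wpM2l//.
  apply: le_trans (amp_Rintegral_le _ _ _) _.
  - under eq_fun do rewrite /= mulrC; apply: ib => // u; exact: le_trans (norm_fst_le_amp _) (Ph _ _).
  - under eq_fun do rewrite /= mulrC; apply: ib => // u; exact: le_trans (norm_snd_le_amp _) (Ph _ _).
  - by under eq_fun do rewrite amp_smul ger0_norm// mulrC.
  by under eq_Rintegral do rewrite amp_smul ger0_norm// mulrC.
apply: le_trans (ler_sum _ (fun k _ => hc k)) _.
have mh k : measurable_fun setT (fun u => nk k ^+ 4 * amp (P u k)).
  by apply: measurable_funM => //; have [] := mP k; exact: measurable_amp.
rewrite -Rintegral_sum; last first.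
  move=> k; under eq_fun do rewrite -mulrA; apply: integrableRZ; apply: ib.
    by have [] := mP k; exact: measurable_amp.
  by move=> u; rewrite ger0_norm ?amp_ge0.
apply: (@le_trans _ _ (\int[interval_measure 0 T]_u (C * (rmoment4 u * \1_A u)))).
  apply: ae_le_Rintegral.
  - by apply: measurable_sum => k; exact: measurable_funM.
  - by move=> u; apply: sumr_ge0 => k _; apply: mulr_ge0 => //; rewrite mulr_ge0 ?amp_ge0.
  - by apply: integrableRZ; apply: (@integrableR_bmul _ _ _ _ _ _ 1) => //; exact: integrable_rmoment4.
  - by move=> u; rewrite !mulr_ge0 ?rmoment4_ge0// ltW.
  - apply: filterS (ae_rmoment4 T0) => u Gu; rewrite -mulr_suml mulrA ler_wpM2r//.
    by apply: (bsum_cube4 (cb u) r1); apply: bsum4_moment4; rewrite Gu.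
rewrite RintegralZl//; last first.
  by apply: (@integrableR_bmul _ _ _ _ _ _ 1) => //; exact: integrable_rmoment4.
rewrite mulrC -ler_pdivlMr// ltW// (le_lt_trans _ h)// [leRHS]Rintegral_mkcond le_eqVlt; apply/orP; left.
apply/eqP; apply: eq_Rintegral => u _; rewrite patchE indicE.
by case: (u \in A); rewrite ?mulr1 ?mulr0 ?(ger0_norm (rmoment4_ge0 _)).
Qed.

Lemma c_near t (e : R) : 0 < e -> exists2 eta : R, 0 < eta &
  forall s, `|s - t| < eta -> bsum (fun=> 1) (fun k => c s k - c t k) e.
Proof.
move=> e0; pose T := `|t| + 1; have T0 : 0 <= T by rewrite addr_ge0.
have [eta eta0 h] := c_modulus T0 e0.
exists (Num.min eta 1); first by rewrite lt_min eta0 ltr01.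
(* As [c] is constant at negative times, these are replaced by 0, which does not increase distances,
   before [c_modulus] is applied. *)
pose p (u : R) := Num.max 0 u.
have cp u : c u = c (p u).
  by rewrite /p; have [//|u0] := leP 0 u; rewrite !cinit// ltW.
move=> s; rewrite lt_min => /andP[st st1]; rewrite cp (cp t).
have p0 u : 0 <= p u by rewrite /p le_max lexx.
have pL u w : p u - p w <= `|u - w|.
  rewrite /p; have := ler_norm (u - w); have := normr_ge0 (u - w).
  by case: (leP 0 u) => hu; case: (leP 0 w) => hw; lra.
have pT : p t <= T.
  by rewrite /p ge_max T0/= /T; have := ler_norm t; lra.
have psT : p s <= T.
  rewrite /p ge_max T0/= /T; have := ler_norm t; have := ler_norm (s - t); lra.
have [ps|/ltW ps] := leP (p t) (p s).
  by apply: h => //; exact: le_lt_trans (pL _ _) st.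
have := h _ _ (p0 s) ps pT; rewrite -normrN opprB in st.
move=> /(_ (le_lt_trans (pL _ _) st)) /bsumN hN n.
by have := hN n; under eq_bigr do rewrite opprB.
Qed.

Lemma v_near t (e : R) : 0 < e -> exists2 eta : R, 0 < eta &
  forall s, `|s - t| < eta -> forall x, `|v s x - v t x| <= e.
Proof.
move=> e0; have [eta eta0 h] := c_near t e0; exists eta => // s st x.
by rewrite -fserB//; apply: fser_le; exact: h.
Qed.

(** By [v_near] the function v is continuous in time uniformly in space, and (1 + v)^-3 is Lipschitz
    in v. The continuity lets the integral equation be differentiated. *)
Lemma P_continuous k : continuous (fun t => (P t k).1) /\ continuous (fun t => (P t k).2).
Proof.
have key (F : R * R -> R) : (forall p q, `|F p - F q| <= amp (p - q)) -> continuous (fun t => F (P t k)).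
  move=> Fl t; apply/cvgrPdist_le => e e0.
  pose L : R := 3 * (1 - r0) ^- 4.
  have L0 : 0 < L by rewrite mulr_gt0// invr_gt0 exprn_gt0.
  have [eta eta0 h] := v_near t (divr_gt0 e0 (mulr_gt0 (ltr0n _ 2) L0)).
  exists eta => // s /=; rewrite distrC => st.
  apply: le_trans (Fl _ _) _; rewrite ampC.
  have -> : e = 2 * (L * (e / (2 * L))) by field; rewrite gt_eqF.
  apply: (@fcoef_dist _ _ _ _ _ _ ((1 - r0) ^- 3)).
  - exact: measurable_cube (cb s) r1.
  - exact: measurable_cube (cb t) r1.
  - by move=> x; exact: cube_bound (cb s) r1 x.
  - by move=> x; exact: cube_bound (cb t) r1 x.
  - move=> x; apply: le_trans (cube_lip r1 (fser_le x (cb s)) (fser_le x (cb t))) _.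
    by rewrite ler_wpM2l ?(ltW L0)// h.
split; apply: key => p q; first exact: norm_fst_le_amp (p - q).
exact: norm_snd_le_amp (p - q).
Qed.

Lemma c_derive k (t : R) : 0 < t ->
  is_derive t (1 : R) (fun u : R => (c u k).1 : R) (nk k ^+ 4 * (P t k).1) /\
  is_derive t (1 : R) (fun u : R => (c u k).2 : R) (nk k ^+ 4 * (P t k).2).
Proof.
move=> t0; have [P1 P2] := P_continuous k.
have key (F : R * R -> R) : (forall p q, F (p + q) = F p + F q) -> continuous (fun u => F (P u k)) ->
    (forall p, `|F p| <= amp p) ->
    (forall u, 0 <= u -> F (c u k) = F (c0 k) + nk k ^+ 4 * \int[interval_measure 0 u]_s F (P s k)) ->
    is_derive t (1 : R) (fun u : R => F (c u k)) (nk k ^+ 4 * F (P t k)).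
  move=> FD cF Fh Fe; pose I (u : R) := \int[lebesgue_measure]_(s in `[0, u]) F (P s k).
  have mF : measurable_fun setT (fun u => F (P u k)) by exact: continuous_measurable_fun.
  have [] := @continuous_FTC1_closed _ (fun u => F (P u k)) 0 t (t + 1) _ _ t0 (cF t).
  - by rewrite ltrDl.
  - apply: continuous_compact_integrable; first exact: segment_compact.
    exact: continuous_subspaceT.
  move=> dI DI.
  have dI' : is_derive t (1 : R) (fun u : R => F (c0 k) + nk k ^+ 4 * I u) (nk k ^+ 4 * F (P t k)).
    apply: is_derive_affine; apply: DeriveDef; first exact: dI.
    by rewrite -derive1E; exact: DI.
  apply: near_eq_is_derive dI'.
  near=> u; rewrite Fe ?Rintegral_interval//.
  by apply: ltW; near: u; exact: lt_nbhsr.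
split.
- by apply: (key fst) => //; [move=> p; exact: norm_fst_le_amp|move=> u u0; rewrite ceq].
- by apply: (key snd) => //; [move=> p; exact: norm_snd_le_amp|move=> u u0; rewrite ceq].
Unshelve. all: by end_near. Qed.

Hypothesis csy : forall t, csym (c t).

Lemma fcoef_unique2 (u w phi : point -> R) : dx.-integrable setT (EFin \o u) ->
  dx.-integrable setT (EFin \o w) -> (forall k, fcoef u k = fcoef w k) ->
  continuous phi -> torus_periodic phi ->
  \int[dx]_x (u x * phi x) = \int[dx]_x (w x * phi x).
Proof.
move=> iu iw uw cp pp; have [M HM] := periodic_bounded cp pp.
have mp : measurable_fun setT phi by exact: continuous_row_measurable.
apply/eqP; rewrite -subr_eq0; apply/eqP.
have iB (g : point -> R) N : measurable_fun setT g -> (forall x, `|g x| <= N) ->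
    \int[dx]_x ((u x - w x) * g x) = \int[dx]_x (u x * g x) - \int[dx]_x (w x * g x).
  move=> mg gN; under eq_Rintegral do rewrite mulrBl.
  by rewrite RintegralB//; exact: integrableR_bmul gN.
rewrite -(iB _ M)//; apply: fcoef_unique => //.
  have := integrableRD iu (integrableRZ (-1) iw).
  by under eq_fun do rewrite mulN1r.
move=> k; have := uw k; rewrite /fcoef /fcos /fsin => -[h1 h2].
rewrite (iB _ 1); [|exact: measurable_cos_dot|by move=> x; exact: norm_cos_le1].
rewrite (iB _ 1); [|exact: measurable_sin_dot|by move=> x; exact: norm_sin_le1].
by rewrite !mulrBr h1 h2 !subrr.
Qed.

Lemma P_summable_coef t : summable_coef (P t). Proof. by exists ((1 - r0) ^- 3). Qed.

Lemma integrable_cube t : dx.-integrable setT (EFin \o cube (c t)).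
Proof. exact: (integrable_bounded _ (measurable_cube (cb t) r1) (cube_bound (cb t) r1)). Qed.

(** The series of the coefficients of (1 + v)^-3 and the function itself have equal coefficients.
    Agreement against continuous periodic functions is all that the weak formulation requires. *)
Lemma fser_P t (phi : point -> R) : continuous phi -> torus_periodic phi ->
  \int[dx]_x (fser (P t) x * phi x) = \int[dx]_x (cube (c t) x * phi x).
Proof.
move=> cp pp; apply: fcoef_unique2 => //.
- apply: (@integrable_bounded _ _ _ _ _ ((1 - r0) ^- 3)) => [|x]; last exact: fser_le.
  exact: measurable_fser (P_summable_coef t).
- exact: integrable_cube.
- move=> k; rewrite fcoef_fser//; first exact: P_summable_coef.
  by apply: fcoef_sym; exact: integrable_cube.
Qed.

(** * The weak identity for one test function *)

Section weak_formulation.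
Context (T : R) (Phi : R * point -> R) (S : R) (v0 : point -> R).
Hypotheses (T0 : 0 < T) (sPhi : smooth Phi) (pPhi : forall t, torus_periodic (fun x => Phi (t, x)))
  (ST : S < T) (Phi0 : forall t x, S < t -> Phi (t, x) = 0)
  (iv0 : dx.-integrable setT (EFin \o v0)) (v0c : forall k, fcoef v0 k = c0 k).
Local Notation dP := (dtime Phi).
Local Notation bP := (bilap Phi).

Let cPhi : continuous Phi. Proof. by have [] := sPhi [::]. Qed.
Let cdP : continuous dP. Proof. exact: dtime_continuous. Qed.
Let cbP : continuous bP. Proof. exact: bilap_continuous. Qed.
Let pdP t : torus_periodic (fun x => dP (t, x)). Proof. exact: dtime_periodic. Qed.
Let pbP t : torus_periodic (fun x => bP (t, x)). Proof. exact: bilap_periodic. Qed.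

Let mPk k : measurable_fun setT (fun z : R * point => trig (P z.1 k) k z.2).
Proof.
have [m1 m2] := mP k; apply: measurable_funD; apply: measurable_funM.
- exact: (measurableT_comp m1).
- by apply: (measurableT_comp (measurable_cos_dot k)).
- exact: (measurableT_comp m2).
- by apply: (measurableT_comp (measurable_sin_dot k)).
Qed.

Let mck k : measurable_fun setT (fun z : R * point => trig (c z.1 k) k z.2).
Proof.
have [m1 m2] := mc k; apply: measurable_funD; apply: measurable_funM.
- exact: (measurableT_comp m1).
- by apply: (measurableT_comp (measurable_cos_dot k)).
- exact: (measurableT_comp m2).
- by apply: (measurableT_comp (measurable_sin_dot k)).
Qed.

Let ch t k : amp (c t k) <= r0.
Proof. exact: bsum_amp (cb t). Qed.

(** The fundamental theorem for [Phi] times one mode at a fixed point. The end term at [T] vanishes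
    since [Phi] is zero after [S < T]. *)
Lemma time_by_parts k x :
  \int[interval_measure 0 T]_t (dP (t, x) * trig (c t k) k x +
    Phi (t, x) * (nk k ^+ 4 * trig (P t k) k x)) = - (Phi (0, x) * trig (c0 k) k x).
Proof.
have [c1 c2] := cc k; have [q1 q2] := P_continuous k.
have ctr (u : R -> R * R) : continuous (fun t => (u t).1) -> continuous (fun t => (u t).2) ->
    continuous (fun t => trig (u t) k x).
  move=> u1 u2; apply: continuous_add; apply: continuous_mul => //; exact: continuous_const.
pose F t := Phi (t, x) * trig (c t k) k x.
have -> : - (Phi (0, x) * trig (c0 k) k x) = F T - F 0.
  by rewrite /F (Phi0 x ST) mul0r sub0r cinit.
apply: Rintegral_FTC_open => //.
- by apply: continuous_mul; [exact: continuous_slice2|exact: ctr].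
- move=> t /andP[t0 tT]; have [d1 d2] := c_derive k t0.
  have := is_derive_mul (dtime_is_derive sPhi t x)
    (is_derive_lin (cos (dotk k x)) (sin (dotk k x)) d1 d2).
  rewrite (_ : nk k ^+ 4 * (P t k).1 * cos (dotk k x) + nk k ^+ 4 * (P t k).2 * sin (dotk k x) =
    nk k ^+ 4 * trig (P t k) k x)//.
  by rewrite /trig; ring.
- apply: continuous_add; apply: continuous_mul.
  + exact: continuous_slice2.
  + exact: ctr.
  + exact: continuous_slice2.
  + apply: (@continuous_mul _ _ (fun=> nk k ^+ 4)); first exact: continuous_const.
    exact: ctr.
Qed.

(** By [bilaplacian_trig], the bilaplacian of the test function produces the factor |k|^4 of the
    time derivative of the mode. Fubini's theorem then reduces the claim to [time_by_parts] at each
    point. *)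
Lemma weak_mode k :
  \int[interval_measure 0 T]_t \int[dx]_x (dP (t, x) * trig (c t k) k x + bP (t, x) * trig (P t k) k x) =
  - \int[dx]_x (Phi (0, x) * trig (c0 k) k x).
Proof.
have [M1 HM1] := periodic_bounded_interval T cPhi pPhi.
have [M2 HM2] := periodic_bounded_interval T cdP pdP.
pose A (z : R * point) := dP z * trig (c z.1 k) k z.2 + Phi z * (nk k ^+ 4 * trig (P z.1 k) k z.2).
have iA : (interval_measure 0 T \x dx)%E.-integrable setT (EFin \o A).
  apply: (@integrable_interval_prod _ _ _ _ _ _ (M2 * r0 + M1 * (nk k ^+ 4 * (1 - r0) ^- 3))).
    apply: measurable_funD; apply: measurable_funM => //.
    - exact: continuous_pair_measurable.
    - exact: continuous_pair_measurable.
    - exact: measurable_funM.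
  move=> z zT; rewrite (le_trans (ler_normD _ _))// lerD// normrM ler_pM ?HM1 ?HM2//.
    exact: le_trans (norm_trig_le _ _ _) (ch _ _).
  by rewrite normrM ger0_norm// ler_wpM2l// (le_trans (norm_trig_le _ _ _)).
transitivity (\int[interval_measure 0 T]_t \int[dx]_x A (t, x)).
  apply: eq_Rintegral => t _.
  have [ct tp _] := C1p_trig (c t k) k; have [ct' tp' _] := C1p_trig (P t k) k.
  have i1 : dx.-integrable setT (EFin \o (fun x => dP (t, x) * trig (c t k) k x)).
    apply: integrable_C0p; last by move=> x i; rewrite pdP tp.
    by apply: continuous_mul => //; exact: continuous_slice.
  have i2 : dx.-integrable setT (EFin \o (fun x => bP (t, x) * trig (P t k) k x)).
    apply: integrable_C0p; last by move=> x i; rewrite pbP tp'.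
    by apply: continuous_mul => //; exact: continuous_slice.
  have i3 : dx.-integrable setT (EFin \o (fun x => Phi (t, x) * trig (P t k) k x)).
    apply: integrable_C0p; last by move=> x i; rewrite pPhi tp'.
    by apply: continuous_mul => //; exact: continuous_slice.
  rewrite RintegralD// [in RHS]/A.
  under [in RHS]eq_Rintegral do rewrite /= mulrCA.
  rewrite RintegralD//; last exact: integrableRZ.
  rewrite RintegralZl//; congr (_ + _).
  exact: (bilaplacian_trig (P t k) k (smooth_slice sPhi t) (pPhi t)).
rewrite -(Rfubini1 iA) (Rfubini2 iA) -mulN1r -RintegralZl//; last first.
  have [ct tp _] := C1p_trig (c0 k) k.
  apply: integrable_C0p; last by move=> x i; rewrite pPhi tp.
  by apply: continuous_mul => //; exact: continuous_slice.
by apply: eq_Rintegral => x _; rewrite mulN1r -time_by_parts.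
Qed.

Let M1 := sval (cid (periodic_bounded_interval T cdP pdP)).
Let HM1 : forall z, 0 <= z.1 <= T -> `|dP z| <= M1.
Proof. exact: svalP (cid (periodic_bounded_interval T cdP pdP)). Qed.
Let M2 := sval (cid (periodic_bounded_interval T cbP pbP)).
Let HM2 : forall z, 0 <= z.1 <= T -> `|bP z| <= M2.
Proof. exact: svalP (cid (periodic_bounded_interval T cbP pbP)). Qed.

Let slice_prod (u : R * point -> R) t (M : R) : measurable_fun setT (fun x => u (t, x)) ->
  (forall x, `|u (t, x)| <= M) -> forall g : R * point -> R, continuous g ->
  (forall s, torus_periodic (fun x => g (s, x))) ->
  dx.-integrable setT (EFin \o (fun x => u (t, x) * g (t, x))).
Proof.
move=> mu uM g cg pg; have cgt : continuous (fun x => g (t, x)) by exact: continuous_slice.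
have [N HN] := periodic_bounded cgt (pg t).
apply: (@integrableR_bmul _ _ _ _ _ _ N) => //; last exact: continuous_row_measurable.
exact: integrable_bounded uM.
Qed.

Let inner n t := \int[dx]_x (ptrig (c t) n x * dP (t, x)) + \int[dx]_x (ptrig (P t) n x * bP (t, x)).

Let measurable_inner (u : R -> freq -> R * R) (B : R) (g : R * point -> R) (M : R) n :
  (forall k, measurable_fun setT (fun t => (u t k).1) /\ measurable_fun setT (fun t => (u t k).2)) ->
  (forall t, bsum (fun=> 1) (u t) B) -> continuous g -> (forall z, 0 <= z.1 <= T -> `|g z| <= M) ->
  measurable_fun setT (fun t => \int[dx]_x (ptrig (u t) n x * g (t, x))).
Proof.
move=> mu uB cg gM.
apply: (@measurable_Rfubini _ _ _ _ _ (interval_measure 0 T) dx (fun z => ptrig (u z.1) n z.2 * g z)).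
apply: (@integrable_interval_prod _ _ _ _ _ _ (B * M)).
  by apply: measurable_funM; [exact: measurable_ptrig2|exact: continuous_pair_measurable].
by move=> z zT; rewrite normrM ler_pM ?gM// ptrig_le.
Qed.

Let inner_bound (u : R -> freq -> R * R) (B : R) (g : R * point -> R) (M : R) n (t : R) : 0 <= t <= T ->
  (forall t, bsum (fun=> 1) (u t) B) -> continuous g -> (forall z, 0 <= z.1 <= T -> `|g z| <= M) ->
  `|\int[dx]_x (ptrig (u t) n x * g (t, x))| <= B * M * fine (dx setT).
Proof.
move=> tT uB cg gM; apply: Rintegral_le_bound.
  apply: measurable_funM; first exact: measurable_ptrig.
  by apply: continuous_row_measurable; exact: continuous_slice.
by move=> x; rewrite normrM ler_pM ?gM// ptrig_le.
Qed.

Let cvg_inner (u : freq -> R * R) (g : R * point -> R) (t : R) : summable_coef u -> continuous g ->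
  (forall s, torus_periodic (fun x => g (s, x))) ->
  (fun n => \int[dx]_x (ptrig u n x * g (t, x))) @ \oo --> \int[dx]_x (fser u x * g (t, x)).
Proof.
move=> su cg pg; have cgt : continuous (fun x => g (t, x)) by exact: continuous_slice.
have [N HN] := periodic_bounded cgt (pg t).
have mg : measurable_fun setT (fun x => g (t, x)) by exact: continuous_row_measurable.
under eq_fun do rewrite (Rintegral_ptrig _ _ mg HN).
exact: cvg_fser_integral su mg HN.
Qed.

Lemma weak_sum n : \int[interval_measure 0 T]_t inner n t =
  - \int[dx]_x (ptrig c0 n x * Phi (0, x)).
Proof.
have cP0 : continuous (fun x => Phi (0, x)) by exact: continuous_slice.
have [N HN] := periodic_bounded cP0 (pPhi 0).
have mP0 : measurable_fun setT (fun x => Phi (0, x)) by exact: continuous_row_measurable.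
rewrite (Rintegral_ptrig _ _ mP0 HN) -sumrN.
under [in RHS]eq_bigr => k _ do under eq_Rintegral do rewrite mulrC.
under [in RHS]eq_bigr do rewrite -weak_mode.
rewrite -Rintegral_sum; last first.
  move=> k; apply: (@integrable_Rfubini _ _ _ _ _ (interval_measure 0 T) dx
    (fun z => dP z * trig (c z.1 k) k z.2 + bP z * trig (P z.1 k) k z.2)).
  apply: (@integrable_interval_prod _ _ _ _ _ _ (M1 * r0 + M2 * (1 - r0) ^- 3)).
    by apply: measurable_funD; apply: measurable_funM => //; exact: continuous_pair_measurable.
  move=> z zT; rewrite (le_trans (ler_normD _ _))// lerD// normrM ler_pM ?HM1 ?HM2//.
    exact: le_trans (norm_trig_le _ _ _) (ch _ _).
  exact: le_trans (norm_trig_le _ _ _) (Ph _ _).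
apply: eq_Rintegral => t _; rewrite /inner.
have sl (g : R * point -> R) (q : freq -> R * R) : continuous g -> (forall s, torus_periodic (fun x => g (s, x))) ->
    (\int[dx]_x (ptrig q n x * g (t, x)) = \sum_(k <- freqs n) \int[dx]_x (trig (q k) k x * g (t, x))) /\
    forall k, dx.-integrable setT (EFin \o (fun x => g (t, x) * trig (q k) k x)).
  move=> cg pg; have cgt : continuous (fun x => g (t, x)) by exact: continuous_slice.
  have [N' HN'] := periodic_bounded cgt (pg t).
  have mg : measurable_fun setT (fun x => g (t, x)) by exact: continuous_row_measurable.
  split; first exact: Rintegral_ptrig HN'.
  move=> k; have [cq pq _] := C1p_trig (q k) k.
  by apply: integrable_C0p; [exact: continuous_mul|move=> x i; rewrite pg pq].
have [-> i1] := sl _ (c t) cdP pdP; have [-> i2] := sl _ (P t) cbP pbP.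
rewrite -big_split; apply: eq_bigr => k _ /=; rewrite RintegralD//.
by congr (_ + _); apply: eq_Rintegral => x _; rewrite mulrC.
Qed.

(** Both sides of [weak_sum] converge: the left by dominated convergence in time, the right because
    [v0] and [fser c0] have the same coefficients and are tested against a continuous periodic
    function. [fser_P] finally replaces the series of the flux by (1 + v)^-3. *)
Lemma weak_identity :
  \int[dx]_x (Phi (0, x) * v0 x) +
  \int[interval_measure 0 T]_t \int[dx]_x (dP (t, x) * v t x + bP (t, x) * cube (c t) x) = 0.
Proof.
have L1 : (fun n => \int[interval_measure 0 T]_t inner n t) @ \oo -->
    \int[interval_measure 0 T]_t (\int[dx]_x (v t x * dP (t, x)) + \int[dx]_x (fser (P t) x * bP (t, x))).
  have mi n : measurable_fun setT (inner n).
    apply: measurable_funD.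
      exact: (measurable_inner n mc cb cdP HM1).
    exact: (measurable_inner n mP P0 cbP HM2).
  have ci t : (inner ^~ t) @ \oo --> \int[dx]_x (v t x * dP (t, x)) + \int[dx]_x (fser (P t) x * bP (t, x)).
    by apply: cvgD; apply: cvg_inner => //; exact: P_summable_coef.
  pose B := r0 * M1 * fine (dx setT) + (1 - r0) ^- 3 * M2 * fine (dx setT).
  apply: (@Rdominated_cvg _ _ _ (interval_measure 0 T) inner _ (fun=> B) mi _ _ _ _).2.
  - exact: fun_cvg_measurable mi ci.
  - by apply: aeW => t; exact: ci.
  - exact: (@integrable_bounded _ _ _ _ _ `|B|).
  - apply: filterS (ae_interval 0 T) => t tT n; rewrite (le_trans (ler_normD _ _))// lerD//.
      exact: (inner_bound n tT cb cdP HM1).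
    exact: (inner_bound n tT P0 cbP HM2).
have L2 : (fun n => \int[interval_measure 0 T]_t inner n t) @ \oo --> - \int[dx]_x (v0 x * Phi (0, x)).
  under eq_fun do rewrite weak_sum; apply: cvgN.
  have sc0 : summable_coef c0 by rewrite -(cinit (lexx 0)).
  have cs0 : csym c0 by rewrite -(cinit (lexx 0)).
  rewrite (@fcoef_unique2 v0 (fser c0) (fun x => Phi (0, x)))//; last exact: continuous_slice.
  - exact: cvg_inner.
  - have cb0 : bsum (fun=> 1) c0 r0 by rewrite -(cinit (lexx 0)).
    apply: (@integrable_bounded _ _ _ _ _ r0) => [|x]; last exact: fser_le.
    exact: measurable_fser.
  - by move=> k; rewrite v0c fcoef_fser.
have := cvg_unique _ L1 L2 => E.
under eq_Rintegral do rewrite mulrC.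
have -> : \int[interval_measure 0 T]_t \int[dx]_x (dP (t, x) * v t x + bP (t, x) * cube (c t) x) =
    \int[interval_measure 0 T]_t (\int[dx]_x (v t x * dP (t, x)) + \int[dx]_x (fser (P t) x * bP (t, x))).
  apply: eq_Rintegral => t _; rewrite fser_P//; last exact: continuous_slice.
  rewrite RintegralD//.
  - by congr (_ + _); apply: eq_Rintegral => x _; rewrite mulrC.
  - under eq_fun do rewrite mulrC; apply: (@slice_prod (fun z => v z.1 z.2) t r0) => //.
      exact: (measurable_fser (sc t)).
    by move=> x; exact: (fser_le x (cb t)).
  - under eq_fun do rewrite mulrC; apply: (@slice_prod (fun z => cube (c z.1) z.2) t ((1 - r0) ^- 3)) => //.
      exact: measurable_cube (cb t) r1.
    by move=> x; exact: cube_bound (cb t) r1 x.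
by rewrite E// subrr.
Qed.

Lemma weak_integrable : (interval_measure 0 T \x dx)%E.-integrable setT
  (EFin \o (fun z => dP z * v z.1 z.2 + bP z * cube (c z.1) z.2)).
Proof.
apply: (@integrable_interval_prod _ _ _ _ _ _ (M1 * r0 + M2 * (1 - r0) ^- 3)).
  have mv : measurable_fun setT (fun z : R * point => v z.1 z.2) by exact: measurable_fser2.
  apply: measurable_funD; apply: measurable_funM => //; try exact: continuous_pair_measurable.
  apply: measurable_inv_cube => // z; rewrite (le_trans (fser_le z.2 (cb z.1)))// ltW//.
move=> z zT; rewrite (le_trans (ler_normD _ _))// lerD// normrM ler_pM ?HM1 ?HM2//.
  exact: fser_le.
exact: cube_bound (cb z.1) r1 z.2.
Qed.

End weak_formulation.

End evolution.

(** The integral of a nonnegative function is a supremum over simple functions below it, hence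
    monotone without measurability. Norms of v can thus be bounded in time without proving that they
    depend measurably on it. *)
Lemma le_integral_nonmeasurable {disp : measure_display} {T : measurableType disp} {R : realType}
    (mu : {measure set T -> \bar R}) (f g : T -> \bar R) : (forall x, 0 <= f x)%E ->
  (forall x, f x <= g x)%E -> (\int[mu]_x f x <= \int[mu]_x g x)%E.
Proof.
move=> f0 fg; have g0 x : (0 <= g x)%E by exact: le_trans (f0 x) (fg x).
rewrite !ge0_integralTE//; apply: ge_ereal_sup => _ [h hf <-].
by apply: ereal_sup_ubound; exists h => // x; exact: le_trans (hf x) (fg x).
Qed.

Lemma Lnorm_lt_pinfty {disp : measure_display} {T : measurableType disp} {R : realType}
    (mu : {measure set T -> \bar R}) (p : R) (f g : T -> \bar R) :
  (forall x, `|f x| `^ p <= g x)%E -> (\int[mu]_x g x < +oo)%E -> ('N[mu]_(p%:E)[f] < +oo)%E.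
Proof.
move=> fg gi; rewrite unlock.
have : (\int[mu]_x (`|f x| `^ p) < +oo)%E.
  by apply: le_lt_trans gi; apply: le_integral_nonmeasurable => // x; exact: poweR_ge0.
exact: poweR_lty.
Qed.

(** * Regularity in time *)

Section dominated_norms.
Context {R : realType} {d : nat}.
Local Notation nk := (@normk R d).
Local Notation point := 'rV[R]_d.
Local Notation freq := 'rV[int]_d.
Local Notation dx := (torus_measure R d).
Implicit Types (k : freq) (b : freq -> R * R).

Definition weight4 k : R := 1 + nk k ^+ 4.

Lemma weight4_ge0 k : 0 <= weight4 k.
Proof. by rewrite addr_ge0// exprn_ge0// normk_ge0. Qed.

Lemma le_weight4 j k : (j <= 4)%N -> nk k ^+ j <= weight4 k.
Proof.
move=> j4; rewrite /weight4; have n0 : 0 <= nk k by exact: normk_ge0.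
have [n1|n1] := leP (nk k) 1.
  by rewrite (le_trans (exprn_ile1 _ n0 n1))// lerDl exprn_ge0.
by rewrite (le_trans (ler_weXn2l (ltW n1) j4))// lerDr.
Qed.

Lemma bsum_weight4 j b M : (j <= 4)%N -> bsum weight4 b M -> bsum (fun k => nk k ^+ j) b M.
Proof.
by move=> j4 h n; apply: le_trans (h n); apply: ler_sum => k _; rewrite ler_wpM2r ?amp_ge0// le_weight4.
Qed.

Lemma bsum_weight4_1 b M : bsum weight4 b M -> bsum (fun=> 1) b M.
Proof. by move=> h; apply: bsum_expr0; exact: (bsum_weight4 (j := 0)). Qed.

(* The norms for which convergence of [fser b] is implied by that of the
   absolutely convergent series of the [weight4 k * amp (b k)]. *)
Definition dominated (N : (point -> R) -> \bar R) : Prop := (forall u, (0 <= N u)%E) /\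
  exists2 C : R, 0 <= C & forall b M, bsum weight4 b M -> (N (fser b) <= (C * M)%:E)%E.

Lemma Lp_norm_ge0 p (u : point -> R) : (0 <= Lp_norm p u)%E.
Proof. by rewrite /Lp_norm; case: ifP => // _; exact: Lnorm_ge0. Qed.

Lemma dominated_infty : dominated (Lp_norm +oo).
Proof.
split; first exact: Lp_norm_ge0.
by exists 1 => // b M h; rewrite mul1r; apply: Lp_norm_infty_fser; exact: bsum_weight4_1.
Qed.

Lemma dominated_sobolev n : (n <= 4)%N -> dominated (sobolev_norm n +oo).
Proof.
move=> n4; split.
  move=> u; apply: le_ereal_inf_tmp => _ [g _ ->]; apply: sume_ge0 => m _; exact: Lp_norm_ge0.
exists #|{ffun 'I_d -> 'I_n.+1}|%:R => // b M h; apply: sobolev_norm_fser => j jn.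
by apply: bsum_weight4 h; exact: leq_trans n4.
Qed.

Lemma dominated_sobolev2 : dominated (sobolev2_norm 2).
Proof.
split; first by move=> u; rewrite /sobolev2_norm; case: ifP => // _; exact: poweR_ge0.
exists 1 => // b M h; apply: le_trans (sobolev2_norm_fser (bsum_weight4_1 h) (bsum_weight4 (leqnn 4) h)) _.
have M0 : 0 <= M by exact: bsum_ge0 h.
by rewrite poweR_EFin powR12_sqrt ?mulr_ge0// -expr2 sqrtr_sqr ger0_norm// mul1r.
Qed.

(** Truncated coefficients form again a coefficient sequence, so that the estimates for [fser], in
    particular [dominated], apply to finite sums. *)
Definition trunc n b k : R * R := if k \in freqs n then b k else 0.

Lemma sum_trunc (w : freq -> R) n m b : \sum_(k <- freqs m) w k * amp (trunc n b k) <=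
  \sum_(k <- freqs n) `|w k| * amp (b k).
Proof.
have p k : 0 <= `|w k| * amp (trunc n b k) by rewrite mulr_ge0 ?amp_ge0.
apply: (@le_trans _ _ (\sum_(k <- freqs m) `|w k| * amp (trunc n b k))).
  by apply: ler_sum => k _; rewrite ler_wpM2r ?amp_ge0// ler_norm.
apply: (@le_trans _ _ (\sum_(k <- freqs (maxn m n)) `|w k| * amp (trunc n b k))).
  by apply: sum_freqs_mono => //; exact: leq_maxl.
rewrite (bigID (fun k => k \in freqs n))/= [X in _ + X]big1 ?addr0.
  rewrite -big_filter (perm_big (freqs n)); last first.
    apply: uniq_perm; rewrite ?filter_uniq ?uniq_freqs// => k.
    rewrite mem_filter !mem_freqs; case: (ltnP (pickle k) n) => //= kn.
    by rewrite (leq_trans kn)// leq_maxr.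
  by rewrite big_seq [leRHS]big_seq; apply: ler_sum => k kn; rewrite /trunc kn.
by move=> k /negbTE kn; rewrite /trunc kn amp0 mulr0.
Qed.

Lemma bsum_trunc n b : bsum weight4 (trunc n b) (\sum_(k <- freqs n) weight4 k * amp (b k)).
Proof.
move=> m; apply: le_trans (sum_trunc weight4 n m b) _; apply: ler_sum => k _.
by rewrite ger0_norm// weight4_ge0.
Qed.

Lemma fser_trunc n b x : fser (trunc n b) x = ptrig b n x.
Proof.
apply/cvg_lim => //; apply: cvg_near_cst; near=> m.
have nm : (n <= m)%N by near: m; exact: nbhs_infty_ge.
rewrite /ptrig (bigID (fun k => k \in freqs n))/= [X in _ + X]big1 ?addr0.
  rewrite -big_filter (perm_big (freqs n)); last first.
    apply: uniq_perm; rewrite ?filter_uniq ?uniq_freqs// => k.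
    rewrite mem_filter !mem_freqs; case: (ltnP (pickle k) n) => //= kn.
    by rewrite (leq_trans kn).
  by rewrite big_seq [RHS]big_seq; apply: eq_bigr => k kn; rewrite /trunc kn.
by move=> k /negbTE kn; rewrite /trunc kn /trig /= !mul0r addr0.
Unshelve. all: by end_near. Qed.

Lemma dominated_ptrig N n b : dominated N -> (N (ptrig b n) < +oo)%E.
Proof.
move=> [_ [C C0 NC]]; rewrite (_ : ptrig b n = fser (trunc n b)); last first.
  by apply/funext => x; rewrite fser_trunc.
exact: le_lt_trans (NC _ _ (bsum_trunc n b)) (ltry _).
Qed.

Lemma dominated_cvg N (b : nat -> freq -> R * R) (M : nat -> R) : dominated N ->
  (forall n, bsum weight4 (b n) (M n)) -> M @ \oo --> 0 -> (fun n => N (fser (b n))) @ \oo --> 0%E.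
Proof.
move=> [N0 [C C0 NC]] bM M0; apply: (@squeeze_cvge _ _ _ _ (fun=> 0%E) _ (fun n => (C * M n)%:E)).
- by apply: nearW => n; rewrite N0 NC.
- exact: cvg_cst.
- apply: cvg_EFin; first by apply: nearW.
  by rewrite -(mulr0 C); apply: cvgMl_tmp.
Qed.

End dominated_norms.

Section time_regularity.
Context {R : realType} {d : nat}.
Local Notation nk := (@normk R d).
Local Notation point := 'rV[R]_d.
Local Notation freq := 'rV[int]_d.
Local Notation dx := (torus_measure R d).
Context (r0 B : R) (c : R -> freq -> R * R).
Hypotheses (cb : forall t, bsum (fun=> 1) (c t) r0) (B0 : 0 <= B)
  (clip : forall s t k, amp (c t k - c s k) <= `|t - s| * (nk k ^+ 4 * B))
  (cc : forall k, continuous (fun t => (c t k).1) /\ continuous (fun t => (c t k).2))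
  (int_moment4 : forall T, 0 <= T -> (\int[interval_measure 0 T]_t moment4 c t < +oo)%E).

Let sc t : summable_coef (c t). Proof. by exists r0; exact: cb. Qed.
Let r00 : 0 <= r0. Proof. exact: bsum_ge0 (cb 0). Qed.

Lemma bsum_weight4_moment4 t (M : R) : (moment4 c t <= M%:E)%E -> bsum weight4 (c t) (r0 + M).
Proof.
move=> GM n; under eq_bigr do rewrite mulrDl; rewrite big_split; apply: lerD; first exact: cb.
exact: bsum4_moment4.
Qed.

Let lipsum n : R := \sum_(k <- freqs n : seq freq) weight4 k * (nk k ^+ 4 * B).

(** The Lipschitz constants grow with the frequency, so the time grid is refined along with the
    truncation: the weighted Lipschitz error over all of [freqs n] is at most 1 / (n + 1). *)
Definition mesh n : nat := (Num.truncn (n.+1%:R * lipsum n)).+1.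

Lemma mesh_gt0 n : 0 < (mesh n)%:R :> R. Proof. by []. Qed.

Lemma meshP n : lipsum n / (mesh n)%:R <= n.+1%:R^-1.
Proof.
rewrite ler_pdivrMr// mulrC ler_pdivlMr// mulrC ltW// /mesh; exact: truncnS_gt.
Qed.

Definition cell n (j : nat) : set R := `[j%:R / (mesh n)%:R, j.+1%:R / (mesh n)%:R[%classic.

(** Truncation to [freqs n] combined with sampling at the left ends of cells. The [n * mesh n] cells
    cover the times from 0 to n, hence eventually any bounded interval. *)
Definition approx n t x : R :=
  \sum_(j < (n * mesh n)%N) \1_(cell n j) t * ptrig (c (j%:R / (mesh n)%:R)) n x.

Lemma simple_approx N n : dominated N -> simple_in N (approx n).
Proof.
move=> dN; exists (n * mesh n)%N, (fun j => cell n j), (fun j => ptrig (c (j%:R / (mesh n)%:R)) n).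
split => //; first by move=> j; exact: measurable_itv.
by move=> j; exact: dominated_ptrig.
Qed.

Lemma approxE n t : 0 <= t -> t < n%:R -> exists2 s : R, `|t - s| <= (mesh n)%:R^-1 &
  forall x, approx n t x = ptrig (c s) n x.
Proof.
move=> t0 tn; have m0 := mesh_gt0 n; pose j := Num.truncn (t * (mesh n)%:R).
have /truncn_itv/andP[j1 j2] : 0 <= t * (mesh n)%:R by rewrite mulr_ge0.
exists (j%:R / (mesh n)%:R).
  rewrite ger0_norm ?subr_ge0 ?ler_pdivrMr//.
  by rewrite lerBlDl -[X in _ + X]mul1r -mulrDl ler_pdivlMr// natr1 ltW.
move=> x; have jn : (j < n * mesh n)%N.
  by rewrite -(ltr_nat R) natrM (le_lt_trans j1)// ltr_pM2r.
have cellP (i : nat) : cell n i t <-> i = j.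
  rewrite /cell /= in_itv/= ler_pdivrMr// ltr_pdivlMr//; split=> [/andP[i1 i2]|->]; last by rewrite j1 j2.
  apply/eqP; rewrite eqn_leq -ltnS -[X in _ && X]ltnS -(ltr_nat R) -[X in _ && X](ltr_nat R).
  by rewrite (le_lt_trans i1 j2) (le_lt_trans j1 i2).
rewrite /approx (bigD1 (Ordinal jn))//= big1 ?addr0.
  by rewrite indicE mem_set ?mul1r//; exact/cellP.
move=> i ij; rewrite indicE memNset ?mul0r// => /cellP E.
by move: ij; rewrite -val_eqE /= E eqxx.
Qed.

(** At almost every time the fourth moment is finite. There, in the weighted norm, sampling costs at
    most 1 / (n + 1) and truncation the tail of a convergent series. *)
Lemma strongly_measurable_fser T N : 0 <= T -> dominated N ->
  strongly_measurable T N (fun t => fser (c t)).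
Proof.
move=> T0 dN; exists approx; first by move=> n; exact: simple_approx.
have ae : {ae interval_measure 0 T, forall t, exists M : R, (moment4 c t <= M%:E)%E}.
  have mG : measurable_fun setT (moment4 c).
    exact: measurable_moment4.
  have iG : (interval_measure 0 T).-integrable setT (moment4 c).
    apply/integrableP; split => //.
    by under eq_integral do rewrite (gee0_abs (moment4_ge0 _ _)); exact: int_moment4.
  apply: filterS (integrable_ae measurableT iG) => t /(_ Logic.I) Gf.
  by exists (fine (moment4 c t)); rewrite fineK.
apply: filterS2 ae (ae_interval 0 T) => t [M GM] /andP[t0 tT].
have cW := bsum_weight4_moment4 GM.
pose W n := \sum_(k <- freqs n) weight4 k * amp (c t k).
have Wnd : nondecreasing_seq W by apply: sum_freqs_mono => k; rewrite mulr_ge0 ?weight4_ge0 ?amp_ge0.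
have Wub : has_ubound (range W) by exists (r0 + M) => _ [n _ <-]; exact: cW.
have Wcv : cvgn W by exact: nondecreasing_is_cvgn.
have [n0 n0T] : exists n0 : nat, T < n0%:R by exists (Num.truncn T).+1; exact: truncnS_gt.
have /choice[s sP] n : exists s : R, (n0 <= n)%N -> `|t - s| <= (mesh n)%:R^-1 /\
    forall x, approx n t x = ptrig (c s) n x.
  have [nn|_] := leqP n0 n; last by exists 0.
  have tn : t < n%:R by rewrite (le_lt_trans tT)// (lt_le_trans n0T)// ler_nat.
  by have [s s1 s2] := approxE t0 tn; exists s.
pose b n k := trunc n (c (s n)) k - c t k.
pose Mn n := n.+1%:R^-1 + (limn W - W n).
(* Before rank [n0] the time may lie beyond the cells; the zero sequence put there keeps the bound
   [Mn] valid for all n. *)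
suff : (fun n => N (fser (if (n0 <= n)%N then b n else fun=> 0))) @ \oo --> 0%E.
  apply: cvg_trans; apply: near_eq_cvg; near=> n.
  have nn : (n0 <= n)%N by near: n; exact: nbhs_infty_ge.
  rewrite nn; congr N; apply/funext => x; have [_ ->] := sP n nn.
  by rewrite /b fserB ?fser_trunc//; exists (\sum_(k <- freqs n) weight4 k * amp (c (s n) k)); exact/bsum_weight4_1/bsum_trunc.
apply: (dominated_cvg (M := Mn)) => //; last first.
  rewrite /Mn -[X in _ --> X](addr0 0); apply: cvgD; first exact: cvg_harmonic.
  by rewrite -(subrr (limn W)); apply: cvgB => //; exact: cvg_cst.
move=> n m; have Mn0 : 0 <= Mn n.
  by rewrite addr_ge0// subr_ge0; exact: nondecreasing_cvgn_le.
case: ifP => nn; last first.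
  by rewrite big1// => k _; rewrite amp0 mulr0.
have [ts _] := sP n nn.
pose m' := maxn m n.
apply: (@le_trans _ _ (\sum_(k <- freqs m') weight4 k * amp (b n k))).
  by apply: sum_freqs_mono; [move=> k; rewrite mulr_ge0 ?weight4_ge0 ?amp_ge0|exact: leq_maxl].
have E (F : freq -> R) : \sum_(k <- freqs m') F k =
    \sum_(k <- freqs n) F k + \sum_(k <- freqs m' | k \notin freqs n) F k.
  rewrite (bigID (fun k => k \in freqs n))/=; congr (_ + _).
  rewrite -big_filter; apply: perm_big; apply: uniq_perm; rewrite ?filter_uniq ?uniq_freqs// => k.
  rewrite mem_filter !mem_freqs; case: (ltnP (pickle k) n) => //= kn.
  by rewrite (leq_trans kn)// leq_maxr.
rewrite E; apply: lerD.
  apply: le_trans (meshP n); rewrite /lipsum mulr_suml big_seq [leRHS]big_seq; apply: ler_sum => k kn.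
  rewrite -mulrA ler_wpM2l ?weight4_ge0// /b /trunc kn; apply: le_trans (clip _ _ _) _.
  by rewrite mulrC ler_wpM2l ?mulr_ge0 ?exprn_ge0 ?normk_ge0// distrC.
rewrite lerBrDl; apply: le_trans (_ : W m' <= _); last exact: nondecreasing_cvgn_le.
rewrite /W [leRHS]E lerD2l; apply: ler_sum => k /negbTE kn.
by rewrite ler_wpM2l ?weight4_ge0// /b /trunc kn sub0r ampN.
Unshelve. all: by end_near. Qed.

Local Notation v := (fun t => fser (c t)).

Let mc k : measurable_fun setT (fun t => (c t k).1) /\ measurable_fun setT (fun t => (c t k).2).
Proof. by have [h1 h2] := cc k; split; exact: continuous_measurable_fun. Qed.

Lemma jointly_measurable_fser : jointly_measurable v.
Proof. exact: measurable_fser2. Qed.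

Lemma bochner_infty T : 0 <= T -> bochner T +oo%E (Lp_norm +oo%E) v.
Proof.
move=> T0; split; first exact: jointly_measurable_fser.
  by apply: strongly_measurable_fser => //; exact: dominated_infty.
apply: le_lt_trans (ltry r0); apply: Lnorm_infty_le => //; apply: aeW => t /=.
by rewrite gee0_abs ?Lp_norm_ge0// Lp_norm_infty_fser.
Qed.

Let mG : measurable_fun setT (moment4 c). Proof. exact: measurable_moment4. Qed.

Lemma affine_moment4_integral T (K : R) : 0 <= T -> 0 <= K ->
  (\int[interval_measure 0 T]_t (K%:E * (1 + moment4 c t)) < +oo)%E.
Proof.
move=> T0 K0; rewrite ge0_integralZl//; first last.
- by move=> t _; rewrite adde_ge0// moment4_ge0.
- exact: emeasurable_funD.
rewrite ge0_integralD//; last by move=> t _; exact: moment4_ge0.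
rewrite integral_cst// mul1e lte_mul_pinfty//.
rewrite lte_add_pinfty//; last exact: int_moment4.
by rewrite -ge0_fin_numE// fin_num_measure.
Qed.

Lemma bochner_sobolev2 T : 0 <= T -> bochner T 2%:E (sobolev2_norm 2) v.
Proof.
move=> T0; have [p0 _] := @dominated_sobolev2 R d.
split; [exact: jointly_measurable_fser|by apply: strongly_measurable_fser => //; exact: dominated_sobolev2|].
apply: (@Lnorm_lt_pinfty _ _ _ _ 2 _ (fun t => ((1 + r0)%:E * (1 + moment4 c t))%E)); last first.
  by apply: affine_moment4_integral => //; rewrite addr_ge0.
move=> t /=; rewrite gee0_abs//.
have r1 : 0 < 1 + r0 by rewrite ltr_wpDr.
have [M GM] : exists M : R, moment4 c t = M%:E \/ moment4 c t = +oo%E.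
  by case: (moment4 c t) (moment4_ge0 c t) => [M _|_|//]; [exists M; left|exists 0; right].
case: GM => GM; last by rewrite GM addey// gt0_muley ?lte_fin// leey.
have M0 : 0 <= M by rewrite -lee_fin -GM moment4_ge0.
have c4 : bsum (fun k => nk k ^+ 4) (c t) M by apply: bsum4_moment4; rewrite GM.
apply: le_trans (le_poweR _ _ (sobolev2_norm_fser (cb t) c4)) _ => //.
rewrite GM !poweR_EFin powR12_sqrt ?mulr_ge0// powR_mulrn ?sqrtr_ge0// sqr_sqrtr ?mulr_ge0//.
rewrite lee_fin; nra.
Qed.

Lemma bochner_sobolev T : 0 <= T -> bochner T (4 / 3)%:E (sobolev_norm 3 +oo%E) v.
Proof.
move=> T0; have [p0 _] := @dominated_sobolev R d 3 isT.
split; [exact: jointly_measurable_fser|by apply: strongly_measurable_fser => //; exact: dominated_sobolev|].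
pose Q : R := #|{ffun 'I_d -> 'I_4}|%:R; pose K := Q * (2 * r0 + 1) + 1.
have K0 : 0 < K by rewrite ltr_wpDl// mulr_ge0// addr_ge0// mulr_ge0.
apply: (@Lnorm_lt_pinfty _ _ _ _ (4 / 3) _ (fun t => ((K `^ (4 / 3))%:E * (1 + moment4 c t))%E)); last first.
  by apply: affine_moment4_integral => //; rewrite powR_ge0.
move=> t /=; rewrite gee0_abs//.
have Kp : 0 < K `^ (4 / 3) by rewrite powR_gt0.
have [M GM] : exists M : R, moment4 c t = M%:E \/ moment4 c t = +oo%E.
  by case: (moment4 c t) (moment4_ge0 c t) => [M _|_|//]; [exists M; left|exists 0; right].
case: GM => GM; last by rewrite GM addey// gt0_muley ?lte_fin// leey.
have M0 : 0 <= M by rewrite -lee_fin -GM moment4_ge0.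
have c4 : bsum (fun k => nk k ^+ 4) (c t) M by apply: bsum4_moment4; rewrite GM.
(* |k|^3 <= |k|^4 / lam + lam^3, with lam chosen to balance both terms *)
pose lam := (1 + M) `^ 4^-1.
have lam1 : 1 <= lam by rewrite -(powRr0 (1 + M)) ler_powR// lerDl.
have lam0 : 0 < lam by exact: lt_le_trans lam1.
have lam4 : lam ^+ 4 = 1 + M.
  rewrite -powR_mulrn ?ltW// /lam -powRrM mulVf// powRr1// addr_ge0//.
(* The constant adds 1 + lam^3 <= 2 lam^3, taken against [r0], and M / lam <= lam^3, which follows
   from lam^4 = 1 + M. *)
have c3 j : (j <= 3)%N -> bsum (fun k => nk k ^+ j) (c t) ((2 * r0 + 1) * lam ^+ 3).
  move=> j3 n; apply: (@le_trans _ _ (\sum_(k <- freqs n) ((1 + lam ^+ 3) * amp (c t k) + lam^-1 * (nk k ^+ 4 * amp (c t k))))).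
    apply: ler_sum => k _; rewrite mulrA -mulrDl ler_wpM2r ?amp_ge0//.
    have n0 : 0 <= nk k by exact: normk_ge0.
    have [n1|n1] := leP (nk k) lam.
      apply: (@le_trans _ _ (1 + lam ^+ 3)); last by rewrite lerDl mulr_ge0 ?exprn_ge0 ?invr_ge0 ?(ltW lam0).
      have [k1|k1] := leP (nk k) 1.
        by rewrite (le_trans (exprn_ile1 _ n0 k1))// lerDl exprn_ge0// ltW.
      rewrite (le_trans (ler_weXn2l (ltW k1) j3))// (le_trans (lerXn2r 3 n0 (ltW lam0) n1))// lerDr//.
    have k1 : 1 <= nk k by rewrite (le_trans lam1)// ltW.
    rewrite (le_trans (ler_weXn2l k1 j3))//.
    apply: (@le_trans _ _ (lam^-1 * nk k ^+ 4)); last by rewrite lerDr addr_ge0// exprn_ge0// ltW.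
    by rewrite mulrC ler_pdivlMr// [leRHS]exprSr ler_wpM2l ?exprn_ge0// ltW.
  rewrite big_split/= -!mulr_sumr.
  have h1 := bsum1 (cb t) n; have h2 := c4 n.
  have lamV : lam^-1 * M <= lam ^+ 3.
    by rewrite mulrC ler_pdivrMr// -exprSr lam4 lerDr.
  have l3 : 1 <= lam ^+ 3 by rewrite exprn_ege1.
  apply: (@le_trans _ _ ((1 + lam ^+ 3) * r0 + lam^-1 * M)).
    by rewrite lerD// ler_wpM2l ?invr_ge0 ?(ltW lam0)// addr_ge0// exprn_ge0// ltW.
  have l3r := ler_wpM2l r00 l3; move: (lam^-1 * M) (lam ^+ 3) lamV l3 l3r => X Y XY Y1 rY.
  by rewrite !mulrDl; lra.
apply: le_trans (le_poweR _ _ (sobolev_norm_fser c3)) _ => //.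
rewrite GM -EFinD -EFinM poweR_EFin lee_fin -/Q.
(* The exponent 4/3 is the one for which the bound becomes linear in the fourth moment, hence
   integrable. *)
have -> : 1 + M = (lam ^+ 3) `^ (4 / 3).
  rewrite -powR_mulrn ?ltW// -powRrM (_ : 3%:R * (4 / 3) = 4%:R :> R); last by field.
  by rewrite powR_mulrn ?ltW.
rewrite -powRM ?(ltW K0) ?exprn_ge0 ?(ltW lam0)//.
rewrite ge0_ler_powR ?nnegrE ?mulr_ge0 ?exprn_ge0 ?(ltW lam0) ?(ltW K0) ?addr_ge0 ?mulr_ge0//.
by rewrite mulrA ler_wpM2r ?exprn_ge0 ?(ltW lam0)// /K lerDl.
Qed.

End time_regularity.

Lemma Rintegral_indic {disp : measure_display} {X : measurableType disp} {R : realType}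
    (mu : {measure set X -> \bar R}) (A : set X) (f : X -> R) :
  \int[mu]_(x in A) f x = \int[mu]_x (\1_A x * f x).
Proof.
rewrite Rintegral_mkcond; apply: eq_Rintegral => x _.
by rewrite patchE indicE; case: (x \in A); rewrite ?mul1r ?mul0r.
Qed.

(** * The vector measure of density v *)

Section radon.
Context {R : realType} {d : nat}.
Local Notation nk := (@normk R d).
Local Notation point := 'rV[R]_d.
Local Notation freq := 'rV[int]_d.
Local Notation dx := (torus_measure R d).

Section mean.
Context (T r0 : R) (b : R -> freq -> R * R) (W : R -> R).
Local Notation I := (interval_measure 0 T).
Hypotheses (br : forall t, bsum (fun=> 1) (b t) r0)
  (mb : forall k, measurable_fun setT (fun t => (b t k).1) /\ measurable_fun setT (fun t => (b t k).2))
  (W0 : forall t, 0 <= W t) (iW : I.-integrable setT (EFin \o W))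
  (bW : {ae I, forall t, bsum weight4 (b t) (W t)}).

Definition mean k : R * R := (\int[I]_t (b t k).1, \int[I]_t (b t k).2).

Let ib k : I.-integrable setT (EFin \o (fun t => (b t k).1)) /\
  I.-integrable setT (EFin \o (fun t => (b t k).2)).
Proof.
have [m1 m2] := mb k; have h t := bsum_amp k (br t).
split; apply: (@integrable_bounded _ _ _ _ _ r0) => // t; apply: le_trans (h t).
  exact: norm_fst_le_amp.
exact: norm_snd_le_amp.
Qed.

Let ihyp k : I.-integrable setT (EFin \o (fun t => amp (b t k))).
Proof.
have [m1 m2] := mb k; apply: (@integrable_bounded _ _ _ _ _ r0); first exact: measurable_amp.
by move=> t; rewrite ger0_norm ?amp_ge0//; exact: bsum_amp.
Qed.

(** Minkowski's inequality frequency by frequency, in the form [amp_Rintegral_le]; the bound by [W]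
    is then integrated almost everywhere. *)
Lemma bsum_mean : bsum weight4 mean (\int[I]_t W t).
Proof.
move=> n; apply: (@le_trans _ _ (\int[I]_t (\sum_(k <- freqs n) weight4 k * amp (b t k)))).
  rewrite Rintegral_sum; last by move=> k; apply: integrableRZ; exact: ihyp.
  apply: ler_sum => k _; rewrite RintegralZl; [|exact: measurableT|exact: ihyp].
  rewrite ler_wpM2l ?weight4_ge0//.
  have [i1 i2] := ib k; exact: amp_Rintegral_le.
apply: ae_le_Rintegral => //.
- by apply: measurable_sum => k; apply: measurable_funM => //; have [m1 m2] := mb k; exact: measurable_amp.
- by move=> t; apply: sumr_ge0 => k _; rewrite mulr_ge0 ?weight4_ge0 ?amp_ge0.
- by apply: filterS bW => t h; exact: h.
Qed.

(** The partial sums are bounded by [r0] uniformly in time, so integral and series commute. *)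
Lemma fser_mean x : \int[I]_t fser (b t) x = fser mean x.
Proof.
have sb t : summable_coef (b t) by exists r0.
have mtr n : measurable_fun setT (fun t => ptrig (b t) n x).
  apply: measurable_sum => k; rewrite /trig; have [m1 m2] := mb k.
  by apply: measurable_funD; exact: measurable_funM.
have mf : measurable_fun setT (fun t => fser (b t) x).
  apply: (@fun_cvg_measurable _ _ _ (fun n t => ptrig (b t) n x)) => // t; exact: fser_cvg.
have cv := Rbounded_cvg (mu := I) mtr (fun n t => ptrig_le n x (br t)) (fun t => fser_cvg (x := x) (sb t)).
suff E n : \int[I]_t ptrig (b t) n x = ptrig mean n x.
  by apply/esym/cvg_lim => //; move: cv; under eq_fun do rewrite E.
rewrite Rintegral_sum; last first.
  move=> k; have [i1 i2] := ib k; rewrite /trig.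
  by apply: integrableRD; [exact: (integrableZr measurableT _ i1)|exact: (integrableZr measurableT _ i2)].
apply: eq_bigr => k _; have [i1 i2] := ib k; rewrite /trig RintegralD//.
- by rewrite !RintegralZr.
- exact: (integrableZr measurableT _ i1).
- exact: (integrableZr measurableT _ i2).
Qed.

End mean.

Context (T r0 : R) (c : R -> freq -> R * R) (W : R -> R).
Local Notation I := (interval_measure 0 T).
Hypotheses (cb : forall t, bsum (fun=> 1) (c t) r0)
  (mc : forall k, measurable_fun setT (fun t => (c t k).1) /\ measurable_fun setT (fun t => (c t k).2))
  (W0 : forall t, 0 <= W t) (iW : I.-integrable setT (EFin \o W))
  (cW : {ae I, forall t, bsum weight4 (c t) (W t)}).

Let r00 : 0 <= r0. Proof. exact: bsum_ge0 (cb 0). Qed.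
Let sc t : summable_coef (c t). Proof. by exists r0; exact: cb. Qed.
Let mW : measurable_fun setT W.
Proof. by apply/measurable_EFinP; have /integrableP[] := iW. Qed.

Definition vmeas (A : set R) (x : point) : R := \int[I]_(t in A) fser (c t) x.
(** The scalar measure of density [W], which up to a constant dominates the variation of [vmeas] in
    every dominated norm. *)
Definition wmeas (A : set R) : R := \int[I]_t (\1_A t * W t).

Let cut (A : set R) t k : R * R := (\1_A t * (c t k).1, \1_A t * (c t k).2).

Let cut_cases A t : cut A t = c t \/ cut A t = fun=> 0.
Proof.
rewrite /cut indicE; case: (t \in A); [left|right]; apply/funext => k.
  by rewrite !mul1r; case: (c t k).
by rewrite !mul0r.
Qed.

Let bsum0 (w : freq -> R) M : 0 <= M -> bsum w (fun=> 0) M.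
Proof. by move=> M0 n; rewrite big1// => k _; rewrite amp0 mulr0. Qed.

Lemma fser_cst0 (x : point) : fser (fun=> 0 : R * R) x = 0 :> R.
Proof.
apply/eqP; rewrite -normr_le0; apply: fser_le; exact: bsum0.
Qed.

Lemma integrable_indicW A : measurable A -> I.-integrable setT (EFin \o (fun t => \1_A t * W t)).
Proof.
move=> mA; rewrite (_ : (fun t => _) = fun t => W t * \1_A t); last by apply/funext => t; rewrite mulrC.
apply: (integrableR_bmul (N := 1)) => // t; rewrite indicE; case: (t \in A); rewrite ?normr1 ?normr0//.
Qed.

Lemma wmeas_ge0 A : 0 <= wmeas A.
Proof. by apply: Rintegral_ge0 => t _; rewrite mulr_ge0. Qed.

(** Restriction to [A] multiplies the coefficients by an indicator, so the vector measure of [A] is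
    the series of their time integrals and all dominated norms apply to it. *)
Lemma vmeasE A : measurable A -> exists2 b, bsum weight4 b (wmeas A) & forall x, vmeas A x = fser b x.
Proof.
move=> mA; have mcut k : measurable_fun setT (fun t => (cut A t k).1) /\ measurable_fun setT (fun t => (cut A t k).2).
  by have [m1 m2] := mc k; split; apply: measurable_funM.
have br t : bsum (fun=> 1) (cut A t) r0.
  by have [->|->] := cut_cases A t; [exact: cb|exact: bsum0].
have cutW : {ae I, forall t, bsum weight4 (cut A t) (\1_A t * W t)}.
  apply: filterS cW => t ct; rewrite /cut indicE; case: (t \in A).
    rewrite mul1r (_ : (fun k => _) = c t)//; apply/funext => k.
    by rewrite !mul1r; case: (c t k).
  rewrite mul0r (_ : (fun k => _) = fun=> 0); first exact: bsum0.
  by apply/funext => k; rewrite !mul0r.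
exists (mean T (cut A)).
  apply: (@bsum_mean _ r0) => //; first by move=> t; rewrite mulr_ge0.
  exact: integrable_indicW.
move=> x; rewrite -(fser_mean _ br mcut).
rewrite /vmeas Rintegral_indic; apply: eq_Rintegral => t _.
rewrite /cut indicE; case: (t \in A).
  rewrite mul1r; congr fser; apply/funext => k; by rewrite !mul1r; case: (c t k).
rewrite mul0r -[LHS](fser_cst0 x); congr fser; apply/funext => k; by rewrite !mul0r.
Qed.

Definition tail (F : nat -> set R) n : set R := \bigcup_(i in [set i | (n <= i)%N]) F i.

Lemma indic_tailS F n t : trivIset setT F -> \1_(tail F n) t = \1_(F n) t + \1_(tail F n.+1) t :> R.
Proof.
move=> tF; rewrite !indicE; have [/set_mem tn|tn] := boolP (t \in F n).
  have -> : t \in tail F n by apply/mem_set; exists n => /=.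
  rewrite memNset ?addr0// => -[j /= nj Fj]; have E : n = j by apply: (tF n j) => //; exists t.
  by move: nj; rewrite E ltnn.
rewrite add0r; congr (nat_of_bool _)%:R; apply/idP/idP => /set_mem[j /= nj Fj]; apply/mem_set.
  exists j => //=; rewrite ltn_neqAle nj andbT; apply: contra tn => /eqP ->; exact/mem_set.
by exists j => //=; exact: ltnW.
Qed.

Lemma indic_tail (F : nat -> set R) n t : trivIset setT F ->
  \1_(\bigcup_i F i) t = \sum_(i < n) \1_(F i) t + \1_(tail F n) t :> R.
Proof.
move=> tF; elim: n => [|n IH]; last by rewrite big_ord_recr/= -addrA -indic_tailS.
by rewrite big_ord0 add0r; congr (\1_ _ t); apply: eq_bigcupl; split.
Qed.

Lemma measurable_tail F n : (forall i, measurable (F i)) -> measurable (tail F n).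
Proof. by move=> mF; apply: bigcup_measurable. Qed.

Lemma wmeas_tail F : (forall i, measurable (F i)) -> trivIset setT F ->
  (fun n => wmeas (tail F n)) @ \oo --> 0.
Proof.
move=> mF tF; rewrite /wmeas -[X in _ --> X](_ : \int[I]_t (fun=> 0 : R) t = 0); last first.
  by rewrite Rintegral_cstT mul0r.
apply: (proj2 (@Rdominated_cvg _ _ _ I (fun n t => \1_(tail F n) t * W t) (fun=> 0) W _ _ _ _ _)) => //.
- by move=> n; apply: measurable_funM => //; apply: measurable_indic; exact: measurable_tail.
- apply: aeW => t; apply: cvg_near_cst.
  have [[j _ tj]|nt] := pselect ((\bigcup_i F i) t).
    near=> n; have jn : (j < n)%N by near: n; exact: nbhs_infty_gt.
    rewrite indicE memNset ?mul0r// => -[i /= ni Fi].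
    have E : i = j by apply: (tF i j) => //; exists t.
    by move: ni; rewrite E leqNgt jn.
  by apply: nearW => n; rewrite indicE memNset ?mul0r// => -[i _ Fi]; apply: nt; exists i.
- by apply: aeW => t n; rewrite ger0_norm ?mulr_ge0// ler_piMl// indicE; case: (t \in _).
Unshelve. all: by end_near. Qed.

Lemma sum_wmeas n (F : 'I_n -> set R) A : measurable A -> (forall j, measurable (F j)) ->
  (forall j, F j `<=` A) -> trivIset setT F -> \sum_(j < n) wmeas (F j) <= wmeas A.
Proof.
move=> mA mF FA tF; rewrite /wmeas -(@Rintegral_sum _ _ _ _ _ _ (fun j t => \1_(F j) t * W t)); last first.
  by move=> j; exact: integrable_indicW.
apply: le_Rintegral => //.
- by apply: integrableR_sum => j; exact: integrable_indicW.
- exact: integrable_indicW.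
move=> t _; rewrite -mulr_suml ler_wpM2r//.
have [[j tj]|nt] := pselect (exists j, F j t).
  rewrite (bigD1 j)//= big1 ?addr0.
    by rewrite !indicE !mem_set//; exact: FA tj.
  move=> i ij; rewrite indicE memNset// => ti; move: ij.
  by rewrite (tF i j) ?eqxx//; exists t.
by rewrite big1// => j _; rewrite indicE memNset// => tj; apply: nt; exists j.
Qed.

Lemma integrable_indic_fser A x : measurable A -> I.-integrable setT (EFin \o (fun t => \1_A t * fser (c t) x)).
Proof.
move=> mA; apply: (@integrable_bounded _ _ _ _ _ (1 * r0)).
  apply: measurable_funM => //; have mf := measurable_fser2 mc sc.
  exact: (measurableT_comp mf (pair2_measurable x)).
move=> t; rewrite normrM ler_pM//; last exact: fser_le.
by rewrite indicE; case: (t \in A); rewrite ?normr1 ?normr0.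
Qed.

Lemma vmeas_tail (F : nat -> set R) n x : (forall i, measurable (F i)) -> trivIset setT F ->
  vmeas (\bigcup_i F i) x - \sum_(i < n) vmeas (F i) x = vmeas (tail F n) x.
Proof.
move=> mF tF; apply/eqP; rewrite subr_eq eq_sym addrC; apply/eqP; rewrite /vmeas.
under eq_bigr do rewrite Rintegral_indic.
rewrite -(@Rintegral_sum _ _ _ _ _ _ (fun (j : 'I_n) t => \1_(F j) t * fser (c t) x)); last first.
  by move=> j; exact: integrable_indic_fser.
rewrite (Rintegral_indic _ (tail F n)) (Rintegral_indic _ (\bigcup_i F i)).
rewrite -(RintegralD measurableT); last 2 first.
- by apply: integrableR_sum => j; exact: integrable_indic_fser.
- by apply: integrable_indic_fser; exact: measurable_tail.
by apply: eq_Rintegral => t _; rewrite (indic_tail n)// mulrDl mulr_suml.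
Qed.

(** Countable additivity, bounded variation and regularity all reduce to [wmeas]. Since this measure
    is absolutely continuous, the Lebesgue regularity of [A] provides both [K] and [U]. *)
Lemma radon_measure_fser N : dominated N -> radon_measure T N vmeas.
Proof.
move=> [N0 [C C0 NC]].
have Nmu A : measurable A -> (N (vmeas A) <= (C * wmeas A)%:E)%E.
  by move=> mA; have [b bA E] := vmeasE mA; rewrite (_ : vmeas A = fser b) ?NC//; exact/funext.
have var A : measurable A -> (vector_variation N vmeas A <= (C * wmeas A)%:E)%E.
  move=> mA; apply: ge_ereal_sup => _ [n [F [mF FA tF ->]]].
  apply: (@le_trans _ _ (\sum_(j < n) (C * wmeas (F j))%:E)%E); first by apply: lee_sum => j _; exact: Nmu.
  by rewrite sumEFin lee_fin -mulr_sumr ler_wpM2l// sum_wmeas.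
have mT : measurable (`[0, T]%classic : set R) by exact: measurable_itv.
split.
- by move=> A mA _; apply: le_lt_trans (Nmu A mA) _; exact: ltry.
- move=> F mF _ tF; apply: (@squeeze_cvge _ _ _ _ (fun=> 0%E) _ (fun n => (C * wmeas (tail F n))%:E)).
  + apply: nearW => n; rewrite N0/= (_ : (fun x => _) = vmeas (tail F n)).
      by apply: Nmu; exact: measurable_tail.
    by apply/funext => x; exact: vmeas_tail.
  + exact: cvg_cst.
  + apply: cvg_EFin; first by apply: nearW.
    by rewrite -(mulr0 C); apply: cvgMl_tmp; exact: wmeas_tail.
- by apply: le_lt_trans (var _ mT) _; exact: ltry.
move=> A e mA AT e0.
have e1 : 0 < e / (C + 1) by rewrite divr_gt0// ltr_wpDl.
have [dl [dl0 hdl]] := integral_normr_continuous iW e1.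
have Afin : (lebesgue_measure A < +oo)%E.
  apply: (@le_lt_trans _ _ (lebesgue_measure (`[0, T]%classic : set R))).
    by apply: le_measure; rewrite ?inE.
  by rewrite lebesgue_measure_itv/=; case: ifPn => _; rewrite ?ltry// -EFinB ltry.
have dl2 : 0 < dl / 2 by rewrite divr_gt0.
have [U [oU AU UA]] := lebesgue_regularity_outer mA Afin dl2.
have [K [cK KA AK]] := lebesgue_regularity_inner mA Afin dl2.
have mU : measurable U by exact: open_measurable.
have mK : measurable K by apply: closed_measurable; exact: compact_closed.
have mD : measurable ((U `&` `[0, T]) `\` K) by apply: measurableD => //; exact: measurableI.
exists K, U; split => //; apply: le_lt_trans (var _ mD) _.
have small : (I ((U `&` `[0%R, T]) `\` K) < dl%:E)%E.
  apply: (@le_lt_trans _ _ (lebesgue_measure ((U `\` A) `|` (A `\` K)))).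
    rewrite /interval_measure; apply: le_measure; rewrite ?inE.
    - exact: measurableI.
    - by apply: measurableU; exact: measurableD.
    by move=> t [[[Ut _] Kt] _]; have [At|At] := pselect (A t); [right|left].
  apply: le_lt_trans (measureU2 _ _ _) _; [exact: measurableD|exact: measurableD|].
  by rewrite [dl]splitr EFinD; exact: lteD.
have := hdl _ mD small; rewrite Rintegral_indic.
under eq_Rintegral do rewrite (ger0_norm (W0 _)).
rewrite -/(wmeas _) ltr_pdivlMr ?ltr_wpDl// => h; rewrite lte_fin.
by apply: le_lt_trans h; rewrite mulrC ler_wpM2l ?wmeas_ge0// lerDl.
Qed.

Lemma radon_space_fser N : dominated N -> radon_space T N (fun t => fser (c t)).
Proof.
move=> dN; split; last exact: radon_measure_fser.
apply/Lfun1_integrable; apply: (@integrable_bounded_prod _ _ _ _ _ _ _ _ r0).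
  exact: measurable_fser2.
by move=> z; exact: fser_le.
Qed.

End radon.

(** * The initial datum and the conclusion *)

Section initial_datum.
Context {R : realType} {d : nat}.
Local Notation freq := 'rV[int]_d.
Local Notation dx := (torus_measure R d).
Context (v0 : 'rV[R]_d -> R).

Lemma bsum_wiener : (wiener_norm 0 v0 < +oo)%E ->
  bsum (fun=> 1) (fcoef v0) (fine (wiener_norm 0 v0)).
Proof.
move=> wf n; rewrite -lee_fin fineK; last first.
  rewrite ge0_fin_numE//; apply: esum_ge0 => k _.
  by rewrite lee_fin mulr_ge0 ?powR_ge0// normc_fourier amp_ge0.
apply: esum_ge; exists [set` freqs n]; first by split => //; exact: finite_seq.
rewrite -fsbig_seq ?uniq_freqs// sumEFin lee_fin; apply: ler_sum => k _.
by rewrite powRr0 normc_fourier.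
Qed.

Lemma fcoef_mean0 : \int[dx]_x v0 x = 0 -> fcoef v0 0 = 0.
Proof.
move=> m0; rewrite /fcoef /fcos /fsin; congr (_, _).
  under eq_Rintegral do rewrite dotk0 cos0 mulr1.
  by rewrite m0 mulr0.
under eq_Rintegral do rewrite dotk0 sin0 mulr0.
by rewrite Rintegral_cstT mul0r mulr0.
Qed.

End initial_datum.

Theorem theorem2p6 (R : realType) (d : nat) (hd : d = 1%N \/ d = 2%N)
    (v0 : 'rV[R]_d -> R) (hv0 : wiener_space 0 v0)
    (hmean : \int[torus_measure R d]_x v0 x = 0)
    (hsmall : (wiener_norm 0 v0 < 1)%E)
    (hdelta : 0 < delta_rate (fine (wiener_norm 0 v0))) :
  exists v : R -> 'rV[R]_d -> R, forall T : R, 0 < T ->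
    weak_solution T v0 v /\
    [/\ (fun z : R * 'rV[R]_d => v z.1 z.2)
          \in Lfun (interval_measure 0%R T \x torus_measure R d)%E +oo%E,
        bochner T (4 / 3)%:E (sobolev_norm 3 +oo%E) v,
        radon_space T (sobolev_norm 4 +oo%E) v &
        bochner T 2%:E (sobolev2_norm 2) v] /\
    continuous_in T (Lp_norm 2%:E) v /\
    forall t, `[0, T]%classic t ->
      (Lp_norm +oo%E (v t) <=
        (fine (wiener_norm 0 v0) *
          expR (- delta_rate (fine (wiener_norm 0 v0)) * t))%:E)%E.
Proof.
move: hv0 => [/Lfun1_integrable iv0 wf].
set r0 := fine (wiener_norm 0 v0) in hdelta *.
have c0r : bsum (fun=> 1) (fcoef v0) r0 := bsum_wiener wf.
have r1 : r0 < 1.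
  rewrite -lte_fin fineK// ge0_fin_numE//; apply: esum_ge0 => k _.
  by rewrite lee_fin mulr_ge0 ?powR_ge0// normc_fourier amp_ge0.
have c0sym := fcoef_sym iv0; have c00 := fcoef_mean0 hmean.
have [phi [c [phi_ge cvc clip]]] := path_subseq c0r r1 hdelta.
have cinit t : t <= 0 -> c t = fcoef v0 by exact: lim_init.
have csy := lim_sym cvc; have cb := lim_bsum c0r r1 hdelta cvc.
have cdecay t : 0 <= t -> bsum (fun=> 1) (c t) (r0 * expR (- delta_rate r0 * t)).
  exact: lim_decay cvc _.
have cc := lim_continuous r1 clip; have mP := measurable_flux c0r r1 hdelta cvc clip.
have cmom n T : 0 <= T -> \int[interval_measure 0 T]_t
    (\sum_(k <- freqs n) normk R k ^+ 4 * amp (c t k)) <= r0 / delta_rate r0.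
  exact: (lim_moment c0r r1 hdelta cvc).
have ceq k t : 0 <= t -> c t k = fcoef v0 k + smul (normk R k ^+ 4)
    (\int[interval_measure 0 t]_s (flux c s k).1, \int[interval_measure 0 t]_s (flux c s k).2).
  exact: lim_equation phi_ge cvc clip k _.
have sc t : summable_coef (c t) by exists r0; exact: cb.
have mc k : measurable_fun setT (fun t => (c t k).1) /\ measurable_fun setT (fun t => (c t k).2).
  by have [h1 h2] := cc k; split; exact: continuous_measurable_fun.
have B0 : 0 <= (1 - r0) ^- 3 by rewrite invr_ge0 exprn_ge0// subr_ge0 ltW.
have int_moment4 T : 0 <= T -> (\int[interval_measure 0 T]_t moment4 c t < +oo)%E.
  by move=> T0; apply: le_lt_trans (moment4_integral cb cc cmom T0) _; exact: ltry.
exists (fun t => fser (c t)) => T T0; have T0' := ltW T0.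
split; [split|split; [split|split]].
- exact: (bochner_infty cb B0 clip cc int_moment4 T0').
- move=> phi0 [sphi pphi [S ST phi00]].
  pose Phi (z : R * 'rV[R]_d) := phi0 z.1 z.2.
  have -> : weak_integrand phi0 (fun t => fser (c t)) = fun t x =>
      dtime Phi (t, x) * fser (c t) x + bilap Phi (t, x) * cube (c t) x.
    apply/funext => t; apply/funext => x; rewrite /weak_integrand /cube derive1E.
    by have [_ <-] := dtime_is_derive (Phi := Phi) sphi t x.
  split.
    apply/Lfun1_integrable; have := weak_integrable r1 cb cc T (Phi := Phi) sphi pphi.
    by congr (_.-integrable _ _); apply/funext => -[t x].
  exact: (weak_identity r1 cinit cb cc cmom ceq mP csy T0 (Phi := Phi) sphi pphi ST phi00 iv0 (fun=> erefl)).
- apply: (@Lfun_infty_bounded _ _ _ _ _ r0); first exact: measurable_fser2.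
  by move=> z; exact: fser_le.
- exact: (bochner_sobolev cb B0 clip cc int_moment4 T0').
(* In the weight 1 + |k|^4 the first summand is controlled by [r0] and the second by the fourth
   moment, finite at almost every time. *)
- apply: (radon_space_fser (W := fun t => r0 + rmoment4 c t) cb mc).
  + by move=> t; rewrite addr_ge0 ?rmoment4_ge0//; exact: bsum_ge0 (cb 0).
  + apply: integrableRD; last exact: integrable_rmoment4.
    exact: (@integrable_bounded _ _ _ _ _ `|r0|).
  + by apply: filterS (ae_rmoment4 cb cc cmom T0') => t Et; apply: (bsum_weight4_moment4 cb); rewrite Et.
  + exact: dominated_sobolev.
- exact: (bochner_sobolev2 cb B0 clip cc int_moment4 T0').
- move=> t _; split; first by apply: le_lt_trans (Lp_norm2_fser (cb t)) _; exact: ltry.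
  apply/fine_cvgP; split.
    apply: nearW => s; rewrite ge0_fin_numE ?Lp_norm_ge0//.
    rewrite (_ : (fun x => _) = fser (fun k => c s k - c t k)); last by apply/funext => x; rewrite fserB.
    have cN : bsum (fun=> 1) (fun k => - c t k) r0.
      by move=> n; under eq_bigr do rewrite ampN; exact: cb.
    by apply: le_lt_trans (Lp_norm2_fser (bsumD (fun=> ler01) (cb s) cN)) _; exact: ltry.
  apply/cvgrPdist_le => e e0.
  have V0 : 0 < Num.sqrt ((2 * pi) ^+ d : R) by rewrite sqrtr_gt0 exprn_gt0// mulr_gt0// pi_gt0.
  (* Passing from the l^1 norm of the coefficients to the L^2 norm costs the square root of the
     volume of the torus. *)
  have e1 : 0 < e / Num.sqrt ((2 * pi) ^+ d) by rewrite divr_gt0.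
  have [eta eta0 ceta] := c_near r1 cinit cb cc cmom ceq mP t e1.
  apply: filterS (_ : within `[0, T] (nbhs t) (fun s => `|s - t| < eta)); last first.
    by exists eta => //= s st _; rewrite distrC.
  move=> s /ceta cs; rewrite sub0r normrN /=.
  rewrite (_ : (fun x => _) = fser (fun k => c s k - c t k)); last by apply/funext => x; rewrite fserB.
  have := Lp_norm2_fser cs; rewrite divfK ?gt_eqF// => le.
  rewrite ger0_norm ?fine_ge0 ?Lp_norm_ge0// -lee_fin fineK//.
  by rewrite ge0_fin_numE ?Lp_norm_ge0// (le_lt_trans le)// ltry.
move=> t; rewrite /= in_itv/= => /andP[t0 _].
by apply: Lp_norm_infty_fser; exact: cdecay.
Qed.
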